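(* Let $n\ge0$ be an integer. Let $u_0\in\mathcal{S}([0,\infty))$ and $g_0\in C^\infty([0,\infty))$ be such that $$\frac{d^{2\ell}u_0(x)}{dx^{2\ell}}\bigg|_{x=0}=\frac{d^\ell g_0(t)}{dt^\ell}\bigg|_{t=0}\quad\text{for }0\le\ell\le n .$$ Let $u(x,t)$ be defined for $(x,t)\in Q=\{(x,t)\in\mathbb{R}^2:x>0,\ t>0\}$ by $$u(x,t)=\frac{1}{2\pi}\int_{-\infty}^{\infty}e^{i\lambda x-\lambda^2t}\,\hat u_0(\lambda)\,d\lambda-\frac{1}{2\pi}\int_{\Gamma}e^{i\lambda x-\lambda^2t}\,\hat u_0(-\lambda)\,d\lambda-\frac{i}{\pi}\int_{\Gamma}e^{i\lambda x-\lambda^2t}\,\lambda\,\tilde g_0(\lambda,t)\,d\lambda ,$$ and let $\partial^ku/\partial x^k$ also denote the continuous extension of this derivative from $Q$ to $\overline{Q}\setminus\{(0,0)\}$. Then $$\lim_{\overline{Q}\ni(x,t)\to(0,0)}\frac{\partial^ku(x,t)}{\partial x^k}=\frac{d^ku_0(x)}{dx^k}\bigg|_{x=0}\quad\text{for }0\le k\le2n+1 .$$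
   Context: Function spaces: a $C^\infty$ function $f:(0,\infty)\to\mathbb{C}$ belongs to $C^\infty([0,\infty))$ if $\lim_{x\to0^+}\frac{d^Nf(x)}{dx^N}$ exists for every integer $N\ge0$ (equivalently, $f$ extends to a $C^\infty$ function on $\mathbb{R}$); values of $f$ and its derivatives at $0$ denote these limits. $f\in\mathcal{S}([0,\infty))$ means $f\in C^\infty([0,\infty))$ and $\sup_{x\ge0}\left|x^M\frac{d^Nf(x)}{dx^N}\right|<\infty$ for all integers $M,N\ge0$. Transforms: $\hat u_0(\lambda)=\int_0^\infty u_0(x)e^{-i\lambda x}\,dx$ for $\lambda\in\mathbb{C}$ with $\operatorname{Im}\lambda\le0$; $\tilde g_0(\lambda,t)=\int_0^te^{\lambda^2\tau}g_0(\tau)\,d\tau$ for $\lambda\in\mathbb{C}$. Contour: $\Gamma=\{\lambda\in\mathbb{C}:\operatorname{Im}\lambda\ge0,\ \operatorname{Re}(\lambda^2)=0\}$ is the positively oriented boundary of $\Omega^-=\{\lambda\in\mathbb{C}:\operatorname{Im}\lambda\ge0,\ \operatorname{Re}(\lambda^2)\le0\}$, i.e. it comes in from infinity along the ray $\arg\lambda=3\pi/4$ to $0$ and then goes out to infinity along the ray $\arg\lambda=\pi/4$. For any $u_0\in\mathcal{S}([0,\infty))$, $g_0\in C^\infty([0,\infty))$, the function $u$ is $C^\infty$ on $Q$ and all its partial derivatives extend continuously to $\overline{Q}\setminus\{(0,0)\}$, where $\overline{Q}=\{x\ge0,\ t\ge0\}$; the limits are taken over $(x,t)\in\overline{Q}\setminus\{(0,0)\}$.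 *)

(* Defs.v *)
From mathcomp Require Import all_boot all_order all_algebra.
From mathcomp Require Import all_classical all_reals all_analysis.
From mathcomp Require Export complex.

Set Implicit Arguments.
Unset Strict Implicit.
Unset Printing Implicit Defensive.

Import Order.TTheory GRing.Theory Num.Theory.
Import numFieldNormedType.Exports.

Local Open Scope classical_set_scope.
Local Open Scope complex_scope.
Local Open Scope ring_scope.

(* R[i] as a numClosedFieldType: the library topology of a numClosedFieldType,
   given by its modulus, is only inferred through this sort. *)
Definition cplx (R : realType) : numClosedFieldType := R[i].

Section ComplexCalculus.
Variable R : realType.

Definition cexp (z : R[i]) : R[i] :=
  (expR (complex.Re z))%:C * (cos (complex.Im z) +i* sin (complex.Im z)).

(* Lebesgue integral of a complex-valued function of a real variable *)
Definition cintegral (D : set R) (f : R -> R[i]) : R[i] :=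
  (\int[lebesgue_measure]_(x in D) complex.Re (f x))%R +i*
  (\int[lebesgue_measure]_(x in D) complex.Im (f x))%R.

Definition cderivable (f : R -> R[i]) (x : R) : Prop :=
  derivable (fun y => complex.Re (f y)) x 1 /\ derivable (fun y => complex.Im (f y)) x 1.

Definition cderive1n (N : nat) (f : R -> R[i]) (x : R) : R[i] :=
  derive1n N (fun y => complex.Re (f y)) x +i* derive1n N (fun y => complex.Im (f y)) x.

End ComplexCalculus.

Section HalfLine.
Variable R : realType.

(* A function on ]0, +oo[ is represented by a total function on R; its values
   on ]-oo, 0] are never used. *)
Definition hderive (N : nat) (f : R -> R[i]) (x : R) : cplx R :=
  if 0 < x then cderive1n N f x
  else lim ((cderive1n N f y : cplx R) @[y --> 0^'+]).

Definition smooth_half (f : R -> R[i]) : Prop :=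
  forall N : nat,
    (forall x : R, 0 < x -> cderivable (cderive1n N f) x) /\
    cvg ((cderive1n N f y : cplx R) @[y --> (0 : R)^'+]).

Definition schwartz_half (f : R -> R[i]) : Prop :=
  smooth_half f /\
  forall M N : nat, exists B : R, forall x : R, 0 <= x ->
    `| x%:C ^+ M * hderive N f x | <= B%:C.

End HalfLine.

Section Solution.
Variable R : realType.

Definition hat (u0 : R -> R[i]) (l : R[i]) : R[i] :=
  cintegral `]0, +oo[ (fun x => u0 x * cexp (- 'i%C * l * x%:C)).

Definition tilde (g0 : R -> R[i]) (l : R[i]) (t : R) : R[i] :=
  cintegral `]0, t[ (fun s => cexp (l ^+ 2 * s%:C) * g0 s).

(* integral along the ray of argument a, oriented away from the origin *)
Definition ray_integral (a : R) (F : R[i] -> R[i]) : R[i] :=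
  cintegral `]0, +oo[ (fun r => F (r%:C * cexp ('i%C * a%:C)) * cexp ('i%C * a%:C)).

(* Gamma comes in along arg = 3 pi / 4 and goes out along arg = pi / 4. *)
Definition Gamma_integral (F : R[i] -> R[i]) : R[i] :=
  ray_integral (pi / 4) F - ray_integral (3 * pi / 4) F.

Definition usol (u0 g0 : R -> R[i]) (x t : R) : R[i] :=
  (2 * pi)^-1%:C *
    cintegral setT (fun l =>
      cexp ('i%C * l%:C * x%:C - l%:C ^+ 2 * t%:C) * hat u0 l%:C)
  - (2 * pi)^-1%:C *
    Gamma_integral (fun l =>
      cexp ('i%C * l * x%:C - l ^+ 2 * t%:C) * hat u0 (- l))
  - 'i%C * (pi^-1)%:C *
    Gamma_integral (fun l =>
      cexp ('i%C * l * x%:C - l ^+ 2 * t%:C) * l * tilde g0 l t).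

End Solution.

Section Quadrant.
Variable R : realType.

Definition quadrant : set (R * R) := [set p | 0 < p.1 /\ 0 < p.2].

Definition closed_quadrant0 : set (R * R) :=
  [set p | [/\ 0 <= p.1, 0 <= p.2 & p <> (0, 0)]].

Definition dxn (k : nat) (u : R -> R -> R[i]) (p : R * R) : R[i] :=
  cderive1n k (fun x => u x p.2) p.1.

(* v is the k-th x-derivative of u on the open quadrant, together with its
   continuous extension to the closed quadrant minus the origin; v is
   determined on that set, the open quadrant being dense in it. *)
Definition dxn_extension (k : nat) (u : R -> R -> R[i]) (v : R * R -> cplx R) :
    Prop :=
  [/\ forall p, quadrant p -> forall j : nat, (j < k)%N ->
        cderivable (cderive1n j (fun x => u x p.2)) p.1,
      forall p, quadrant p -> v p = dxn k u p &
      {within closed_quadrant0, continuous v}].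

End Quadrant.

(* Main.v *)
Require Import Defs.
From mathcomp Require Import all_boot all_order all_algebra.
From mathcomp Require Import all_classical all_reals all_analysis.
From mathcomp Require Import measurable_realfun zify ring lra.
Import Order.TTheory GRing.Theory Num.Theory.
Import numFieldNormedType.Exports.
Local Open Scope classical_set_scope.
Local Open Scope complex_scope.
Local Open Scope ring_scope.
Set Implicit Arguments.
Unset Strict Implicit.
Unset Printing Implicit Defensive.

(** Deforming the contour on rays and using Fubini turns the three contour integrals into heat
    potentials of [u0] and [g0] for the kernel [heat w t = exp (- w^2 / (4 t)) / sqrt (4 pi t)]:
    the convolution with [u0], minus its mirror image in [x], plus twice the Duhamel integral of the
    dipole [heat1 = d/dw heat].  Let [Psi] be the [w]-primitive of [heat] vanishing at [-oo]
    (an error function).  Integrating by parts in [y] and in [s], and using that [Psi] solves the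
    heat equation, moves all singular kernels onto derivatives of the data: up to a constant,
    [u] becomes an integral of [Psi] against [u0'] plus a Duhamel integral of [Psi] against [g0'],
    the boundary terms cancelling because [u0 0 = g0 0].  Each further [x]-derivative, followed by
    one more integration by parts, yields an expression of the same shape with the next
    derivatives of the data, alternating between a Dirichlet form (odd reflection) and a Neumann
    form (the same with the even reflection and [Theta], a primitive of [Psi]); the passage from
    order [2 l + 1] to [2 l + 2] is where the compatibility condition of index [l + 1] is used.
    The kernels [Psi] and [Theta] are bounded and, for almost all values of the integration
    variable, continuous up to the boundary of the quadrant, so that dominated convergence
    gives the continuous extension, and at the origin only the constant term survives. *)

(** * Lebesgue integrals of real functions *)

Section Toolkit.
Context {R : realType}.
Notation mu := (@lebesgue_measure R).
Implicit Types (D : set R) (f g : R -> R).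

(** The obstacle is the corner: [heat] and [heat1] are unbounded there, and [Psi], though bounded,
    has no limit there. Under an integral a bounded kernel does no harm, so everything depends on
    the boundary terms. In a Dirichlet form they add up to [a * Psi x t - a * Psi (- x) t + 2 * b *
    Psi (- x) t], where [a] is the trace at 0 of the space datum and [b] that of the time datum.
    Since [Psi x t + Psi (- x) t = 1], this is [a + 2 * (b - a) * Psi (- x) t], a constant as soon
    as the traces agree. In a Neumann form the time trace multiplies [Theta], which is continuous
    and zero at the origin, so no condition is consumed. Hence [n + 1] conditions reach order
    [2 n + 1]: a mismatch of index [n + 1] first shows at order [2 n + 2]. Cauchy's theorem is
    replaced by differentiating a real integral with respect to the slope of the ray. The resulting
    kernels are real, so the real and imaginary parts of the data obey the same real statements. *)

Definition intble (D : set R) (f : R -> R) := mu.-integrable D (EFin \o f).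

Lemma intble_meas D f : intble D f -> measurable_fun D f.
Proof. by move=> /integrableP[/measurable_EFinP]. Qed.

Lemma intble_eq D f g : {in D, f =1 g} -> measurable D -> intble D f -> intble D g.
Proof. by move=> fg mD; apply: eq_integrable => // x /fg /= ->. Qed.

Lemma intbleD D f g : measurable D -> intble D f -> intble D g ->
  intble D (fun x => f x + g x).
Proof. by move=> mD fi gi; apply: eq_integrable (@integrableD _ (measurableTypeR R) R mu D mD _ _ fi gi). Qed.

Lemma intbleB D f g : measurable D -> intble D f -> intble D g ->
  intble D (fun x => f x - g x).
Proof. by move=> mD fi gi; apply: eq_integrable (@integrableB _ (measurableTypeR R) R mu D mD _ _ fi gi). Qed.

Lemma intbleZl D f (k : R) : measurable D -> intble D f -> intble D (fun x => k * f x).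
Proof. by move=> mD fi; apply: eq_integrable (@integrableZl _ (measurableTypeR R) R mu D mD k _ fi). Qed.

Lemma intble_le D f g : measurable D -> measurable_fun D f ->
  (forall x, D x -> `|f x| <= g x) -> intble D g -> intble D f.
Proof.
move=> mD mf fg; apply: le_integrable => //; first exact/measurable_EFinP.
by move=> x Dx; rewrite /= lee_fin (le_trans (fg _ Dx)) ?ler_norm.
Qed.

Lemma intble_norm D f : measurable D -> intble D f -> intble D (fun x => `|f x|).
Proof. by move=> mD fi; apply: eq_integrable (@integrable_norm _ (measurableTypeR R) R mu D _ fi). Qed.

Lemma intble_bndM D f g (M : R) : measurable D -> measurable_fun D g ->
  (forall x, D x -> `|g x| <= M) -> intble D f -> intble D (fun x => g x * f x).
Proof.
move=> mD mg gM fi.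
apply: (@intble_le _ _ (fun x => M * `|f x|)) => //.
- by apply: measurable_funM => //; exact: intble_meas.
- by move=> x Dx; rewrite normrM ler_wpM2r// gM.
- exact/intbleZl/intble_norm.
Qed.

Lemma open_cont_meas (D : set R) (f : R -> R) : open D ->
  (forall x, D x -> {for x, continuous f}) -> measurable_fun D f.
Proof.
by move=> oD cf; apply: open_continuous_measurable_fun => // x; rewrite inE; exact: cf.
Qed.

Lemma intble_oo_bnd (a b M : R) (f : R -> R) : measurable_fun `]a, b[ f ->
  (forall x, a < x < b -> `|f x| <= M) -> intble `]a, b[ f.
Proof.
move=> mf fM; apply: measurable_bounded_integrable => //.
  by rewrite /= lebesgue_measure_itv/=; case: ifPn => //= _; rewrite -EFinD ltry.
exists M; split; first exact: num_real.
by move=> N MN x /=; rewrite in_itv/= => xab; rewrite (le_trans (fM _ xab))// ltW.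
Qed.

Lemma Rint_norm_le D f g : measurable D -> intble D f -> intble D g ->
  (forall x, D x -> `|f x| <= g x) ->
  `|\int[mu]_(x in D) f x| <= \int[mu]_(x in D) g x.
Proof.
move=> mD fi gi fg; apply: le_trans (@le_normr_Rintegral _ (measurableTypeR R) R mu _ _ mD fi) _.
by apply: le_Rintegral => //; exact: intble_norm.
Qed.

(* A countable base of the filter reduces the statement to sequences. *)
Lemma dominated_cvg_filter {T : Type} (F : set_system T) {FF : Filter F}
    (B : nat -> set T) (D : set R) (f : T -> R -> R) (g l : R -> R) :
  (forall n, F (B n)) -> (forall A, F A -> exists n, forall m, (n <= m)%N -> B m `<=` A) ->
  measurable D -> intble D g -> measurable_fun D l ->
  (\forall p \near F, measurable_fun D (f p)) ->
  (\forall p \near F, forall y, D y -> `|f p y| <= g y) ->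
  {ae mu, forall y, D y -> f p y @[p --> F] --> l y} ->
  (\int[mu]_(y in D) f p y) @[p --> F] --> \int[mu]_(y in D) l y.
Proof.
move=> FB BF mD gi ml mf fg fl.
apply/cvgrPdist_lt => e e0; apply: contrapT => nF.
have [n0 Hn0] := BF _ (filterI mf fg).
have : forall n, exists p, B (n0 + n)%N p /\
    e <= `|\int[mu]_(y in D) l y - \int[mu]_(y in D) f p y|.
  move=> n; apply: contrapT => H; apply: nF.
  apply: filterS (FB (n0 + n)%N) => p Bp.
  by rewrite ltNge; apply/negP => le; apply: H; exists p.
move=> /choice[p] /all_and2[Bp ep].
have pn A : F A -> \forall n \near \oo, A (p n).
  move=> /BF[n Hn]; exists n => // m /= nm; apply: (Hn (n0 + m)%N) => //.
  exact: leq_trans nm (leq_addl _ _).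
have mp n : measurable_fun D (f (p n)).
  by have [] := Hn0 (n0 + n)%N (leq_addr _ _) _ (Bp n).
have gp n : forall y, D y -> `|f (p n) y| <= g y.
  by have [_] := Hn0 (n0 + n)%N (leq_addr _ _) _ (Bp n).
have afl : {ae mu, forall y, D y -> (f (p n) y)%:E @[n --> \oo] --> (l y)%:E}.
  case: fl => N [mN N0 sN]; exists N; split => // y nH; apply: sN => Hy; apply: nH.
  by move=> Dy; apply: cvg_EFin; [exact: nearW|move=> A /(Hy Dy); exact: pn].
have [il _ cv] := @dominated_convergence _ (measurableTypeR R) R mu D mD
  (fun n y => (f (p n) y)%:E) (EFin \o l) (EFin \o g)
  (fun n => (measurable_EFinP _ _).2 (mp n)) ((measurable_EFinP _ _).2 ml)
  afl gi ltac:(apply: aeW => y n Dy; rewrite /= lee_fin; exact: gp).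
have {}cv : (\int[mu]_(y in D) f (p n) y) @[n --> \oo] --> \int[mu]_(y in D) l y.
  apply: fine_cvg; rewrite fineK; first exact: cv.
  exact: integrable_fin_num.
move/cvgrPdist_lt : cv => /(_ _ e0)[n _ /(_ n (leqnn _))] /=.
by rewrite ltNge ep.
Qed.

(** The compact intervals [[a_ n, b_ n]] exhaust [D]; the fundamental theorem holds on each of them,
    and dominated convergence with bound [|f|] passes to the limit. Bounded intervals, half-lines
    and the whole line are treated at once in this way. *)
Lemma FTC_seq (F f : R -> R) (D : set R) (a_ b_ : nat -> R) (la lb : R) :
  measurable D -> (forall n, a_ n < b_ n) ->
  (forall n y, a_ n <= y <= b_ n -> D y) ->
  (forall y, D y -> \forall n \near \oo, a_ n <= y <= b_ n) ->
  (forall y, D y -> is_derive y 1 F (f y)) ->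
  (forall y, D y -> {for y, continuous f}) ->
  intble D f -> F (a_ n) @[n --> \oo] --> la -> F (b_ n) @[n --> \oo] --> lb ->
  \int[mu]_(y in D) f y = lb - la.
Proof.
move=> mD ab abD Dab dF cf fi Fa Fb.
have E n : \int[mu]_(y in `[a_ n, b_ n]) f y = F (b_ n) - F (a_ n).
  rewrite /Rintegral (@continuous_FTC2 _ f F) ?EFinB//.
  - by apply: continuous_in_subspaceT => x; rewrite inE/= in_itv/= => /abD; exact: cf.
  - have cF x : a_ n <= x <= b_ n -> {for x, continuous F}.
      move=> /abD/dF dFx; apply: differentiable_continuous.
      exact/derivable1_diffP.
    split.
    + by move=> x /subset_itv_oo_cc; rewrite /= in_itv/= => /abD/dF[].
    + apply: cvg_at_right_filter; apply: cF.
      by rewrite lexx ltW ?ab.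
    + apply: cvg_at_left_filter; apply: cF.
      by rewrite lexx ltW ?ab.
  - move=> x /subset_itv_oo_cc; rewrite /= in_itv/= => /abD/dF[_].
    by rewrite derive1E.
apply: (@cvg_unique _ _ (F (b_ n) - F (a_ n) @[n --> \oo])) => //; last exact: cvgB.
(* The truncated integrals are rewritten over the fixed set [D], with [f] set to zero outside
   [[a_ n, b_ n]]. *)
have -> : (fun n => F (b_ n) - F (a_ n)) =
    (fun n => \int[mu]_(y in D) (f \_ `[a_ n, b_ n]) y).
  apply/funext => n; rewrite -E Rintegral_mkcond [RHS]Rintegral_mkcond.
  apply: eq_Rintegral => y _; rewrite /patch; case: ifPn => // yab.
    by rewrite ifT// inE; apply: (abD n); move: yab; rewrite inE/= in_itv.
  by case: ifPn.
have mf := intble_meas fi.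
apply: (@dominated_cvg_filter _ _ _ (fun n => [set m | (n <= m)%N]) _ _
   (fun y => `|f y|)) => //.
- by move=> n; exists n.
- move=> A [n _ nA]; exists n => m nm k /= mk; apply: nA => /=.
  exact: leq_trans nm mk.
- exact: intble_norm.
- apply: nearW => n; apply/(measurable_restrict _ _ mD) => //.
  by apply: measurable_funS mf => // x [].
- apply: nearW => n y Dy; rewrite /patch; case: ifPn => //.
  by rewrite normr0.
- apply: aeW => y Dy; apply: cvg_near_cst; apply: filterS (Dab y Dy) => n ny.
  by rewrite /patch ifT// inE /= in_itv.
Qed.

Let left_seq (a d : R) : a + d * harmonic n @[n --> \oo] --> a.
Proof.
rewrite -[X in _ --> X]addr0 -[X in _ + X](mulr0 d).
by apply: cvgD; [exact: cvg_cst|apply: cvgMr; exact: cvg_harmonic].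
Qed.

Let harm_le1 n : @harmonic R n <= 1.
Proof. by rewrite /harmonic/= invf_le1// ler1n. Qed.

Lemma FTC_oo (F f : R -> R) (a b la lb : R) : a < b ->
  (forall y, a < y < b -> is_derive y 1 F (f y)) ->
  (forall y, a < y < b -> {for y, continuous f}) ->
  intble `]a, b[ f -> F y @[y --> a^'+] --> la -> F y @[y --> b^'-] --> lb ->
  \int[mu]_(y in `]a, b[) f y = lb - la.
Proof.
move=> ab dF cf fi Fa Fb.
(* As [harmonic n] is at most 1, a third of the length keeps the left end below the right end for
   every [n]. *)
pose d := (b - a) / 3; have d0 : 0 < d by rewrite divr_gt0// subr_gt0.
have db : b = a + 3 * d by rewrite /d; field.
have h0 n : 0 < d * @harmonic R n by rewrite mulr_gt0// harmonic_gt0.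
have h1 n : d * @harmonic R n <= d by rewrite ler_piMr// ltW.
apply: (@FTC_seq F f `]a, b[ (fun n => a + d * harmonic n)
  (fun n => b + - d * harmonic n)) => //.
- by move=> n /=; rewrite mulNr; move: (h1 n) (h0 n) db d0; move: (d * _) => h; lra.
- move=> n y; rewrite /= in_itv/= mulNr => /andP[]; move: (h0 n); move: (d * _) => h *.
  by apply/andP; split; lra.
- move=> y; rewrite /= in_itv/= => /andP[ay yb].
  near=> n; apply/andP; split; apply: ltW; near: n.
    exact: (cvgr_lt _ (@left_seq a (d))).
  exact: (cvgr_gt _ (@left_seq b (- d))).
- move/cvg_at_rightP : Fa; apply; split => // n; by rewrite ltrDl.
- move/cvg_at_leftP : Fb; apply; split => // n; by rewrite gtrDl mulNr oppr_lt0.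
Unshelve. all: by end_near. Qed.

Lemma FTC_oy (F f : R -> R) (a la lb : R) :
  (forall y, a < y -> is_derive y 1 F (f y)) ->
  (forall y, a < y -> {for y, continuous f}) ->
  intble `]a, +oo[ f -> F y @[y --> a^'+] --> la -> F y @[y --> +oo] --> lb ->
  \int[mu]_(y in `]a, +oo[) f y = lb - la.
Proof.
move=> dF cf fi Fa Fb.
have h0 n : 0 < @harmonic R n by rewrite harmonic_gt0.
have by_ : (a + 2 + n%:R : R) @[n --> \oo] --> +oo.
  apply/cvgryPge => A; near=> n; rewrite -lerBlDl; near: n.
  exact: nbhs_infty_ger.
apply: (@FTC_seq F f `]a, +oo[ (fun n => a + 1 * harmonic n)
  (fun n => a + 2 + n%:R)) => //.
- move=> n /=; rewrite mul1r; have /= := harm_le1 n; move: (ler0n R n); move: (_^-1) => h; lra.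
- move=> n y; rewrite /= in_itv/= mul1r => /andP[]; have /= := h0 n; move: (_^-1) => h *.
  by rewrite andbT; lra.
- move=> y; rewrite /= in_itv/= andbT => ay.
  near=> n; apply/andP; split; last by near: n; move/cvgryPge : by_; exact.
  by apply: ltW; near: n; exact: (cvgr_lt _ (@left_seq a (1))).
- by move=> y; rewrite /= in_itv/= andbT; exact: dF.
- by move=> y; rewrite /= in_itv/= andbT; exact: cf.
- apply: ((cvg_at_rightP _ _ _).1 Fa (fun n => a + 1 * harmonic n)); split => //.
  by move=> n; rewrite ltrDl mul1r.
- by move/cvg_pinftyP : Fb; apply.
Unshelve. all: by end_near. Qed.

Lemma FTC_T (F f : R -> R) (la lb : R) :
  (forall y : R, is_derive y 1 F (f y)) -> continuous f ->
  intble setT f -> F y @[y --> -oo] --> la -> F y @[y --> +oo] --> lb ->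
  \int[mu]_y f y = lb - la.
Proof.
move=> dF cf fi Fa Fb.
have oy : (n.+1%:R : R) @[n --> \oo] --> +oo.
  apply/cvgryPge => A; near=> n; apply: (@le_trans _ _ n%:R).
    by near: n; exact: nbhs_infty_ger.
  by rewrite ler_nat.
have oNy : (- n.+1%:R : R) @[n --> \oo] --> -oo.
  apply/cvgrNyPle => A; near=> n; rewrite lerNl; near: n.
  exact: ((cvgryPge _).1 oy).
apply: (@FTC_seq F f setT (fun n => - n.+1%:R) (fun n => n.+1%:R)) => //.
- by move=> n; rewrite (@lt_trans _ _ 0)// oppr_lt0.
- move=> y _; near=> n; apply/andP; split; near: n.
    by move/cvgrNyPle : oNy; exact.
  by move/cvgryPge : oy; exact.
- by move=> y _; exact: cf.
- by move/cvg_ninftyP : Fa; apply.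
- by move/cvg_pinftyP : Fb; apply.
Unshelve. all: by end_near. Qed.

(** Domination is asked for near [a] only, because the bounds on the kernels below degenerate as the
    parameter tends to 0. *)
Lemma is_derive_under_integral (D : set R) (f df : R -> R -> R) (G : R -> R) (a e : R) :
  measurable D -> 0 < e ->
  (forall x, `|x - a| < e -> intble D (f x)) ->
  (forall x y, `|x - a| < e -> D y -> is_derive x 1 (f ^~ y) (df x y)) ->
  intble D G -> (forall x y, `|x - a| < e -> D y -> `|df x y| <= G y) ->
  is_derive a 1 (fun x => \int[mu]_(y in D) f x y) (\int[mu]_(y in D) df a y).
Proof.
move=> mD e0 fi fd Gi dG.
have I x : [set` `]a - e, a + e[] x -> `|x - a| < e.
  by rewrite /= in_itv/= => H; rewrite ltr_norml; lra.
have Ia : [set` `]a - e, a + e[] a by rewrite /= in_itv/=; lra.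
have dE x y : `|x - a| < e -> D y -> partial1of2 f x y = df x y.
  by move=> xa Dy; rewrite partial1of2E; case: (fd x y xa Dy).
have Gi' : intble D (fun y => `|G y|) by exact: intble_norm.
have h1 : forall x, [set` `]a - e, a + e[] x -> intble D (f x) by move=> x /I; exact: fi.
have h2 : forall x y, [set` `]a - e, a + e[] x -> D y -> derivable (f ^~ y) x 1.
  by move=> x y /I xa Dy; case: (fd x y xa Dy).
have h3 : forall x y, [set` `]a - e, a + e[] x -> D y -> `|partial1of2 f x y| <= `|G y|.
  by move=> x y /I xa Dy; rewrite dE// (le_trans (dG _ _ xa Dy))// ler_norm.
split.
- exact: (@derivable_under_integral _ _ (measurableTypeR R) mu f D mD a (a - e) (a + e)
    Ia h1 h2 _ (fun=> normr_ge0 _) Gi' h3).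
- rewrite -derive1E.
  rewrite (@differentiation_under_integral _ _ (measurableTypeR R) mu f D mD a (a - e) (a + e)
    Ia h1 h2 _ (fun=> normr_ge0 _) Gi' h3).
  by apply: eq_Rintegral => y; rewrite inE => Dy; apply: dE => //; rewrite subrr normr0.
Qed.

End Toolkit.

(** * Fubini's theorem for a dominated kernel against an integrable function *)

Section Fubini.
Context {R : realType}.
Notation mu := (@lebesgue_measure R).
Notation TR := (measurableTypeR R).
Implicit Types (D : set R) (f g : R -> R).

Lemma Rint_indicM D f : \int[mu]_(x in D) f x = \int[mu]_x (\1_D x * f x).
Proof.
rewrite Rintegral_mkcond; apply: eq_Rintegral => x _.
by rewrite /patch indicE; case: ifPn => xD; rewrite ?mul1r ?mul0r.
Qed.

Lemma Rint_eq0 D f : (forall x, f x = 0) -> \int[mu]_(x in D) f x = 0.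
Proof.
by move=> f0; rewrite /Rintegral (_ : (fun x => _) = cst 0%E) ?integral0//;
  apply/funext => x; rewrite /= f0.
Qed.

Lemma intble_indicM D f : measurable D -> intble D f <-> intble setT (fun x => \1_D x * f x).
Proof.
move=> mD; rewrite /intble (@integrable_mkcond _ TR R mu D _ mD).
by split; apply: eq_integrable => // x _; rewrite /patch/= indicE; case: ifPn => xD;
  rewrite ?mul1r ?mul0r.
Qed.

(** The product [a r * |f y|] dominates, so Tonelli gives integrability on the plane. Keeping [f]
    apart from [A] separates a datum known only to be integrable from an explicit, jointly
    measurable kernel. *)
Lemma Rfubini (A : TR * TR -> R) f a D1 D2 :
  measurable D1 -> measurable D2 -> measurable_fun setT A ->
  intble D1 a -> intble D2 f ->
  (forall r y, D1 r -> D2 y -> `|A (r, y)| <= a r) ->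
  [/\ intble D1 (fun r => \int[mu]_(y in D2) (f y * A (r, y))),
      intble D2 (fun y => f y * \int[mu]_(r in D1) A (r, y)) &
      \int[mu]_(r in D1) \int[mu]_(y in D2) (f y * A (r, y)) =
      \int[mu]_(y in D2) (f y * \int[mu]_(r in D1) A (r, y))].
Proof.
move=> m1 m2 mA ai fi Aa.
have mA1 y : measurable_fun setT (fun r => A (r, y)).
  by apply: (measurableT_comp mA); apply: measurable_fun_pair.
have mA2 r : measurable_fun setT (fun y => A (r, y)).
  by apply: (measurableT_comp mA); apply: measurable_fun_pair.
pose f' x := \1_D2 x * f x; pose a' x := \1_D1 x * a x.
have fi' : intble setT f' by apply: (intble_indicM f m2).1.
have ai' : intble setT a' by apply: (intble_indicM a m1).1.
(* Indicators extend everything by zero, so that Fubini applies on the full plane. *)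
pose H p := \1_D1 p.1 * (f' p.2 * A p).
have mf' := intble_meas fi'.
have mH : measurable_fun setT (H : TR * TR -> R).
  apply: measurable_funM.
    exact: (measurableT_comp (measurable_indic m1) measurable_fst).
  apply: measurable_funM mA.
  exact: (measurableT_comp mf' measurable_snd).
have HM (r y : R) : `|H (r, y)| <= `|a' r| * `|f' y|.
  rewrite /H /a' /f' /= !indicE; case: (boolP (r \in D1)) => r1; last first.
    by rewrite !mul0r normr0 mul0r.
  case: (boolP (y \in D2)) => y2; last by rewrite !mul0r mulr0 normr0 mulr0.
  rewrite !mul1r normrM mulrC ler_wpM2r//; rewrite !inE in r1 y2.
  by rewrite (le_trans (Aa _ _ r1 y2))// ler_norm.
have iH2 (r : R) : intble setT (fun y => H (r, y)).
  apply: (@intble_le _ _ _ (fun y => `|a' r| * `|f' y|)) => //.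
  - by apply: (measurableT_comp mH); apply: measurable_fun_pair.
  - by apply: intbleZl => //; exact: intble_norm.
have iHr : intble setT (fun r => \int[mu]_y `|H (r, y)|) /\
    (mu \x mu)%E.-integrable setT (EFin \o (H : TR * TR -> R)).
  pose c := \int[mu]_y `|f' y|.
  have HE (r : R) : \int[mu]_y `|H (r, y)| <= `|a' r| * c.
    rewrite /c -(@RintegralZl _ TR R mu)//; last exact: intble_norm.
    apply: (@le_Rintegral _ TR R mu) => //.
    - exact: intble_norm (iH2 r).
    - by apply: intbleZl => //; exact: intble_norm.
  have E1 : (fun r => \int[mu]_y `|(EFin \o (H : TR * TR -> R)) (r, y)|)%E =
      (fun r : TR => (\int[mu]_y `|H (r, y)|)%:E).
    apply/funext => r; rewrite /Rintegral fineK//.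
    exact: (@integrable_fin_num _ TR R mu _ measurableT _ (intble_norm measurableT (iH2 r))).
  have mN : measurable_fun setT (fun r : TR => \int[mu]_y `|H (r, y)|).
    apply/measurable_EFinP; rewrite /comp -E1.
    apply: (@measurable_fun_fubini_tonelli_F _ _ TR TR R mu (fun p => `|(H p)%:E|)%E) => //.
    exact/measurableT_comp/measurable_EFinP.
  have i1 : intble setT (fun r => \int[mu]_y `|H (r, y)|).
    apply: (@intble_le _ _ _ (fun r => `|a' r| * c)) => //.
      move=> x _; rewrite ger0_norm ?HE//.
      by apply: Rintegral_ge0.
    have -> : (fun r => `|a' r| * c) = (fun r => c * `|a' r|) by apply/funext => r; rewrite mulrC.
    by apply: intbleZl => //; exact: intble_norm.
  split=> //; apply/integrable12ltyP; first exact/measurable_EFinP.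
  have /integrableP[_] := i1; rewrite E1; apply: le_lt_trans.
  apply: ge0_le_integral => //.
  - by move=> x _; rewrite lee_fin; apply: Rintegral_ge0.
  - exact/measurable_EFinP.
  - by apply/measurable_EFinP; exact: measurableT_comp mN.
  - by move=> x _; rewrite lee_fin ler_norm.
have [_ iH] := iHr.
have iH1 (y : R) : intble setT (fun r => H (r, y)).
  apply: (@intble_le _ _ _ (fun r => `|f' y| * `|a' r|)) => //.
  - by apply: (measurableT_comp mH); apply: measurable_fun_pair.
  - by move=> x _; rewrite mulrC.
  - by apply: intbleZl => //; exact: intble_norm.
have EF : (fun r : TR => \int[mu]_y (EFin \o (H : TR * TR -> R)) (r, y))%E =
    EFin \o (fun r => \1_D1 r * \int[mu]_(y in D2) (f y * A (r, y))).
  apply/funext => r /=.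
  rewrite -[LHS]fineK; last exact: (@integrable_fin_num _ TR R mu _ measurableT _ (iH2 r)).
  congr EFin; rewrite -[LHS]/(\int[mu]_y H (r, y)) [X in _ = _ * X]Rint_indicM.
  rewrite /H /f' /= indicE; case: (boolP (r \in D1)) => r1; last first.
    by rewrite mul0r Rint_eq0// => y; rewrite mul0r.
  by rewrite mul1r; apply: eq_Rintegral => y _; rewrite mul1r mulrA.
have EG : (fun y : TR => \int[mu]_r (EFin \o (H : TR * TR -> R)) (r, y))%E =
    EFin \o (fun y => \1_D2 y * (f y * \int[mu]_(r in D1) A (r, y))).
  apply/funext => y /=.
  rewrite -[LHS]fineK; last exact: (@integrable_fin_num _ TR R mu _ measurableT _ (iH1 y)).
  congr EFin; rewrite -[LHS]/(\int[mu]_r H (r, y)) [X in _ = _ * (_ * X)]Rint_indicM.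
  rewrite /H /f' /= indicE; case: (boolP (y \in D2)) => y2; last first.
    by rewrite [RHS]mul0r Rint_eq0// => r; rewrite !mul0r mulr0.
  (* Integrability of [A (r, y)] in [r] is recovered from that of [H] by dividing by [f y]; where
     [f y] vanishes both sides are zero. *)
  have [->|fy0] := eqVneq (f y) 0.
    by rewrite mul0r mulr0 Rint_eq0// => r; rewrite !(mulr0, mul0r).
  rewrite !mul1r -(@RintegralZl _ TR R mu)//.
    by apply: eq_Rintegral => r _; rewrite mulrCA.
  have := intbleZl (f y)^-1 measurableT (iH1 y); apply: intble_eq => // r _.
  by rewrite /H /f' /= [\1_D2 y]indicE y2 mul1r [RHS]mulrC; field.
have iF := integrable_fubini_F iH; rewrite /fubini_F EF in iF.
have mG := measurable_fubini_G iH; rewrite /fubini_G EG in mG.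
have iG : intble setT (fun y => \1_D2 y * (f y * \int[mu]_(r in D1) A (r, y))).
  apply: (@intble_le _ _ _ (fun y => (\int[mu]_(r in D1) a r) * `|f' y|)) => //.
  - exact/measurable_EFinP.
  - move=> y _; rewrite mulrA normrM mulrC /f'; have [y2|y2] := boolP (y \in D2); last first.
      by rewrite [\1_D2 y]indicE (negbTE y2) !mul0r normr0 !mulr0.
    rewrite ler_wpM2r//; apply: Rint_norm_le => //; last first.
      by move=> r r1; apply: Aa => //; rewrite inE in y2.
    apply: (@intble_le _ _ _ a) => //.
      exact: measurable_funTS (mA1 y).
    by move=> r r1; apply: Aa => //; rewrite inE in y2.
  - by apply: intbleZl => //; exact: intble_norm.
split.
- by apply: (intble_indicM _ _).2.
- by apply: (intble_indicM _ _).2.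
- have := Fubini iH; rewrite [X in (\int[mu]_x X x)%E = _]EF [X in _ = (\int[mu]_x X x)%E]EG.
  by move=> /(congr1 fine) E; rewrite [LHS]Rint_indicM [RHS]Rint_indicM; exact: E.
Qed.

End Fubini.

(** * Gaussian integrals *)

Section Calculus.
Context {R : realType}.
Implicit Types (u v : R -> R) (x : R).

Lemma isd_cst (k x : R) : is_derive x 1 (fun=> k) 0.
Proof. exact: is_derive_cst. Qed.
Lemma isd_id x : is_derive x 1 (fun y : R => y) 1.
Proof. exact: is_derive_id. Qed.
Lemma isd_add u v x (du dv : R) : is_derive x 1 u du -> is_derive x 1 v dv ->
  is_derive x 1 (fun y => u y + v y) (du + dv).
Proof. by move=> du_ dv_; exact: is_deriveD. Qed.
Lemma isd_opp u x (du : R) : is_derive x 1 u du -> is_derive x 1 (fun y => - u y) (- du).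
Proof. by move=> du_; exact: is_deriveN. Qed.
Lemma isd_mul u v x (du dv : R) : is_derive x 1 u du -> is_derive x 1 v dv ->
  is_derive x 1 (fun y => u y * v y) (u x * dv + v x * du).
Proof. by move=> du_ dv_; exact: is_deriveM. Qed.
Lemma isd_comp (f : R -> R) u x (df du : R) : is_derive (u x) 1 f df -> is_derive x 1 u du ->
  is_derive x 1 (fun y => f (u y)) (df * du).
Proof. exact: is_derive1_comp. Qed.
Lemma isd_exp u x n (du : R) : is_derive x 1 u du ->
  is_derive x 1 (fun y => u y ^+ n) (n%:R * u x ^+ n.-1 * du).
Proof.
move=> du_; have -> : (fun y => u y ^+ n) = u ^+ n by rewrite exprfctE.
by apply: is_derive_eq (is_deriveX n du_) _.
Qed.
Lemma isd_expR u x (du : R) : is_derive x 1 u du ->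
  is_derive x 1 (fun y => expR (u y)) (expR (u x) * du).
Proof. by move=> ?; apply: isd_comp. Qed.
Lemma isd_cos u x (du : R) : is_derive x 1 u du ->
  is_derive x 1 (fun y => cos (u y)) (- sin (u x) * du).
Proof. by move=> ?; apply: isd_comp. Qed.
Lemma isd_sin u x (du : R) : is_derive x 1 u du ->
  is_derive x 1 (fun y => sin (u y)) (cos (u x) * du).
Proof. by move=> ?; apply: isd_comp. Qed.

Lemma is_derive_cts u x (du : R) : is_derive x 1 u du -> {for x, continuous u}.
Proof. by move=> [du_ _]; apply/differentiable_continuous/derivable1_diffP. Qed.

End Calculus.

(** The rule is selected from the shape of the function body; [deriv] then leaves one equation
    between the computed and the expected derivative. *)
Ltac deriv1 := match goal with
  | |- is_derive _ _ (fun=> ?k) _ => exact: isd_cst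
  | |- is_derive _ _ (fun y => y) _ => exact: isd_id
  | |- is_derive _ _ (fun y => @?u y + @?v y) _ => apply: (@isd_add _ u v)
  | |- is_derive _ _ (fun y => - @?u y) _ => apply: (@isd_opp _ u)
  | |- is_derive _ _ (fun y => @?u y * @?v y) _ => apply: (@isd_mul _ u v)
  | |- is_derive _ _ (fun y => @?u y ^+ ?n) _ => apply: (@isd_exp _ u _ n)
  | |- is_derive _ _ (fun y => expR (@?u y)) _ => apply: (@isd_expR _ u)
  | |- is_derive _ _ (fun y => cos (@?u y)) _ => apply: (@isd_cos _ u)
  | |- is_derive _ _ (fun y => sin (@?u y)) _ => apply: (@isd_sin _ u)
  end.
Ltac deriv := refine (is_derive_eq _ _); first (repeat deriv1).

Section Cts.
Context {R : realType} {T : topologicalType}.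
Implicit Types (u v : T -> R) (x : T).
Lemma cts_add u v x : {for x, continuous u} -> {for x, continuous v} ->
  {for x, continuous (fun y => u y + v y)}.
Proof. by move=> cu cv; exact: cvgD. Qed.
Lemma cts_opp u x : {for x, continuous u} -> {for x, continuous (fun y => - u y)}.
Proof. by move=> cu; exact: cvgN. Qed.
Lemma cts_mul u v x : {for x, continuous u} -> {for x, continuous v} ->
  {for x, continuous (fun y => u y * v y)}.
Proof. by move=> cu cv; exact: cvgM. Qed.
Lemma cts_cst (k : R) x : {for x, continuous (fun=> k)}.
Proof. exact: cvg_cst. Qed.
Lemma cts_comp (f : R -> R) u x : {for u x, continuous f} -> {for x, continuous u} ->
  {for x, continuous (fun y => f (u y))}.
Proof. by move=> cf cu; apply: (@continuous_comp _ _ _ u f). Qed.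
Lemma cts_expR u x : {for x, continuous u} -> {for x, continuous (fun y => expR (u y))}.
Proof. move=> ?; apply: cts_comp => //; exact: continuous_expR. Qed.
Lemma cts_cos u x : {for x, continuous u} -> {for x, continuous (fun y => cos (u y))}.
Proof. move=> ?; apply: cts_comp => //; exact: continuous_cos. Qed.
Lemma cts_sin u x : {for x, continuous u} -> {for x, continuous (fun y => sin (u y))}.
Proof. move=> ?; apply: cts_comp => //; exact: continuous_sin. Qed.
Lemma cts_sqrt u x : {for x, continuous u} -> {for x, continuous (fun y => Num.sqrt (u y))}.
Proof. move=> ?; apply: cts_comp => //; exact: sqrt_continuous. Qed.
Lemma cts_inv u x : u x != 0 -> {for x, continuous u} -> {for x, continuous (fun y => (u y)^-1)}.
Proof. by move=> u0 cu; exact: cvgV. Qed.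
Lemma cts_exp u n x : {for x, continuous u} -> {for x, continuous (fun y => u y ^+ n)}.
Proof. move=> ?; apply: (@cts_comp (fun y => y ^+ n)) => //; exact: exprn_continuous. Qed.
End Cts.
Lemma cts_fst {R : realType} (x : R * R) : {for x, continuous (fun p => p.1)}.
Proof. exact: cvg_fst. Qed.
Lemma cts_snd {R : realType} (x : R * R) : {for x, continuous (fun p => p.2)}.
Proof. exact: cvg_snd. Qed.
Lemma cts_id {R : realType} (x : R) : {for x, continuous (fun p => p)}.
Proof. exact: cvg_id. Qed.

Ltac cts1 := match goal with
  | |- prop_for _ (inPhantom (continuous (fun=> _))) => exact: cts_cst
  | |- prop_for _ (inPhantom (continuous (fun y => y))) => exact: cts_id
  | |- prop_for _ (inPhantom (continuous (fun y => y.1))) => exact: cts_fst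
  | |- prop_for _ (inPhantom (continuous (fun y => y.2))) => exact: cts_snd
  | |- prop_for _ (inPhantom (continuous (fun y => @?u y + @?v y))) => apply: (@cts_add _ _ u v)
  | |- prop_for _ (inPhantom (continuous (fun y => - @?u y))) => apply: (@cts_opp _ _ u)
  | |- prop_for _ (inPhantom (continuous (fun y => @?u y * @?v y))) => apply: (@cts_mul _ _ u v)
  | |- prop_for _ (inPhantom (continuous (fun y => @?u y ^+ ?n))) => apply: (@cts_exp _ _ u n)
  | |- prop_for _ (inPhantom (continuous (fun y => expR (@?u y)))) => apply: (@cts_expR _ _ u)
  | |- prop_for _ (inPhantom (continuous (fun y => cos (@?u y)))) => apply: (@cts_cos _ _ u)
  | |- prop_for _ (inPhantom (continuous (fun y => sin (@?u y)))) => apply: (@cts_sin _ _ u)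
  | |- prop_for _ (inPhantom (continuous (fun y => Num.sqrt (@?u y)))) => apply: (@cts_sqrt _ _ u)
  | |- prop_for _ (inPhantom (continuous (fun y => (@?u y)^-1))) => apply: (@cts_inv _ _ u)
  end.
Ltac cts := repeat cts1.

Section Meas.
Context {R : realType} d {T : measurableType d} (D : set T).
Implicit Types (u v : T -> R).
Lemma meas_add u v : measurable_fun D u -> measurable_fun D v ->
  measurable_fun D (fun y => u y + v y).
Proof. by move=> mu mv; exact: measurable_funD. Qed.
Lemma meas_opp u : measurable_fun D u -> measurable_fun D (fun y => - u y).
Proof. by move=> mu; exact: measurableT_comp. Qed.
Lemma meas_mul u v : measurable_fun D u -> measurable_fun D v ->
  measurable_fun D (fun y => u y * v y).
Proof. by move=> mu mv; exact: measurable_funM. Qed.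
Lemma meas_exp u n : measurable_fun D u -> measurable_fun D (fun y => u y ^+ n).
Proof. by move=> mu; exact: measurable_funX. Qed.
Lemma meas_cst (k : R) : measurable_fun D (fun=> k).
Proof. exact: measurable_cst. Qed.
Lemma meas_comp (f : R -> R) u : continuous f -> measurable_fun D u ->
  measurable_fun D (fun y => f (u y)).
Proof. by move=> /continuous_measurable_fun mf mu; exact: measurableT_comp. Qed.
Lemma meas_expR u : measurable_fun D u -> measurable_fun D (fun y => expR (u y)).
Proof. by apply: meas_comp; exact: continuous_expR. Qed.
Lemma meas_cos u : measurable_fun D u -> measurable_fun D (fun y => cos (u y)).
Proof. by apply: meas_comp; exact: continuous_cos. Qed.
Lemma meas_sin u : measurable_fun D u -> measurable_fun D (fun y => sin (u y)).
Proof. by apply: meas_comp; exact: continuous_sin. Qed.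
End Meas.
Lemma meas_id {R : realType} (D : set R) : measurable_fun D (fun y : R => y).
Proof. by apply: measurable_funTS; exact: measurable_id. Qed.
Lemma meas_fst {R : realType} :
  measurable_fun setT (fun p : measurableTypeR R * measurableTypeR R => p.1).
Proof. exact: measurable_fst. Qed.
Lemma meas_snd {R : realType} :
  measurable_fun setT (fun p : measurableTypeR R * measurableTypeR R => p.2).
Proof. exact: measurable_snd. Qed.
Ltac meas1 := match goal with
  | |- measurable_fun _ (fun=> _) => exact: meas_cst
  | |- measurable_fun _ (fun y => y) => exact: meas_id
  | |- measurable_fun _ (fun y => y.1) => exact: meas_fst
  | |- measurable_fun _ (fun y => y.2) => exact: meas_snd
  | |- measurable_fun _ (fun y => @?u y + @?v y) => apply: (@meas_add _ _ _ _ u v)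
  | |- measurable_fun _ (fun y => - @?u y) => apply: (@meas_opp _ _ _ _ u)
  | |- measurable_fun _ (fun y => @?u y * @?v y) => apply: (@meas_mul _ _ _ _ u v)
  | |- measurable_fun _ (fun y => @?u y ^+ ?n) => apply: (@meas_exp _ _ _ _ u n)
  | |- measurable_fun _ (fun y => expR (@?u y)) => apply: (@meas_expR _ _ _ _ u)
  | |- measurable_fun _ (fun y => cos (@?u y)) => apply: (@meas_cos _ _ _ _ u)
  | |- measurable_fun _ (fun y => sin (@?u y)) => apply: (@meas_sin _ _ _ _ u)
  end.
Ltac meas := repeat meas1.

(** * Gaussian integrals and their cosine transforms *)

Section Gauss.
Context {R : realType}.
Notation mu := (@lebesgue_measure R).

(** A single term of the exponential series is at most its sum. The numerical constants in the decay
    bounds below come from here. *)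
Lemma pow_exp_bound n (v : R) : 0 <= v -> v ^+ n * expR (- v) <= n`!%:R.
Proof.
move=> v0; rewrite expRN ler_pdivrMr ?expR_gt0//.
case: n => [|n]; first by rewrite expr0 fact0 mul1r (le_trans _ (expR_ge1Dx v))// lerDl.
rewrite mulrC -ler_pdivrMr ?ltr0n ?fact_gt0//.
by rewrite (le_trans _ (expR_ge1Dxn n v0))// lerDr.
Qed.

Lemma expN_le1 (v : R) : 0 <= v -> expR (- v) <= 1.
Proof. by move=> v0; rewrite -[leRHS]expR0 ler_expR oppr_le0. Qed.

Lemma norm_cos_le1 (x : R) : `|cos x| <= 1.
Proof. by rewrite ler_norml cos_geN1 cos_le1. Qed.

Lemma norm_sin_le1 (x : R) : `|sin x| <= 1.
Proof. by rewrite ler_norml sin_geN1 sin_le1. Qed.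

Lemma cvg_pinfty_bnd (F : R -> R) (C : R) : (forall l, 1 <= l -> `|F l| <= C / l) ->
  F l @[l --> +oo] --> 0.
Proof.
move=> FC; apply/cvgr0Pnorm_lt => e e0; near=> l.
have l1 : 1 <= l by near: l; apply: nbhs_pinfty_ge; exact: num_real.
apply: le_lt_trans (FC _ l1) _; rewrite ltr_pdivrMr ?(lt_le_trans _ l1)//.
rewrite mulrC -ltr_pdivrMr//; near: l; apply: nbhs_pinfty_gt; exact: num_real.
Unshelve. all: by end_near. Qed.

Lemma cvg_ninfty_bnd (F : R -> R) (C : R) : (forall l, 1 <= l -> `|F (- l)| <= C / l) ->
  F l @[l --> -oo] --> 0.
Proof. by move=> FC; apply/cvgNy_compNP; exact: cvg_pinfty_bnd FC. Qed.

Lemma intble_oneDsqrV : intble `]0, +oo[ (fun r : R => (oneDsqr r)^-1).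
Proof.
apply: (@integrableS _ (measurableTypeR R) R mu `[0, +oo[) => //.
  by apply: subset_itv; rewrite bnd_simp.
apply/integrableP; split.
  apply/measurable_EFinP; apply: measurable_funTS; apply: continuous_measurable_fun.
  exact: continuous_oneDsqrV.
rewrite [X in (X < _)%E](_ : _ = (pi / 2)%:E) ?ltry// -integral0y_oneDsqr.
apply: eq_integral => r _.
by rewrite /= ger0_norm ?invr_ge0 ?(le_trans _ (oneDsqr_ge1 _)).
Qed.

Lemma intble_rpow_exp (a : R) k : 0 < a ->
  intble `]0, +oo[ (fun r => r ^+ k * expR (- (a * r))).
Proof.
move=> a0.
(* Bounds [1 + r ^+ 2] times the integrand: one summand for each of the powers [k] and [k + 2]. *)
pose C : R := k`!%:R / a ^+ k + (k.+2)`!%:R / a ^+ k.+2.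
have b n (r : R) : 0 <= r -> r ^+ n * expR (- (a * r)) <= n`!%:R / a ^+ n.
  move=> r0; rewrite ler_pdivlMr ?exprn_gt0//.
  have := pow_exp_bound n (mulr_ge0 (ltW a0) r0); apply: le_trans.
  by rewrite exprMn mulrAC (mulrC (r ^+ n)).
apply: (@intble_le _ _ _ (fun r => C * (oneDsqr r)^-1)) => //.
- by meas.
- move=> r; rewrite /= in_itv/= andbT => r0.
  have {}r0 := ltW r0.
  rewrite ger0_norm ?mulr_ge0 ?exprn_ge0 ?expR_ge0//.
  rewrite ler_pdivlMr ?(lt_le_trans _ (oneDsqr_ge1 _))//.
  by rewrite /oneDsqr mulrDr mulr1 /C lerD ?b// mulrAC -exprD addn2 b.
- by apply: intbleZl => //; exact: intble_oneDsqrV.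
Qed.

(** With variance [1 / (2 a)] the normal density is a multiple of [exp (- a l ^ 2)], so that the
    Gaussian integral follows from the normalisation of that density. *)
Let nrm_sigma (a : R) := Num.sqrt (2 * a)^-1.

Let normal_gauss (a l : R) : 0 < a ->
  normal_pdf 0 (nrm_sigma a) l = (Num.sqrt (pi / a))^-1 * expR (- (a * l ^+ 2)).
Proof.
move=> a0; have s2 : nrm_sigma a ^+ 2 = (2 * a)^-1.
  by rewrite sqr_sqrtr// invr_ge0 mulr_ge0// ltW.
rewrite normal_pdfE; last by rewrite gt_eqF// sqrtr_gt0 invr_gt0 mulr_gt0.
rewrite /normal_peak /normal_fun s2 subr0; congr (_^-1 * expR _).
  by congr Num.sqrt; field; rewrite gt_eqF.
by field; rewrite gt_eqF.
Qed.

Lemma intble_gauss (a : R) : 0 < a -> intble setT (fun l => expR (- (a * l ^+ 2))).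
Proof.
move=> a0; have := intbleZl (Num.sqrt (pi / a)) measurableT
  (integrable_normal_pdf 0 (nrm_sigma a)).
apply: intble_eq => // l _; rewrite normal_gauss// mulrA divff ?mul1r//.
by rewrite gt_eqF// sqrtr_gt0 divr_gt0 ?pi_gt0.
Qed.

Lemma integral_gauss (a : R) : 0 < a ->
  \int[mu]_l expR (- (a * l ^+ 2)) = Num.sqrt (pi / a).
Proof.
move=> a0; have s0 : Num.sqrt (pi / a) != 0.
  by rewrite gt_eqF// sqrtr_gt0 divr_gt0 ?pi_gt0.
apply: (mulfI (invr_neq0 s0)); rewrite mulVf//.
rewrite -(@RintegralZl _ (measurableTypeR R) R mu)//; last exact: intble_gauss.
under eq_Rintegral do rewrite -normal_gauss//.
by rewrite /Rintegral integral_normal_pdf.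
Qed.

Lemma integral_gauss_half (a : R) : 0 < a ->
  \int[mu]_(l in `]0, +oo[) expR (- (a * l ^+ 2)) = Num.sqrt (pi / a) / 2.
Proof.
move=> a0; rewrite -integral_gauss//.
have cg : continuous (fun l : R => expR (- (a * l ^+ 2))).
  by move=> x; change {for x, continuous (fun l : R => expR (- (a * l ^+ 2)))}; cts.
rewrite /Rintegral ge0_symfun_integralT//=.
- rewrite -set_itvcy integral_itv_obnd_cbnd; last first.
    apply/measurable_EFinP; apply: measurable_funTS; apply: continuous_measurable_fun.
    exact: cg.
  rewrite fineM//; first by rewrite [RHS]mulrC [RHS]mulKf.
  apply: (@integrable_fin_num _ (measurableTypeR R) R mu) => //.
  by apply: (@integrableS _ (measurableTypeR R) R mu setT) => //; exact: intble_gauss.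
- by move=> x /=; rewrite sqrrN.
Qed.

Lemma intble_gauss1 (a : R) : 0 < a -> intble setT (fun l => l * expR (- (a * l ^+ 2))).
Proof.
move=> a0; apply: (@intble_le _ _ _
  (fun l => expR (- (a * l ^+ 2)) + 2 / a * expR (- (a / 2 * l ^+ 2)))) => //.
- by meas.
- move=> l _; rewrite normrM (ger0_norm (expR_ge0 _)).
  (* Half of the exponent absorbs the factor [l ^+ 2]; the other half stays integrable. *)
  have -> : expR (- (a * l ^+ 2)) = expR (- (a / 2 * l ^+ 2)) * expR (- (a / 2 * l ^+ 2)).
    by rewrite -expRD; congr expR; field.
  have h0 : 0 <= a / 2 * l ^+ 2 by rewrite mulr_ge0 ?sqr_ge0// divr_ge0// ltW.
  have := pow_exp_bound 1 h0; rewrite expr1 => h1.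
  set e := expR _ in h1 *; have e0 : 0 < e := expR_gt0 _.
  have hl : l ^+ 2 * e <= 2 / a.
    by rewrite ler_pdivlMr//; move: h1; rewrite [X in X <= _ -> _](_ : _ = (l ^+ 2 * e * a) / 2) ?ler_pdivrMr ?mul1r//; field.
  have nl : `|l| <= 1 + l ^+ 2.
    have := sqr_ge0 (l + 1); have := sqr_ge0 (l - 1); have := sqr_ge0 l.
    by rewrite ler_norml; move=> *; apply/andP; split; nra.
  apply: (@le_trans _ _ ((1 + l ^+ 2) * (e * e))); first by rewrite ler_wpM2r// mulr_ge0// ltW.
  by rewrite mulrDl mul1r lerD2l mulrA ler_wpM2r// ltW.
- apply: intbleD => //; first exact: intble_gauss.
  by apply: intbleZl => //; apply: intble_gauss; rewrite divr_gt0.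
Qed.

(** As a function of [z] the left side solves [I' = - z / (2 t) * I], so [I z * exp (z ^ 2 / (4 t))]
    is constant. The hypothesis says that the [l]-derivative of
    [exp (- t c ^ 2 l ^ 2) * sin (c l z + p)] integrates to zero over [D]; it yields the
    differential equation. The phase [p] makes the sine accessible as well. *)
Lemma gauss_fourier (D : set R) (t c p z : R) : measurable D -> 0 < t -> 0 < c ->
  (forall z, \int[mu]_(l in D) (- (2 * t * c ^+ 2 * l) * expR (- (t * c ^+ 2 * l ^+ 2)) * sin (c * l * z + p)
     + c * z * expR (- (t * c ^+ 2 * l ^+ 2)) * cos (c * l * z + p)) = 0) ->
  \int[mu]_(l in D) (expR (- (t * c ^+ 2 * l ^+ 2)) * cos (c * l * z + p)) =
  expR (- (z ^+ 2 / (4 * t))) * \int[mu]_(l in D) (expR (- (t * c ^+ 2 * l ^+ 2)) * cos p).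
Proof.
move=> mD t0 c0 H; set a := t * c ^+ 2 in H *; have a0 : 0 < a by rewrite mulr_gt0 ?exprn_gt0.
have gi : intble D (fun l => expR (- (a * l ^+ 2))).
  by apply: (@integrableS _ (measurableTypeR R) R mu setT) => //; exact: intble_gauss.
have g1i : intble D (fun l => l * expR (- (a * l ^+ 2))).
  by apply: (@integrableS _ (measurableTypeR R) R mu setT) => //; exact: intble_gauss1.
have ci y : intble D (fun l => expR (- (a * l ^+ 2)) * cos (c * l * y + p)).
  apply: (@intble_le _ _ _ (fun l => expR (- (a * l ^+ 2)))) => //; first by meas.
  by move=> l _; rewrite normrM (ger0_norm (expR_ge0 _)) ler_piMr ?norm_cos_le1.
have si y : intble D (fun l => l * expR (- (a * l ^+ 2)) * sin (c * l * y + p)).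
  apply: (@intble_le _ _ _ (fun l => `|l * expR (- (a * l ^+ 2))|)) => //; first by meas.
    by move=> l _; rewrite normrM ler_piMr ?norm_sin_le1.
  exact: intble_norm.
pose I y := \int[mu]_(l in D) (expR (- (a * l ^+ 2)) * cos (c * l * y + p)).
have dI (y : R) : is_derive y 1 I (- (y / (2 * t)) * I y).
  have -> : - (y / (2 * t)) * I y =
      \int[mu]_(l in D) (- c * (l * expR (- (a * l ^+ 2)) * sin (c * l * y + p))).
    have := H y; rewrite (_ : Rintegral _ _ _ = \int[mu]_(l in D)
        (2 * t * c * (- c * (l * expR (- (a * l ^+ 2)) * sin (c * l * y + p)))
        + c * y * (expR (- (a * l ^+ 2)) * cos (c * l * y + p)))); last first.
      by apply: eq_Rintegral => l _; ring.
    rewrite (@RintegralD _ (measurableTypeR R) R mu)//; [|exact/intbleZl/intbleZl/si|exact/intbleZl/ci].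
    rewrite (@RintegralZl _ (measurableTypeR R) R mu)//; last exact/intbleZl/si.
    rewrite (@RintegralZl _ (measurableTypeR R) R mu _ _ (c * y))//; last exact/ci.
    (* Cancelling [c] leaves the differential equation [2 t I' + z I = 0]. *)
    rewrite -/(I y) => E; have {E} : 2 * t * (\int[mu]_(l in D) (- c * (l * expR (- (a * l ^+ 2)) * sin (c * l * y + p)))) + y * I y = 0.
      by apply: (mulfI (lt0r_neq0 c0)); rewrite mulr0 -[RHS]E; ring.
    set J := Rintegral _ _ _ => E; have -> : J = (2 * t)^-1 * (2 * t * J + y * I y) - (y / (2 * t)) * I y.
      by field; rewrite gt_eqF.
    by rewrite E mulr0 sub0r mulNr.
  apply: (@is_derive_under_integral _ _ _
    (fun y l => - c * (l * expR (- (a * l ^+ 2)) * sin (c * l * y + p)))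
    (fun l => c * `|l * expR (- (a * l ^+ 2))|) y 1) => //.
  - by move=> x l _ _; deriv; rewrite /GRing.scale/=; ring.
  - by apply: intbleZl => //; exact: intble_norm.
  - move=> x l _ _; rewrite normrM normrN (gtr0_norm c0) ler_wpM2l ?(ltW c0)//.
    by rewrite normrM ler_piMr ?norm_sin_le1.
have dJ (y : R) : is_derive y 1 (fun y : R => I y * expR (y ^+ 2 / (4 * t))) 0.
  apply: (is_derive_eq (isd_mul (dI y) (isd_expR (isd_mul (isd_exp 2 (isd_id y)) (isd_cst (4 * t)^-1 y))))).
  by rewrite /GRing.scale/=; field; rewrite gt_eqF.
have := @is_derive_0_is_cst _ _ z 0 dJ; rewrite expr0n/= mul0r expR0 mulr1 => E.
rewrite -/a -[LHS]/(I z) expRN -[LHS](mulfK (lt0r_neq0 (expR_gt0 (z ^+ 2 / (4 * t))))) E mulrC.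
by congr (_ * _); apply: eq_Rintegral => l _; rewrite mulr0 add0r.
Qed.

Lemma gauss_decay (a l : R) : 0 < a -> 1 <= l -> expR (- (a * l ^+ 2)) <= a^-1 / l.
Proof.
move=> a0 l1; have l0 : 0 < l by apply: lt_le_trans l1.
have := @pow_exp_bound 1 (a * l ^+ 2) (mulr_ge0 (ltW a0) (sqr_ge0 l)); rewrite expr1.
set e := expR _; have e0 : 0 < e := expR_gt0 _; move=> h.
rewrite -invfM -[leRHS]div1r ler_pdivlMr ?mulr_gt0//; apply: le_trans h.
have : 0 <= a * e * (l * (l - 1)) by rewrite !mulr_ge0 ?subr_ge0// ltW.
by rewrite (_ : a * e * _ = a * l ^+ 2 * e - e * (a * l)) ?subr_ge0//; ring.
Qed.

Lemma gauss_fourier_primitive (a c p z l : R) : is_derive l 1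
  (fun l => expR (- (a * l ^+ 2)) * sin (c * l * z + p))
  (- (2 * a * l) * expR (- (a * l ^+ 2)) * sin (c * l * z + p)
     + c * z * expR (- (a * l ^+ 2)) * cos (c * l * z + p)).
Proof. by deriv; rewrite /GRing.scale/=; ring. Qed.

Lemma intble_fourier (a c p z : R) : 0 < a -> intble setT
  (fun l => - (2 * a * l) * expR (- (a * l ^+ 2)) * sin (c * l * z + p)
     + c * z * expR (- (a * l ^+ 2)) * cos (c * l * z + p)).
Proof.
move=> a0; apply: (@intble_le _ _ _ (fun l => 2 * a * `|l * expR (- (a * l ^+ 2))|
   + `|c * z| * expR (- (a * l ^+ 2)))) => //.
- by meas.
- move=> l _; apply: (le_trans (ler_normD _ _)); apply: lerD.
    have E : `|- (2 * a * l) * expR (- (a * l ^+ 2))| = 2 * a * `|l * expR (- (a * l ^+ 2))|.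
      have a2 : 0 <= 2 * a by rewrite mulr_ge0// ltW.
      by rewrite -[in RHS](ger0_norm a2) -normrM -normrN; congr (`|_|); ring.
    rewrite normrM E ler_piMr ?norm_sin_le1//.
    by rewrite mulr_ge0// mulr_ge0// ltW.
  rewrite normrM normrM (ger0_norm (expR_ge0 _)) ler_piMr ?norm_cos_le1//.
- apply: intbleD => //; apply: intbleZl => //; last exact: intble_gauss.
  by apply: intble_norm => //; exact: intble_gauss1.
Qed.

Lemma cts_fourier (a c p z l : R) : {for l, continuous
  (fun l => - (2 * a * l) * expR (- (a * l ^+ 2)) * sin (c * l * z + p)
     + c * z * expR (- (a * l ^+ 2)) * cos (c * l * z + p))}.
Proof. by cts. Qed.

Lemma fourier_decay (a c p z l : R) : 0 < a -> 1 <= l ->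
  `|expR (- (a * l ^+ 2)) * sin (c * l * z + p)| <= a^-1 / l.
Proof.
move=> a0 l1; rewrite normrM (ger0_norm (expR_ge0 _)).
by rewrite (le_trans _ (gauss_decay a0 l1))// ler_piMr ?norm_sin_le1 ?expR_ge0.
Qed.

Lemma gauss_fourierT (t p z : R) : 0 < t ->
  \int[mu]_l (expR (- (t * l ^+ 2)) * cos (l * z + p)) =
  expR (- (z ^+ 2 / (4 * t))) * cos p * Num.sqrt (pi / t).
Proof.
move=> t0.
have -> : \int[mu]_l (expR (- (t * l ^+ 2)) * cos (l * z + p)) =
    \int[mu]_l (expR (- (t * 1 ^+ 2 * l ^+ 2)) * cos (1 * l * z + p)).
  by apply: eq_Rintegral => l _; rewrite expr1n mulr1 mul1r.
rewrite (@gauss_fourier setT t 1 p z measurableT t0 ltr01).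
  rewrite expr1n mulr1 -mulrA -integral_gauss//; congr (_ * _).
  rewrite -(@RintegralZl _ (measurableTypeR R) R mu)//; last exact: intble_gauss.
  by apply: eq_Rintegral => l _; rewrite mulrC.
move=> {}z; rewrite expr1n !mulr1.
rewrite (@FTC_T _ _ _ 0 0 (gauss_fourier_primitive t 1 p z)) ?subrr//.
- by move=> l; exact: cts_fourier.
- exact: intble_fourier.
- apply: (@cvg_ninfty_bnd _ t^-1) => l l1.
  have -> : 1 * - l * z + p = 1 * l * (- z) + p by ring.
  by rewrite sqrrN; exact: fourier_decay.
- by apply: (@cvg_pinfty_bnd _ t^-1) => l l1; exact: fourier_decay.
Qed.

(** The scale [c] is kept because this integral is the horizontal end of the rotation below, where
    the ray is [l = r c]. *)
Lemma gauss_fourier_half (t c z : R) : 0 < t -> 0 < c ->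
  \int[mu]_(l in `]0, +oo[) (expR (- (t * c ^+ 2 * l ^+ 2)) * (c * cos (c * l * z))) =
  expR (- (z ^+ 2 / (4 * t))) * Num.sqrt (pi / t) / 2.
Proof.
move=> t0 c0; have a0 : 0 < t * c ^+ 2 by rewrite mulr_gt0// exprn_gt0.
have mD : measurable (`]0, +oo[ : set R) by [].
have := @gauss_fourier `]0, +oo[ t c 0 z mD t0 c0.
have gi : intble `]0, +oo[ (fun l : R => expR (- (t * c ^+ 2 * l ^+ 2))).
  by apply: (@integrableS _ (measurableTypeR R) R mu setT) => //; exact: intble_gauss.
under eq_Rintegral do rewrite addr0.
move=> E.
have -> : \int[mu]_(l in `]0, +oo[) (expR (- (t * c ^+ 2 * l ^+ 2)) * (c * cos (c * l * z))) =
   c * \int[mu]_(l in `]0, +oo[) (expR (- (t * c ^+ 2 * l ^+ 2)) * cos (c * l * z)).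
  rewrite -(@RintegralZl _ (measurableTypeR R) R mu)//.
    by apply: eq_Rintegral => l _; ring.
  apply: (@intble_le _ _ _ (fun l => expR (- (t * c ^+ 2 * l ^+ 2)))) => //; first by meas.
  by move=> l _; rewrite normrM (ger0_norm (expR_ge0 _)) ler_piMr ?norm_cos_le1.
rewrite E; last first.
  move=> {E}z; set a := t * c ^+ 2 in a0 *.
  have -> : 2 * t * c ^+ 2 = 2 * a by rewrite /a mulrA.
  (* With phase zero the primitive also vanishes at the finite end; this singles out the cosine on
     the half-line. *)
  have F0 : expR (- (a * l ^+ 2)) * sin (c * l * z + 0) @[l --> (0:R)^'+] --> 0.
    have : {for (0:R), continuous (fun l : R => expR (- (a * l ^+ 2)) * sin (c * l * z + 0))} by cts.
    by move/cvg_at_right_filter; rewrite mulr0 mul0r addr0 sin0 mulr0.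
  have Fy : expR (- (a * l ^+ 2)) * sin (c * l * z + 0) @[l --> +oo] --> 0.
    by apply: (@cvg_pinfty_bnd _ a^-1) => l l1; exact: fourier_decay.
  have i0 : intble `]0, +oo[ (fun l => - (2 * a * l) * expR (- (a * l ^+ 2)) * sin (c * l * z + 0)
     + c * z * expR (- (a * l ^+ 2)) * cos (c * l * z + 0)).
    by apply: (@integrableS _ (measurableTypeR R) R mu setT) => //; exact: intble_fourier.
  rewrite (FTC_oy (fun l _ => gauss_fourier_primitive a c 0 z l)
    (fun l _ => @cts_fourier a c 0 z l) i0 F0 Fy) subrr//.
have -> : \int[mu]_(l in `]0, +oo[) (expR (- (t * c ^+ 2 * l ^+ 2)) * cos 0) = Num.sqrt (pi / (t * c ^+ 2)) / 2.
  by rewrite -integral_gauss_half//; apply: eq_Rintegral => l _; rewrite cos0 mulr1.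
have -> : Num.sqrt (pi / t) = c * Num.sqrt (pi / (t * c ^+ 2)).
  have {1}-> : c = Num.sqrt (c ^+ 2) by rewrite sqrtr_sqr ger0_norm ?ltW.
  rewrite -sqrtrM ?sqr_ge0//.
  by congr Num.sqrt; field; rewrite !gt_eqF.
by rewrite !mulrA (mulrC c).
Qed.

End Gauss.

(** * Rotation of the contour *)

Section WithinBase.
Context {R : realType} {T : pseudoMetricType R}.
Notation mu := (@lebesgue_measure R).

Let B (A : set T) (x : T) n := A `&` ball x (n.+1%:R^-1).

(** The balls of radius [1 / (n + 1)] cut by [A] form the countable base needed to pass to
    sequences. *)
Lemma dominated_cvg_within (A : set T) (x : T) (D : set R) (f : T -> R -> R) (g l : R -> R) :
  measurable D -> intble D g -> measurable_fun D l ->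
  (\forall p \near x, A p -> measurable_fun D (f p)) ->
  (\forall p \near x, A p -> forall y, D y -> `|f p y| <= g y) ->
  {ae mu, forall y, D y -> f p y @[p --> within A (nbhs x)] --> l y} ->
  (\int[mu]_(y in D) f p y) @[p --> within A (nbhs x)] --> \int[mu]_(y in D) l y.
Proof.
apply: (@dominated_cvg_filter R T (within A (nbhs x)) _ (B A x)).
- move=> n; rewrite /B /within/=; near=> y => Ay; split => //.
  by near: y; apply: nbhsx_ballx; rewrite invr_gt0.
- move=> P; rewrite /within/= => /nbhs_ballP[e /= e0 He].
  have [n Hn] : exists n, (n.+1%:R : R)^-1 < e.
    by have [n _ /(_ n (leqnn _))] := near_infty_natSinv_lt (PosNum e0); exists n.
  exists n => m nm p [Ap px]; apply: He => //.
  apply: le_ball px; rewrite (le_trans _ (ltW Hn))// lef_pV2 ?posrE// ler_nat.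
  by rewrite ltnS.
Unshelve. all: by end_near. Qed.

End WithinBase.

Lemma near_mid {R : realFieldType} (x s c e : R) : - e < x - s -> x - s < e ->
  e <= s / 2 -> e <= (c - s) / 2 -> s / 2 <= x /\ x <= c.
Proof. by move=> *; split; lra. Qed.

Section Rotation.
Context {R : realType}.
Notation mu := (@lebesgue_measure R).
Variables (z t c : R).
Hypotheses (z0 : 0 < z) (t0 : 0 < t) (c0 : 0 < c).

(* [phi l = exp (i l z - l ^ 2 t)] along the ray [l = r (c + i s)]: [rotE] is its modulus, [roth]
   its argument; [rotf] and [rotg] are the real parts of [phi * dl/dr] and [phi * dl/ds]. *)
Let rotE (s r : R) : R := expR (- (r * s * z + r ^+ 2 * (c ^+ 2 - s ^+ 2) * t)).
Let roth (s r : R) : R := r * c * z - 2 * r ^+ 2 * c * s * t.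
Let rotf (s r : R) : R := rotE s r * (c * cos (roth s r) - s * sin (roth s r)).
Let rotg (s r : R) : R := - (r * rotE s r * sin (roth s r)).
Let rotd (s r : R) : R := rotE s r *
  ((- r * z + 2 * r ^+ 2 * s * t) * (c * cos (roth s r) - s * sin (roth s r))
   - sin (roth s r) + 2 * r ^+ 2 * c * t * (c * sin (roth s r) + s * cos (roth s r))).

(** [dsf] and [drg] share the value [rotd] because the form [phi dl] is closed; this identity takes
    the place of Cauchy's theorem. *)
Let dsf (s r : R) : is_derive s 1 (rotf ^~ r) (rotd s r).
Proof. by rewrite /rotf /rotd /rotE /roth; deriv; rewrite /GRing.scale/=; ring. Qed.

Let drg (s r : R) : is_derive r 1 (rotg s) (rotd s r).
Proof. by rewrite /rotg /rotd /rotE /roth; deriv; rewrite /GRing.scale/=; ring. Qed.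

Let rotE_ge0 s r : 0 <= rotE s r. Proof. exact: expR_ge0. Qed.

(** At [s = 0] the decay is Gaussian, at [s = c] it comes from [z] alone. In between the exponent is
    at least a convex combination of these two, hence at least the smaller one, so a single function
    dominates for all slopes. *)
Let rotE_le (s r : R) : 0 <= s <= c -> 0 <= r ->
  rotE s r <= expR (- (c * z * r)) + expR (- (t * c ^+ 2 * r ^+ 2)).
Proof.
move=> /andP[s0 sc] r0; set w1 := c * z * r; set w2 := t * c ^+ 2 * r ^+ 2.
(* With [s = k c] the exponent is [k w1 + (1 - k ^ 2) w2], and [1 - k ^ 2 >= 1 - k] on [[0, 1]]. *)
pose k := s / c; have k0 : 0 <= k by rewrite divr_ge0// ltW.
have k1 : k <= 1 by rewrite ler_pdivrMr// mul1r.
have sk : s = k * c by rewrite /k divfK// gt_eqF.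
have -> : rotE s r = expR (- (k * w1 + (1 - k ^+ 2) * w2)).
  by rewrite /rotE sk /w1 /w2; congr (expR (- _)); ring.
have w10 : 0 <= w1 by rewrite !mulr_ge0// ltW.
have w20 : 0 <= w2 by rewrite !mulr_ge0 ?sqr_ge0// ltW.
have kk : (1 - k) * w2 <= (1 - k ^+ 2) * w2.
  by rewrite ler_wpM2r// lerD2l lerN2 expr2 ler_piMl.
have [w12|w21] := leP w1 w2.
  apply: ler_wpDr; first exact: expR_ge0.
  by rewrite ler_expR lerN2 (le_trans _ (lerD (lexx _) kk))//; nra.
apply: ler_wpDl; first exact: expR_ge0.
by rewrite ler_expR lerN2 (le_trans _ (lerD (lexx _) kk))//; nra.
Qed.

(** Away from [s = 0] the factor in [z] suffices. This serves for the derivative in [s], which is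
    taken at interior slopes. *)
Let rotE_le2 (a s r : R) : 0 <= a <= s -> s <= c -> 0 <= r -> rotE s r <= expR (- (a * z * r)).
Proof.
move=> /andP[a0 as_] sc r0; rewrite /rotE ler_expR lerN2.
have h1 : 0 <= r ^+ 2 * (c ^+ 2 - s ^+ 2) * t.
  rewrite !mulr_ge0 ?sqr_ge0 ?(ltW t0)// subr_ge0 ler_sqr// nnegrE ?(ltW c0)//.
  exact: le_trans a0 as_.
apply: (@le_trans _ _ (r * s * z)); last by rewrite lerDl.
by rewrite mulrAC ler_wpM2r ?(ltW z0)// mulrC ler_wpM2l.
Qed.

Let trig_le (s r : R) : 0 <= s <= c -> `|c * cos (roth s r) - s * sin (roth s r)| <= 2 * c.
Proof.
move=> /andP[s0 sc]; apply: (le_trans (ler_normB _ _)).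
rewrite !normrM (ger0_norm (ltW c0)) (ger0_norm s0) mulr_natl mulr2n lerD//.
  by rewrite ler_piMr ?norm_cos_le1// ltW.
by rewrite (le_trans _ sc)// ler_piMr ?norm_sin_le1.
Qed.

Let trig_le2 (s r : R) : 0 <= s <= c -> `|c * sin (roth s r) + s * cos (roth s r)| <= 2 * c.
Proof.
move=> /andP[s0 sc]; apply: (le_trans (ler_normD _ _)).
rewrite !normrM (ger0_norm (ltW c0)) (ger0_norm s0) mulr_natl mulr2n lerD//.
  by rewrite ler_piMr ?norm_sin_le1// ltW.
by rewrite (le_trans _ sc)// ler_piMr ?norm_cos_le1.
Qed.

Let mD : measurable (`]0, +oo[ : set R). Proof. by []. Qed.

Let mf (s : R) : measurable_fun (`]0, +oo[ : set R) (rotf s).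
Proof. by rewrite /rotf /rotE /roth; meas. Qed.

Let domF (r : R) : R := 2 * c * (expR (- (c * z * r)) + expR (- (t * c ^+ 2 * r ^+ 2))).

Let domFi : intble `]0, +oo[ domF.
Proof.
apply: intbleZl => //; apply: intbleD => //.
  have := @intble_rpow_exp R (c * z) 0 (mulr_gt0 c0 z0).
  by apply: intble_eq => // r _; rewrite expr0 mul1r.
apply: (@integrableS _ (measurableTypeR R) R mu setT) => //; apply: intble_gauss.
by rewrite mulr_gt0// exprn_gt0.
Qed.

Let f_le (s r : R) : 0 <= s <= c -> 0 <= r -> `|rotf s r| <= domF r.
Proof.
move=> sc r0; rewrite /rotf /domF normrM (ger0_norm (rotE_ge0 _ _)) mulrC.
by apply: ler_pM => //; [exact: trig_le|exact: rotE_le].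
Qed.

Let fi (s : R) : 0 <= s <= c -> intble `]0, +oo[ (rotf s).
Proof.
move=> sc; apply: (@intble_le _ _ _ domF) => // r.
by rewrite /= in_itv/= andbT => r0; apply: f_le => //; exact: ltW.
Qed.

Let domd (a r : R) : R := expR (- (a * z * r)) * (2 * c * z * r + 1 + 8 * c ^+ 2 * t * r ^+ 2).

Let domdi (a : R) : 0 < a -> intble `]0, +oo[ (domd a).
Proof.
move=> a0; have az : 0 < a * z by rewrite mulr_gt0.
have i k := @intble_rpow_exp R (a * z) k az.
have := intbleD mD (intbleD mD (intbleZl (2 * c * z) mD (i 1%N)) (i 0%N))
  (intbleZl (8 * c ^+ 2 * t) mD (i 2%N)).
by apply: intble_eq => // r _; rewrite /domd; ring.
Qed.

Let d_le (a s r : R) : 0 < a <= s -> s <= c -> 0 <= r -> `|rotd s r| <= domd a r.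
Proof.
move=> /andP[a0 as_] sc r0; have s0 : 0 <= s := le_trans (ltW a0) as_.
rewrite /rotd /domd normrM (ger0_norm (rotE_ge0 _ _)); apply: ler_pM => //.
  by apply: rotE_le2 => //; rewrite ltW.
have sc' : 0 <= s <= c by rewrite s0.
have A1 := trig_le r sc'; have A2 := trig_le2 r sc'.
set X := c * cos _ - _ in A1 *; set Y := c * sin _ + _ in A2 *.
have p0 : 0 <= 2 * r ^+ 2 * c * t by rewrite !mulr_ge0 ?sqr_ge0// ltW.
have B1 : `|(- r * z + 2 * r ^+ 2 * s * t) * X| <= (r * z + 2 * r ^+ 2 * c * t) * (2 * c).
  rewrite normrM; apply: ler_pM => //; apply: (le_trans (ler_normD _ _)); apply: lerD.
    by rewrite mulNr normrN ger0_norm// mulr_ge0// ltW.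
  rewrite ger0_norm; last by rewrite !mulr_ge0 ?sqr_ge0// ltW.
  by rewrite ler_wpM2r ?(ltW t0)// ler_wpM2l// mulr_ge0 ?sqr_ge0.
have B2 : `|2 * r ^+ 2 * c * t * Y| <= 2 * r ^+ 2 * c * t * (2 * c).
  by rewrite normrM (ger0_norm p0) ler_wpM2l.
apply: (le_trans (ler_normD _ _)); apply: (le_trans (lerD (ler_normB _ _) (lexx _))).
apply: (le_trans (lerD (lerD B1 (norm_sin_le1 _)) B2)).
by rewrite le_eqVlt; apply/orP; left; apply/eqP; ring.
Qed.

Let int_d (s : R) : 0 < s < c -> \int[mu]_(r in `]0, +oo[) rotd s r = 0.
Proof.
move=> /andP[s0 sc].
have cd (r : R) : {for r, continuous (rotd s)} by rewrite /rotd /rotE /roth; cts.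
have i0 : intble `]0, +oo[ (rotd s).
  apply: (@intble_le _ _ _ (domd s)) => //; last exact: domdi.
    by rewrite /rotd /rotE /roth; meas.
  by move=> r; rewrite /= in_itv/= andbT => r0; apply: d_le; [rewrite s0/=|exact: ltW|exact: ltW].
have F0 : rotg s r @[r --> (0:R)^'+] --> 0.
  have := is_derive_cts (drg s 0); move/cvg_at_right_filter.
  by rewrite /rotg !mul0r oppr0.
have Fy : rotg s r @[r --> +oo] --> 0.
  (* From [v ^ 2 * exp (- v) <= 2!] at [v = s * z * r]. *)
  apply: (@cvg_pinfty_bnd _ _ (2 / (s * z) ^+ 2)) => r r1.
  have r0 : 0 < r by apply: lt_le_trans r1.
  have sz : 0 < s * z by rewrite mulr_gt0.
  rewrite /rotg normrN !normrM (ger0_norm (rotE_ge0 _ _)) (gtr0_norm r0).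
  apply: (@le_trans _ _ (r * expR (- (s * z * r)))).
    rewrite -[leRHS]mulr1; apply: ler_pM => //.
    - by rewrite mulr_ge0// ltW.
    - by rewrite ler_wpM2l ?(ltW r0)// rotE_le2// ?(ltW s0) ?lexx// ltW.
    - exact: norm_sin_le1.
  rewrite ler_pdivlMr// ler_pdivlMr ?exprn_gt0//.
  have := @pow_exp_bound R 2 (s * z * r) (mulr_ge0 (ltW sz) (ltW r0)).
  by apply: le_trans; rewrite le_eqVlt; apply/orP; left; apply/eqP; ring.
by rewrite (FTC_oy (fun r _ => drg s r) (fun r _ => cd r) i0 F0 Fy) subrr.
Qed.

Lemma rotation : \int[mu]_(r in `]0, +oo[) rotf c r = \int[mu]_(r in `]0, +oo[) rotf 0 r.
Proof.
pose I s := \int[mu]_(r in `]0, +oo[) rotf s r.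
have dI (s : R) : s \in `]0, c[%R -> is_derive s 1 I 0.
  rewrite in_itv/= => /[dup] sc' /andP[s0 sc]; rewrite -(int_d sc').
  pose e := Num.min (s / 2) ((c - s) / 2).
  have e0 : 0 < e by rewrite lt_min !divr_gt0// subr_gt0.
  have He x : `|x - s| < e -> s / 2 <= x /\ x <= c.
    rewrite ltr_norml => /andP[h1 h2].
    have e1 : e <= s / 2 by rewrite ge_min lexx.
    have e2 : e <= (c - s) / 2 by rewrite ge_min lexx orbT.
    exact: near_mid h1 h2 e1 e2.
  apply: (@is_derive_under_integral _ _ rotf rotd (domd (s / 2)) s e) => //.
  - by move=> x /He[h1 h2]; apply: fi; rewrite h2 andbT; lra.
  - by apply: domdi; rewrite divr_gt0.
  - move=> x r /He[h1 h2]; rewrite /= in_itv/= andbT => r0; apply: d_le => //; last exact: ltW.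
    by rewrite h1 andbT divr_gt0.
(* The ends of [[0, c]] are reached by dominated convergence, the derivative being controlled in the
   interior only; the mean value theorem then compares them. *)
have cI : {within `[0, c], continuous I}.
  apply/subspace_continuousP => s; rewrite /= in_itv/= => sc.
  apply: (@dominated_cvg_within R R `[0, c] s `]0, +oo[ rotf domF (rotf s)) => //.
  - by exists 1 => //= x _ _; exact: mf.
  - exists 1 => //= x _; rewrite in_itv/= => xc r; rewrite in_itv/= andbT => r0.
    by apply: f_le => //; exact: ltW.
  - apply: aeW => r _; apply: cvg_within_filter; exact: (is_derive_cts (dsf s r)).
have [x _] := MVT c0 dI cI.
by rewrite mul0r => /eqP; rewrite subr_eq0 => /eqP.
Unshelve. all: by end_near. Qed.

End Rotation.

(** * The heat kernel and its primitives *)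

Section HeatKernel.
Context {R : realType}.
Notation mu := (@lebesgue_measure R).
Implicit Types (w x z t : R).

Definition heat w t : R := (Num.sqrt (4 * pi * t))^-1 * expR (- (w ^+ 2 / (4 * t))).
Definition heat1 w t : R := - (w / (2 * t)) * heat w t.

Lemma heat_gaussE w t : 0 < t ->
  expR (- (w ^+ 2 / (4 * t))) * Num.sqrt (pi / t) / 2 = pi * heat w t.
Proof.
move=> t0; have p0 := pi_gt0 R.
have s0 : 0 < Num.sqrt (4 * pi * t) by rewrite sqrtr_gt0 !mulr_gt0.
have S : Num.sqrt (pi / t) / 2 = pi / Num.sqrt (4 * pi * t).
  apply: (mulIf (lt0r_neq0 s0)); rewrite [RHS]divfK ?gt_eqF//.
  rewrite mulrAC -sqrtrM ?divr_ge0 ?(ltW p0) ?ltW//.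
  have -> : pi / t * (4 * pi * t) = (2 * pi) ^+ 2 :> R by field; rewrite gt_eqF.
  rewrite sqrtr_sqr ger0_norm; last by rewrite mulr_ge0// ltW.
  by rewrite mulrC mulKf.
by rewrite -mulrA S /heat; ring.
Qed.

Section Gamma.
Variables (c z t : R).
Hypotheses (z0 : 0 < z) (t0 : 0 < t) (c0 : 0 < c).
Let th (r : R) := c * z * r - 2 * c ^+ 2 * t * r ^+ 2.

(** This is the ray [l = r c (1 + i)], the end [s = c] of the rotation, whose other end is the
    half-line Gaussian integral. *)
Lemma gamma_kernel0 :
  \int[mu]_(r in `]0, +oo[) (expR (- (c * z * r)) * (c * cos (th r) - c * sin (th r))) =
  pi * heat z t.
Proof.
rewrite -heat_gaussE// -(@gauss_fourier_half _ _ c)//.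
have := rotation z0 t0 c0.
set A := Rintegral _ _ _; set B := Rintegral _ _ _; have -> : A = Rintegral mu `]0, +oo[
    (fun r => expR (- (c * z * r)) * (c * cos (th r) - c * sin (th r))).
  apply: eq_Rintegral => r _; congr (expR (- _) * (c * cos _ - c * sin _)); rewrite /th; ring.
move=> ->; apply: eq_Rintegral => r _; rewrite mul0r subr0.
congr (expR (- _) * (c * cos _)); ring.
Qed.

Let ei k := @intble_rpow_exp R (c * z) k (mulr_gt0 c0 z0).
Let mD : measurable (`]0, +oo[ : set R). Proof. by []. Qed.

Let trig_intble k (b : R -> R) : measurable_fun (`]0, +oo[ : set R) b -> (forall r, `|b r| <= 1) ->
  intble `]0, +oo[ (fun r => r ^+ k * expR (- (c * z * r)) * b r).
Proof.
move=> mb b1; apply: (intble_le mD _ _ (ei k)); first by meas.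
move=> r; rewrite /= in_itv/= andbT => r0.
rewrite normrM ger0_norm ?ler_piMr//; by rewrite mulr_ge0 ?exprn_ge0 ?expR_ge0// ltW.
Qed.

(** Along the ray [d phi = (i z - 2 t l) phi dl]. The imaginary part [F] of [phi] vanishes at both
    ends, so integrating this relation expresses the kernel by the previous one, without
    differentiating in [z]. *)
Lemma gamma_kernel1 :
  \int[mu]_(r in `]0, +oo[) (expR (- (c * z * r)) * (- (2 * c ^+ 2 * r) * cos (th r))) =
  pi * heat1 z t.
Proof.
have cos_i k : intble `]0, +oo[ (fun r => r ^+ k * expR (- (c * z * r)) * cos (th r)).
  by apply: trig_intble; [rewrite /th; meas|move=> r; exact: norm_cos_le1].
have sin_i k : intble `]0, +oo[ (fun r => r ^+ k * expR (- (c * z * r)) * sin (th r)).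
  by apply: trig_intble; [rewrite /th; meas|move=> r; exact: norm_sin_le1].
pose u (r : R) := expR (- (c * z * r)) * (c * cos (th r) - c * sin (th r)).
pose v (r : R) := expR (- (c * z * r)) * (- (2 * c ^+ 2 * r) * cos (th r)).
have ui : intble `]0, +oo[ u.
  have := intbleB mD (intbleZl c mD (cos_i 0%N)) (intbleZl c mD (sin_i 0%N)).
  by apply: intble_eq => // r _; rewrite /u; ring.
have vi : intble `]0, +oo[ v.
  have := intbleZl (- (2 * c ^+ 2)) mD (cos_i 1%N).
  by apply: intble_eq => // r _; rewrite /v; ring.
pose F (r : R) := expR (- (c * z * r)) * sin (th r).
have dF (r : R) : is_derive r 1 F (z * u r + 2 * t * v r).
  by rewrite /F /u /v /th; deriv; rewrite /GRing.scale/=; ring.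
have cF (r : R) : {for r, continuous (fun r => z * u r + 2 * t * v r)}.
  by rewrite /u /v /th; cts.
have i0 : intble `]0, +oo[ (fun r => z * u r + 2 * t * v r).
  by apply: intbleD => //; apply: intbleZl.
have F0 : F r @[r --> (0:R)^'+] --> 0.
  have := is_derive_cts (dF 0); move/cvg_at_right_filter.
  by rewrite /F /th !mulr0 expr0n/= mulr0 subr0 sin0 mulr0.
have Fy : F r @[r --> +oo] --> 0.
  apply: (@cvg_pinfty_bnd _ _ (c * z)^-1) => r r1.
  have r0 : 0 < r by apply: lt_le_trans r1.
  have cz : 0 < c * z by rewrite mulr_gt0.
  rewrite /F normrM (ger0_norm (expR_ge0 _)).
  apply: (@le_trans _ _ (expR (- (c * z * r)))); first by rewrite ler_piMr ?norm_sin_le1 ?expR_ge0.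
  rewrite -invfM -[leRHS]div1r ler_pdivlMr ?mulr_gt0//.
  have := @pow_exp_bound R 1 (c * z * r) (mulr_ge0 (ltW cz) (ltW r0)).
  by rewrite expr1 mulrC.
have := FTC_oy (fun r _ => dF r) (fun r _ => cF r) i0 F0 Fy; rewrite subrr.
rewrite (@RintegralD _ (measurableTypeR R) R mu)//; [|exact: intbleZl|exact: intbleZl].
rewrite (@RintegralZl _ (measurableTypeR R) R mu)// (@RintegralZl _ (measurableTypeR R) R mu)//.
rewrite {1}/u gamma_kernel0 -/v => E.
rewrite /heat1; apply: (@mulfI _ (2 * t)); first by rewrite gt_eqF// mulr_gt0.
rewrite [RHS](_ : _ = - (z * (pi * heat z t))); last by field; rewrite gt_eqF.
by apply/eqP; rewrite -addr_eq0 addrC; apply/eqP.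
Qed.

End Gamma.

(** This is [(1 + erf w) / 2], as [gauss_fun x] is [exp (- x ^ 2)]. *)
Definition Phi w : R := (Num.sqrt pi)^-1 * \int[mu]_(x in `]-oo, w]) gauss_fun x.

Let gi : intble setT (@gauss_fun R). Proof. exact: integrableT_gauss. Qed.

Lemma dPhi w : is_derive w 1 Phi ((Num.sqrt pi)^-1 * gauss_fun w).
Proof.
have [||||d1 d2] := @continuous_FTC1 R gauss_fun -oo%O w (w + 1) _ _ _ _.
- by rewrite ltrDl.
- by apply: (@integrableS _ (measurableTypeR R) R mu setT) => //; exact: gi.
- by first [exact: isT | rewrite ltNye | rewrite ltNyr | rewrite /Order.lt /= ].
- exact: continuous_gauss_fun.
have H : is_derive w 1 (fun v : R => \int[mu]_(x in `]-oo, v]) gauss_fun x) (gauss_fun w).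
  by apply: (@DeriveDef _ _ _ _ _ _ _ d1); rewrite -derive1E; exact: d2.
by refine (is_derive_eq (isd_mul (isd_cst (Num.sqrt pi)^-1 w) H) _); rewrite mulr0 addr0.
Qed.

Lemma continuous_Phi : continuous Phi.
Proof. by move=> w; exact: is_derive_cts (dPhi w). Qed.

Let sp0 : 0 < Num.sqrt pi :> R. Proof. by rewrite sqrtr_gt0 pi_gt0. Qed.

Lemma Phi_ge0 w : 0 <= Phi w.
Proof.
by rewrite mulr_ge0 ?invr_ge0 ?(ltW sp0)//; apply: Rintegral_ge0 => x _; exact: gauss_fun_ge0.
Qed.

Let PhiE w : Phi w = (Num.sqrt pi)^-1 * \int[mu]_x (\1_`]-oo, w] x * gauss_fun x).
Proof. by rewrite /Phi Rint_indicM. Qed.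

(** Serves at both infinities: the cut-off indicator tends pointwise to the constant [k], with the
    Gaussian as dominating function. *)
Let Phi_cvg (F : set_system R) {FF : Filter F} (B : nat -> set R) (k : R) :
  (forall n, F (B n)) -> (forall A, F A -> exists n, forall m, (n <= m)%N -> B m `<=` A) ->
  (forall x, \forall w \near F, \1_`]-oo, w] x = k :> R) -> Phi w @[w --> F] --> k.
Proof.
move=> FB BF Fk; have -> : k = (Num.sqrt pi)^-1 * \int[mu]_x (k * gauss_fun x).
  rewrite (@RintegralZl _ (measurableTypeR R) R mu)//.
  by rewrite /Rintegral integralT_gauss/= mulrCA mulVf ?mulr1// gt_eqF.
under eq_fun do rewrite PhiE; apply: cvgMr.
have mg : measurable_fun setT (@gauss_fun R) by exact: measurable_gauss_fun.
apply: (@dominated_cvg_filter R _ F _ B setT _ gauss_fun) => //.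
- exact: meas_mul.
- by apply: nearW => w; apply: meas_mul => //; apply: measurable_indic.
- apply: nearW => w x _; rewrite normrM (ger0_norm (gauss_fun_ge0 _)) ler_piMl ?gauss_fun_ge0//.
  by rewrite indicE; case: (_ \in _); rewrite ?normr1 ?normr0.
- by apply: aeW => x _; apply: cvg_near_cst; apply: filterS (Fk x) => w ->.
Qed.

Lemma Phi_Ny : Phi w @[w --> -oo] --> 0.
Proof.
apply: (@Phi_cvg _ _ (fun n => [set w | w < - n%:R])).
- by move=> n; apply: nbhs_ninfty_lt; exact: num_real.
- move=> A [M [Mr MA]]; exists (Num.bound `|M|) => m nm w /= wm; apply: MA.
  apply: (lt_le_trans wm); rewrite lerNl.
  apply: (@le_trans _ _ (Num.bound `|M|)%:R); last by rewrite ler_nat (leq_trans _ nm).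
  by rewrite (le_trans (ler_norm _))// normrN ltW// archi_boundP// normr_ge0.
- move=> x; near=> w; rewrite indicE memNset//= in_itv/= => xw.
  have : w < x by near: w; apply: nbhs_ninfty_lt; exact: num_real.
  by rewrite ltNge xw.
Unshelve. all: by end_near. Qed.

Lemma Phi_y : Phi w @[w --> +oo] --> (1 : R).
Proof.
apply: (@Phi_cvg _ _ (fun n => [set w | n%:R < w])).
- by move=> n; apply: nbhs_pinfty_gt; exact: num_real.
- move=> A [M [Mr MA]]; exists (Num.bound `|M|) => m nm w /= wm; apply: MA.
  apply: (le_lt_trans _ wm).
  apply: (@le_trans _ _ (Num.bound `|M|)%:R); last by rewrite ler_nat (leq_trans _ nm).
  by rewrite (le_trans (ler_norm _))// ltW// archi_boundP// normr_ge0.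
- move=> x; near=> w; rewrite indicE mem_set//= in_itv/=.
  by near: w; apply: nbhs_pinfty_ge; exact: num_real.
Unshelve. all: by end_near. Qed.

(** The sum has derivative zero, and its constant value is read off at infinity. *)
Lemma PhiDN w : Phi w + Phi (- w) = 1.
Proof.
have dS (v : R) : is_derive v 1 (fun v : R => Phi v + Phi (- v)) 0.
  refine (is_derive_eq (isd_add (dPhi v) (@isd_comp R Phi (fun y => - y) v _ _ (dPhi (- v)) (isd_opp (isd_id v)))) _).
  by rewrite /gauss_fun sqrrN mulrN1 subrr.
have E v : Phi v + Phi (- v) = Phi w + Phi (- w).
  exact: (@is_derive_0_is_cst _ _ v w dS).
have : Phi v + Phi (- v) @[v --> +oo] --> (1 + 0 : R).
  apply: cvgD; first exact: Phi_y.
  by apply/(cvgNy_compNP Phi); exact: Phi_Ny.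
under eq_fun do rewrite E.
by rewrite addr0 => /(cvg_unique _ (cvg_cst _)); apply.
Qed.

Lemma Phi_le1 w : Phi w <= 1.
Proof. by rewrite -(PhiDN w) lerDl Phi_ge0. Qed.


(* The value at [t <= 0] is the limit as [t -> 0], for [w != 0]. *)
Definition Psi w t : R := if 0 < t then Phi (w / (2 * Num.sqrt t)) else ((0 : R) < w)%R%:R.

(** For [t > 0] this is the integral of [Psi (- y) t] over [y > x], that is [sqrt t] times the
    iterated complementary error function of [x / (2 sqrt t)]. *)
Definition Theta x t : R := 2 * t * heat x t - x * Psi (- x) t.

Lemma Psi_ge0 w t : 0 <= Psi w t.
Proof. by rewrite /Psi; case: ifPn => _; rewrite ?Phi_ge0// ler0n. Qed.

Lemma Psi_le1 w t : Psi w t <= 1.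
Proof. by rewrite /Psi; case: ifPn => _; rewrite ?Phi_le1// lern1; case: (0 < w). Qed.

(** At [w = 0], [t <= 0] both terms are zero, whence the hypothesis. The identity merges the traces
    of the two reflected kernels into a constant. *)
Lemma PsiDN w t : 0 < t \/ w != 0 -> Psi w t + Psi (- w) t = 1.
Proof.
rewrite /Psi; case: ifPn => [t0 _|t0 [//|w0]]; first by rewrite mulNr PhiDN.
by rewrite oppr_gt0; case: ltgtP w0 => //= _ _; rewrite ?addr0 ?add0r.
Qed.

Lemma heat_ge0 w t : 0 <= heat w t.
Proof. by rewrite mulr_ge0 ?invr_ge0 ?sqrtr_ge0 ?expR_ge0. Qed.

Lemma heat_nonpos w t : t <= 0 -> heat w t = 0.
Proof.
move=> t0; rewrite /heat ler0_sqrtr ?invr0 ?mul0r//.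
by rewrite mulr_ge0_le0// mulr_ge0// pi_ge0.
Qed.

Lemma heat_le w t : heat w t <= (Num.sqrt (4 * pi * t))^-1.
Proof.
have [t0|t0] := leP t 0; first by rewrite heat_nonpos// invr_ge0 sqrtr_ge0.
rewrite ler_piMr ?invr_ge0 ?sqrtr_ge0// expN_le1// mulr_ge0 ?sqr_ge0//.
by rewrite invr_ge0 mulr_ge0// ltW.
Qed.

Let sqrt4 t : 0 < t -> Num.sqrt (4 * pi * t) = 2 * Num.sqrt pi * Num.sqrt t.
Proof.
move=> t0; rewrite sqrtrM ?mulr_ge0 ?pi_ge0// sqrtrM//.
have -> : 4 = 2 ^+ 2 :> R by rewrite -natrX.
by rewrite sqrtr_sqr ger0_norm.
Qed.

Let gaussE w t : 0 < t -> gauss_fun (w / (2 * Num.sqrt t)) = expR (- (w ^+ 2 / (4 * t))).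
Proof.
move=> t0; rewrite /gauss_fun; congr (expR (- _)).
by rewrite expr_div_n exprMn sqr_sqrtr ?ltW// -natrX.
Qed.

Let near_pos t : 0 < t -> \forall s \near t, 0 < s.
Proof. by move=> t0; exact: lt_nbhsr. Qed.

Lemma dPsi_w w t : 0 < t -> is_derive w 1 (Psi ^~ t) (heat w t).
Proof.
move=> t0; have s0 : 0 < Num.sqrt t by rewrite sqrtr_gt0.
have -> : Psi ^~ t = (fun w => Phi (w * (2 * Num.sqrt t)^-1)).
  by apply/funext => v; rewrite /Psi t0.
refine (is_derive_eq (@isd_comp R Phi (fun w => w * (2 * Num.sqrt t)^-1) w _ _ (dPhi _) (isd_mul (isd_id w) (isd_cst _ w))) _).
rewrite gaussE// /heat sqrt4//; field; by rewrite !gt_eqF.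
Qed.

(** [heat1] is both the [w]-derivative of [heat] and the [t]-derivative of [Psi], so the dipole can
    be integrated by parts in time with the bounded primitive [Psi]. *)
Lemma dPsi_t w t : 0 < t -> is_derive t 1 (Psi w) (heat1 w t).
Proof.
move=> t0; have s0 : 0 < Num.sqrt t by rewrite sqrtr_gt0.
have E : \forall s \near t, Phi (w * (2 * Num.sqrt s)^-1) = Psi w s.
  by near=> s; rewrite /Psi ifT//; near: s; exact: near_pos.
apply: (near_eq_is_derive E).
have ds := is_derive1_sqrt t0.
have n2 : 2 * Num.sqrt t != 0 by rewrite gt_eqF// mulr_gt0.
refine (is_derive_eq (@isd_comp R Phi (fun s => w * (2 * Num.sqrt s)^-1) t _ _ (dPhi _)
  (isd_mul (isd_cst _ t) (@is_deriveV R _ t _ 1 n2 (isd_mul (isd_cst 2 t) ds)))) _).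
rewrite gaussE// /heat1 /heat sqrt4// /GRing.scale/=.
have e : t = Num.sqrt t ^+ 2 by rewrite sqr_sqrtr// ltW.
move: (expR _) => g; set S := Num.sqrt t in e s0 *; rewrite e.
by field; rewrite !gt_eqF.
Unshelve. all: by end_near. Qed.

Lemma dheat_w w t : 0 < t -> is_derive w 1 (heat ^~ t) (heat1 w t).
Proof.
move=> t0; rewrite /heat1 /heat; deriv; rewrite /GRing.scale/=.
field; by rewrite !gt_eqF ?sqrtr_gt0 ?mulr_gt0 ?pi_gt0.
Qed.

Lemma dheat_t w t : 0 < t ->
  is_derive t 1 (heat w) ((w ^+ 2 / (4 * t ^+ 2) - (2 * t)^-1) * heat w t).
Proof.
move=> t0; have p0 := pi_gt0 R; have q0 : 0 < 4 * pi * t by rewrite !mulr_gt0.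
have ds := is_derive1_sqrt q0.
have n2 : Num.sqrt (4 * pi * t) != 0 by rewrite gt_eqF// sqrtr_gt0.
have n4 : 4 * t != 0 by rewrite gt_eqF// mulr_gt0.
refine (is_derive_eq (isd_mul (@is_deriveV R _ t _ 1 n2 (@isd_comp R Num.sqrt (fun s => 4 * pi * s) t _ _ ds (isd_mul (isd_cst _ t) (isd_id t))))
  (isd_expR (isd_opp (isd_mul (isd_cst (w ^+ 2) t) (@is_deriveV R _ t _ 1 n4 (isd_mul (isd_cst 4 t) (isd_id t))))))) _).
rewrite /GRing.scale/= /heat; set S := Num.sqrt _ in n2 *; set e := expR _.
have S2 : pi = S ^+ 2 / (4 * t) by rewrite sqr_sqrtr ?(ltW q0)//; field; rewrite gt_eqF.
by rewrite S2; field; rewrite n2 gt_eqF.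
Qed.

Lemma dTheta_x x t : 0 < t -> is_derive x 1 (Theta ^~ t) (- Psi (- x) t).
Proof.
move=> t0; refine (is_derive_eq (isd_add (isd_mul (isd_cst (2 * t) x) (dheat_w x t0))
  (isd_opp (isd_mul (isd_id x) (@isd_comp R (Psi ^~ t) (fun y => - y) x _ _ (dPsi_w (- x) t0) (isd_opp (isd_id x)))))) _).
by rewrite /heat1 /heat sqrrN; field; rewrite !gt_eqF// sqrtr_gt0 !mulr_gt0 ?pi_gt0.
Qed.

(** In the time variable [Theta] is to [heat] what [Psi] is to [heat1]. *)
Lemma dTheta_t x t : 0 < t -> is_derive t 1 (Theta x) (heat x t).
Proof.
move=> t0; refine (is_derive_eq (isd_add (isd_mul (isd_mul (isd_cst 2 t) (isd_id t)) (dheat_t x t0))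
  (isd_opp (isd_mul (isd_cst x t) (dPsi_t (- x) t0)))) _).
by rewrite /heat1 /heat sqrrN; field; rewrite !gt_eqF// sqrtr_gt0 !mulr_gt0 ?pi_gt0.
Qed.

(** With [y = w / (2 sqrt t)] the kernel equals [y exp (- y ^ 2) / (sqrt pi * w)]. Being uniform in
    time, the bound controls Duhamel integrals near [s = t]. *)
Lemma heat_le_inv w t : 0 < w -> heat w t <= (Num.sqrt pi * w)^-1.
Proof.
move=> w0; have [t0|t0] := leP t 0.
  by rewrite heat_nonpos// invr_ge0 mulr_ge0 ?(ltW sp0)// ltW.
have s0 : 0 < Num.sqrt t by rewrite sqrtr_gt0.
rewrite /heat -gaussE// sqrt4// /gauss_fun.
pose y := w / (2 * Num.sqrt t); have y0 : 0 < y by rewrite divr_gt0 ?mulr_gt0.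
have := pow_exp_bound 1 (sqr_ge0 y); have := expN_le1 (sqr_ge0 y); rewrite -/y expr1.
move: (expR_gt0 (- y ^+ 2)); move: (expR _) => e e0 e1 e2.
have ye : y * e <= 1.
  have [y1|y1] := leP y 1; first by rewrite -[leRHS]mulr1 ler_pM// ltW.
  by apply: le_trans e2; rewrite ler_wpM2r ?(ltW e0)// expr2 ler_peMr ?ltW.
have -> : (2 * Num.sqrt pi * Num.sqrt t)^-1 * e = (Num.sqrt pi * w)^-1 * (y * e).
  by rewrite /y; field; rewrite !gt_eqF.
by rewrite ler_piMr// invr_ge0 mulr_ge0 ?(ltW sp0)// ltW.
Qed.

Lemma heat1_bnd w t : 0 < w -> 0 < t -> `|heat1 w t| <= 6 / (Num.sqrt pi * w ^+ 2).
Proof.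
move=> w0 t0; have s0 : 0 < Num.sqrt t by rewrite sqrtr_gt0.
rewrite /heat1 normrM normrN (ger0_norm (heat_ge0 _ _)) ger0_norm; last first.
  by rewrite divr_ge0 ?mulr_ge0// ltW.
rewrite /heat -gaussE// sqrt4// /gauss_fun.
pose y := w / (2 * Num.sqrt t); have y0 : 0 < y by rewrite divr_gt0 ?mulr_gt0.
have := pow_exp_bound 1 (sqr_ge0 y); have := pow_exp_bound 2 (sqr_ge0 y); rewrite -/y expr1.
move: (expR_gt0 (- y ^+ 2)); move: (expR _) => e e0 e2 e1.
(* From [y ^ 3 <= y ^ 2 + y ^ 4] and the bounds [1!] and [2!]; the remaining factor 2 makes the
   constant 6. *)
have ye : y ^+ 3 * e <= 3.
  apply: (@le_trans _ _ (y ^+ 2 * e + (y ^+ 2) ^+ 2 * e)).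
    rewrite -mulrDl ler_wpM2r ?(ltW e0)//.
    have := sqr_ge0 (y * (y - 1)); have := sqr_ge0 y; nra.
  by move: e1 e2 => /= e1 e2; apply: (le_trans (lerD e1 e2)); rewrite -natrD ler_nat.
have tE : t = w ^+ 2 / (4 * y ^+ 2).
  rewrite /y expr_div_n exprMn sqr_sqrtr ?(ltW t0)//; field; by rewrite !gt_eqF.
have -> : w / (2 * t) * ((2 * Num.sqrt pi * Num.sqrt t)^-1 * e) = 2 / (Num.sqrt pi * w ^+ 2) * (y ^+ 3 * e).
  have -> : (2 * Num.sqrt pi * Num.sqrt t)^-1 = y / (Num.sqrt pi * w).
    by rewrite /y; field; rewrite !gt_eqF.
  by rewrite tE; field; rewrite !gt_eqF.
apply: (@le_trans _ _ (2 / (Num.sqrt pi * w ^+ 2) * 3)).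
  by rewrite ler_wpM2l// divr_ge0// mulr_ge0 ?sqr_ge0// ltW.
by rewrite le_eqVlt; apply/orP; left; apply/eqP; field; rewrite !gt_eqF.
Qed.

Lemma measurable_Psi x t : measurable_fun (setT : set R) (fun y => Psi (x - y) t).
Proof.
have [t0|t0] := ltP 0 t.
  apply: continuous_measurable_fun => y.
  exact: is_derive_cts (@isd_comp R (Psi ^~ t) (fun y => x - y) y _ _ (dPsi_w _ t0) (isd_add (isd_cst x y) (isd_opp (isd_id y)))).
have -> : (fun y => Psi (x - y) t) = \1_`]-oo, x[.
  apply/funext => y; rewrite /Psi ltNge t0/= indicE subr_gt0.
  by case: (ltP y x) => yx; [rewrite mem_set//= in_itv|rewrite memNset//= in_itv/= ltNge yx].
exact: measurable_indic.
Qed.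

Lemma cvg0_le {T : Type} (F : set_system T) {FF : Filter F} (f h : T -> R) :
  (\forall p \near F, `|f p| <= h p) -> h p @[p --> F] --> (0 : R) ->
  f p @[p --> F] --> (0 : R).
Proof.
move=> fh h0; apply/cvgr0Pnorm_lt => e e0; near=> p.
have fp : `|f p| <= h p by near: p.
by apply: (le_lt_trans fp); near: p; exact: (cvgr_lt _ h0).
Unshelve. all: by end_near. Qed.

(** * Limits of [Psi], [heat] and [Theta] along a filter *)

Section Limits.
Context {T : Type} (F : set_system T) {FF : Filter F}.
Variables (w t : T -> R) (w0 t0 : R).
Hypotheses (wF : w p @[p --> F] --> w0) (tF : t p @[p --> F] --> t0).
Hypothesis (tge0 : \forall p \near F, 0 <= t p).

Let Psi_cvg_neg (w' : T -> R) (v : R) : v < 0 -> w' p @[p --> F] --> v -> t0 = 0 ->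
  Psi (w' p) (t p) @[p --> F] --> (0 : R).
Proof.
move=> v0 w'F t00; apply/cvgr0Pnorm_lt => e e0.
have /cvgr0Pnorm_lt/(_ _ e0)[M [_ HM]] := @Phi_Ny.
pose m := `|M| + 1; have m0 : 0 < m by rewrite ltr_wpDl.
have st : Num.sqrt (t p) @[p --> F] --> (0 : R).
  rewrite -[X in _ --> X](sqrtr0 R) -t00; apply: (cvg_comp _ _ tF); exact: sqrt_continuous.
(* If [w' < v / 2] and [sqrt t] is below this threshold, then [w' / (2 sqrt t) < - m]; adding 1 in
   [m] makes it positive. *)
have d0 : 0 < - v / (4 * m) by rewrite divr_gt0 ?oppr_gt0 ?mulr_gt0.
near=> p; have tp : 0 <= t p by near: p.
have wp : w' p < v / 2.
  by near: p; apply: (cvgr_lt _ w'F); rewrite ltr_pdivlMr// mulr_natr mulr2n gtrDl.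
have sp : Num.sqrt (t p) < - v / (4 * m) by near: p; exact: (cvgr_lt _ st).
have wp0 : w' p < 0 by rewrite (lt_trans wp)// ltr_pdivrMr// mul0r.
rewrite /Psi; case: ifPn => [tp0|_]; last by rewrite (lt_gtF wp0) normr0.
apply: HM; apply: (@lt_le_trans _ _ (- `|M|)); last by rewrite lerNl -normrN ler_norm.
have sp1 : 0 < Num.sqrt (t p) by rewrite sqrtr_gt0.
rewrite ltr_pdivrMr ?mulr_gt0//; apply: (lt_trans wp).
move: sp; rewrite ltr_pdivlMr ?mulr_gt0//.
have : `|M| * Num.sqrt (t p) <= m * Num.sqrt (t p) by rewrite ler_wpM2r ?(ltW sp1)// lerDl.
rewrite (mulrC _ (4 * m)) -(mulrA 4) mulNr (mulrCA `|M|).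
move: (m * _) (`|M| * _) => a b; lra.
Unshelve. all: by end_near. Qed.

Let Psi_cvg_pos (w' : T -> R) (v : R) : w' p @[p --> F] --> v -> 0 < t0 ->
  Psi (w' p) (t p) @[p --> F] --> Psi v t0.
Proof.
move=> w'F t00; have n2 : 2 * Num.sqrt t0 != 0 by rewrite gt_eqF// mulr_gt0// sqrtr_gt0.
have : Phi (w' p / (2 * Num.sqrt (t p))) @[p --> F] --> Phi (v / (2 * Num.sqrt t0)).
  apply: (@cvg_comp _ _ _ (fun p => w' p / (2 * Num.sqrt (t p))) Phi); last exact: continuous_Phi.
  apply: cvgM => //; apply: cvgV => //; apply: cvgM; first exact: cvg_cst.
  by apply: (cvg_comp _ _ tF); exact: sqrt_continuous.
rewrite {2}/Psi t00; apply: cvg_trans.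
apply: near_eq_cvg; near=> p; rewrite /Psi ifT//; near: p.
exact: (cvgr_gt _ tF).
Unshelve. all: by end_near. Qed.

(** The origin is left out because [Psi] takes the constant value [Phi (k / 2)] on each curve
    [w = k * sqrt t]. At time 0 a positive [w0] is reduced to a negative one by [PsiDN]. *)
Lemma Psi_cvg : 0 < t0 \/ w0 != 0 /\ t0 = 0 -> Psi (w p) (t p) @[p --> F] --> Psi w0 t0.
Proof.
case=> [t00|[w00 t00]]; first exact: Psi_cvg_pos.
case: (ltgtP w0 0) w00 => // wn _.
  rewrite /Psi t00 ltxx ltNge (ltW wn)/=.
  exact: Psi_cvg_neg wn wF t00.
have -> : Psi w0 t0 = 1 - 0 by rewrite /Psi t00 ltxx wn subr0.
have : 1 - Psi (- w p) (t p) @[p --> F] --> (1 - 0 : R).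
  apply: cvgB; first exact: cvg_cst.
  by apply: (@Psi_cvg_neg _ (- w0)) => //; [rewrite oppr_lt0|exact: cvgN].
apply: cvg_trans; apply: near_eq_cvg; near=> p.
rewrite -(@PsiDN (w p) (t p)) ?addrK//; right.
by rewrite gt_eqF//; near: p; exact: (cvgr_gt _ wF).
Unshelve. all: by end_near. Qed.

Lemma heat_cvg : 0 < t0 -> heat (w p) (t p) @[p --> F] --> heat w0 t0.
Proof.
move=> t00; have q0 : 0 < 4 * pi * t0 by rewrite !mulr_gt0// pi_gt0.
apply: cvgM.
  apply: cvgV; first by rewrite gt_eqF// sqrtr_gt0.
  apply: (@cvg_comp _ _ _ (fun p => 4 * pi * t p) Num.sqrt); last exact: sqrt_continuous.
  by apply: cvgMr.
apply: (@cvg_comp _ _ _ (fun p => - (w p ^+ 2 / (4 * t p))) expR); last exact: continuous_expR.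
apply: cvgN; apply: cvgM.
  by rewrite expr2; under eq_fun do rewrite expr2; exact: cvgM.
apply: cvgV; first by rewrite gt_eqF// mulr_gt0.
exact: cvgMr.
Qed.

(** Unlike for [Psi], the origin is allowed: [2 t heat] is at most [sqrt (4 pi t) / (2 pi)], and the
    factor [x] absorbs the bounded [Psi]. *)
Lemma Theta_cvg : (\forall p \near F, 0 <= w p) -> 0 <= w0 -> 0 <= t0 ->
  Theta (w p) (t p) @[p --> F] --> Theta w0 t0.
Proof.
move=> wge0 w00; rewrite le_eqVlt => /predU1P[t00|t00].
  rewrite /Theta; apply: cvgB.
    rewrite heat_nonpos -?t00// mulr0.
    apply: (@cvg0_le _ _ _ _ (fun p => Num.sqrt (4 * pi * t p) / (2 * pi))).
      near=> p; have tp : 0 <= t p by near: p.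
      rewrite ger0_norm ?mulr_ge0 ?heat_ge0//.
      apply: (le_trans (ler_wpM2l _ (heat_le _ _))); first by rewrite mulr_ge0.
      move: tp; rewrite le_eqVlt => /predU1P[<-|tp]; first by rewrite !(mulr0, mul0r, sqrtr0).
      have p0 := pi_gt0 R.
      have q0 : 0 < 4 * pi * t p by rewrite !mulr_gt0.
      have s0 : 0 < Num.sqrt (4 * pi * t p) by rewrite sqrtr_gt0.
      have tE : t p = Num.sqrt (4 * pi * t p) ^+ 2 / (4 * pi).
        by rewrite sqr_sqrtr ?(ltW q0)// [RHS]mulrC mulKf// gt_eqF// mulr_gt0.
      pose S : R := Num.sqrt (4 * pi * t p); rewrite -/S in s0 tE *; rewrite tE.
      rewrite le_eqVlt; apply/orP; left; apply/eqP.
      have S0 : S != 0 by rewrite gt_eqF.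
      have P0 : pi != 0 :> R by rewrite gt_eqF.
      by move: P0 S0; move: (pi : R) (S : R) => q r q1 r1; field; rewrite q1 r1.
    have -> : 0 = Num.sqrt (4 * pi * t0) / (2 * pi) by rewrite -t00 mulr0 sqrtr0 mul0r.
    apply: cvgMl; apply: (@cvg_comp _ _ _ (fun p => 4 * pi * t p) Num.sqrt); last exact: sqrt_continuous.
    exact: cvgMr.
  have -> : w0 * Psi (- w0) t0 = 0.
    by rewrite /Psi -t00 ltxx oppr_gt0 ltNge w00 mulr0.
  move: (w00); rewrite le_eqVlt => /predU1P[w0E|w0p].
    apply: (@cvg0_le _ _ _ _ w); last by rewrite w0E.
    near=> p; have wp : 0 <= w p by near: p.
    by rewrite ger0_norm ?mulr_ge0 ?Psi_ge0// ler_piMr ?Psi_le1.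
  rewrite -[X in _ --> X](mulr0 w0); apply: cvgM => //.
  by apply: (@Psi_cvg_neg _ (- w0)); rewrite ?oppr_lt0//; exact: cvgN.
apply: cvgB.
  by apply: cvgM; [exact: cvgMr|exact: heat_cvg].
apply: cvgM => //.
by apply: Psi_cvg_pos => //; exact: cvgN.
Unshelve. all: by end_near. Qed.
End Limits.

End HeatKernel.

(** * Heat potentials and their derivatives *)

Section Potentials.
Context {R : realType}.
Notation mu := (@lebesgue_measure R).
Notation pos := (`]0, +oo[%classic : set R).
Implicit Types (f h : R -> R) (x t : R).

Let mpos : measurable pos. Proof. by []. Qed.

Let sub_eqN (A B C : R) : A - B = - C -> B = C + A.
Proof. by move=> /eqP; rewrite subr_eq => /eqP ->; rewrite addrA subrr add0r. Qed.

Lemma norm_Psi_le1 (w t : R) : `|Psi w t| <= 1.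
Proof. by rewrite ger0_norm ?Psi_ge0 ?Psi_le1. Qed.

Let dPsi_sub (x t y : R) : 0 < t -> is_derive y 1 (fun y => Psi (x - y) t) (- heat (x - y) t).
Proof.
move=> t0; refine (is_derive_eq (@isd_comp R (Psi ^~ t) (fun y => x - y) y _ _ (dPsi_w _ t0)
  (isd_add (isd_cst x y) (isd_opp (isd_id y)))) _).
by rewrite add0r mulrN1.
Qed.

Let dheat_sub (x t y : R) : 0 < t -> is_derive y 1 (fun y => heat (x - y) t) (- heat1 (x - y) t).
Proof.
move=> t0; refine (is_derive_eq (@isd_comp R (heat ^~ t) (fun y => x - y) y _ _ (dheat_w _ t0)
  (isd_add (isd_cst x y) (isd_opp (isd_id y)))) _).
by rewrite add0r mulrN1.
Qed.

Let cheat_sub (x t y : R) : 0 < t -> {for y, continuous (fun y => heat (x - y) t)}.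
Proof. by move=> t0; exact: is_derive_cts (dheat_sub x y t0). Qed.

Lemma measurable_heat_sub (x t : R) : 0 < t -> measurable_fun (setT : set R) (fun y => heat (x - y) t).
Proof. by move=> t0; apply: continuous_measurable_fun => y; exact: cheat_sub. Qed.

Lemma intble_Psi f x t : intble pos f -> intble pos (fun y => Psi (x - y) t * f y).
Proof.
move=> fi; apply: (@intble_bndM _ _ _ _ 1) => //.
  by apply: measurable_funTS; exact: measurable_Psi.
by move=> y _; exact: norm_Psi_le1.
Qed.

Lemma intble_heat f x t : 0 < t -> intble pos f -> intble pos (fun y => heat (x - y) t * f y).
Proof.
move=> t0 fi; apply: (@intble_bndM _ _ _ _ (Num.sqrt (4 * pi * t))^-1) => //.
  by apply: measurable_funTS; exact: measurable_heat_sub.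
by move=> y _; rewrite ger0_norm ?heat_ge0 ?heat_le.
Qed.

Lemma heat_ibp f (f' : R -> R) (a x t : R) : 0 < t ->
  (forall y : R, 0 < y -> is_derive y 1 f (f' y)) ->
  (forall y : R, 0 < y -> {for y, continuous f'}) ->
  intble pos f -> intble pos f' ->
  f y @[y --> (0:R)^'+] --> a -> f y @[y --> +oo] --> (0:R) ->
  \int[mu]_(y in pos) (heat (x - y) t * f y) =
  Psi x t * a + \int[mu]_(y in pos) (Psi (x - y) t * f' y).
Proof.
move=> t0 df cf' fi f'i f0 fy.
pose F (y : R) := Psi (x - y) t * f y.
have dF (y : R) : 0 < y -> is_derive y 1 F (Psi (x - y) t * f' y - heat (x - y) t * f y).
  move=> y0; refine (is_derive_eq (isd_mul (dPsi_sub x y t0) (df y y0)) _).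
  by rewrite mulrN (mulrC (f y)).
have cF (y : R) : 0 < y -> {for y, continuous (fun y => Psi (x - y) t * f' y - heat (x - y) t * f y)}.
  move=> y0; apply: cts_add; last apply: cts_opp; apply: cts_mul.
  - exact: is_derive_cts (dPsi_sub x y t0).
  - exact: cf'.
  - exact: cheat_sub.
  - exact: is_derive_cts (df y y0).
have i0 : intble pos (fun y => Psi (x - y) t * f' y - heat (x - y) t * f y).
  by apply: intbleB => //; [exact: intble_Psi|exact: intble_heat].
have F0 : F y @[y --> (0:R)^'+] --> Psi x t * a.
  apply: cvgM => //.
  have := is_derive_cts (dPsi_sub x 0 t0); move/cvg_at_right_filter.
  by rewrite subr0.
have Fy : F y @[y --> +oo] --> (0 : R).
  apply: (@cvg0_le _ _ _ _ _ (fun y => `|f y|)).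
    by apply: nearW => y; rewrite /F normrM ler_piMl ?norm_Psi_le1.
  by rewrite -[X in _ --> X](@normr0 _ R); exact: cvg_norm.
have := FTC_oy dF cF i0 F0 Fy.
rewrite (@RintegralB _ (measurableTypeR R) R mu)//; [|exact: intble_Psi|exact: intble_heat].
by rewrite sub0r => /sub_eqN.
Qed.

Lemma Psi_conv_derive f x t : 0 < t -> intble pos f ->
  is_derive x 1 (fun x => \int[mu]_(y in pos) (Psi (x - y) t * f y))
    (\int[mu]_(y in pos) (heat (x - y) t * f y)).
Proof.
move=> t0 fi; apply: (@is_derive_under_integral _ _ _ (fun x y => heat (x - y) t * f y)
   (fun y => (Num.sqrt (4 * pi * t))^-1 * `|f y|) x 1) => //.
- by move=> z _; exact: intble_Psi.
- move=> z y _ _; refine (is_derive_eq (isd_mul (@isd_comp R (Psi ^~ t) (fun z => z - y) z _ _ (dPsi_w _ t0)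
    (isd_add (isd_id z) (isd_opp (isd_cst y z)))) (isd_cst (f y) z)) _).
  by rewrite subr0 mulr1 mulr0 add0r mulrC.
- by apply: intbleZl => //; exact: intble_norm.
- by move=> z y _ _; rewrite normrM ler_wpM2r// ger0_norm ?heat_ge0 ?heat_le.
Qed.

Lemma Psi_convN_derive f x t : 0 < t -> intble pos f ->
  is_derive x 1 (fun x => \int[mu]_(y in pos) (Psi (- x - y) t * f y))
    (- \int[mu]_(y in pos) (heat (- x - y) t * f y)).
Proof.
move=> t0 fi; refine (is_derive_eq (@isd_comp R
  (fun x => \int[mu]_(y in pos) (Psi (x - y) t * f y)) (fun x => - x) x _ _
  (Psi_conv_derive (- x) t0 fi) (isd_opp (isd_id x))) _).
by rewrite mulrN1.
Qed.

(** Stated for an abstract pair with [K' = k], to serve for [heat1], [Psi] and for [heat], [Theta].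
    The vanishing of [K] at 0 removes the term at [s = t]; the term at [s = 0] carries the initial
    value of the datum. *)
Lemma duhamel_ibp (k K h h' : R -> R) (t a M : R) : 0 < t ->
  (forall s : R, 0 < s -> is_derive s 1 K (k s)) ->
  (forall s : R, 0 < s -> {for s, continuous k}) ->
  K s @[s --> (0:R)^'+] --> (0:R) ->
  (forall s : R, 0 < s < t -> `|k s| <= M /\ `|K s| <= M) ->
  (forall s : R, 0 < s -> is_derive s 1 h (h' s)) ->
  (forall s : R, 0 < s -> {for s, continuous h'}) ->
  h s @[s --> (0:R)^'+] --> a ->
  intble `]0, t[ h -> intble `]0, t[ h' ->
  \int[mu]_(s in `]0, t[) (k (t - s) * h s) =
  K t * a + \int[mu]_(s in `]0, t[) (K (t - s) * h' s).
Proof.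
move=> t0 dK ck K0 bnd dh ch' h0 hi h'i.
pose F (s : R) := K (t - s) * h s.
have mt : measurable (`]0, t[%classic : set R) by [].
have dsub (s : R) : is_derive s 1 (fun s => t - s) (-1).
  by refine (is_derive_eq (isd_add (isd_cst t s) (isd_opp (isd_id s))) _); rewrite add0r.
have dKs (s : R) : 0 < s < t -> is_derive s 1 (fun s => K (t - s)) (- k (t - s)).
  move=> /andP[s0 st]; refine (is_derive_eq (@isd_comp R K (fun s => t - s) s _ _ (dK _ _) (dsub s)) _).
    by rewrite subr_gt0.
  by rewrite mulrN1.
have cks (s : R) : 0 < s < t -> {for s, continuous (fun s => k (t - s))}.
  move=> /andP[s0 st]; apply: (@cts_comp R _ k (fun s => t - s)); last exact: is_derive_cts (dsub s).
  by apply: ck; rewrite subr_gt0.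
have sub (s : R) : 0 < s < t -> 0 < t - s < t.
  by move=> /andP[s0 st]; rewrite subr_gt0 st gtrBl.
have dF (s : R) : 0 < s < t -> is_derive s 1 F (K (t - s) * h' s - k (t - s) * h s).
  move=> /[dup] st /andP[s0 _]; refine (is_derive_eq (isd_mul (dKs s st) (dh s s0)) _).
  by rewrite mulrN (mulrC (h s)).
have cF (s : R) : 0 < s < t -> {for s, continuous (fun s => K (t - s) * h' s - k (t - s) * h s)}.
  move=> /[dup] st /andP[s0 _]; apply: cts_add; last apply: cts_opp; apply: cts_mul.
  - exact: is_derive_cts (dKs s st).
  - exact: ch'.
  - exact: cks.
  - exact: is_derive_cts (dh s s0).
have ot : open (`]0, t[%classic : set R) by exact: interval_open.
have iK : intble `]0, t[ (fun s => K (t - s) * h' s).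
  apply: (@intble_bndM _ _ _ _ M) => //.
    by apply: open_cont_meas => // s; rewrite /= in_itv/= => st; exact: is_derive_cts (dKs s st).
  by move=> s; rewrite /= in_itv/= => /sub/bnd[].
have ik : intble `]0, t[ (fun s => k (t - s) * h s).
  apply: (@intble_bndM _ _ _ _ M) => //.
    by apply: open_cont_meas => // s; rewrite /= in_itv/=; exact: cks.
  by move=> s; rewrite /= in_itv/= => /sub/bnd[].
have F0 : F s @[s --> (0:R)^'+] --> K t * a.
  apply: cvgM => //; have := dK t t0 => dKt.
  have : {for (0:R), continuous (fun s => K (t - s))}.
    apply: (@cts_comp R _ K (fun s => t - s)); last exact: is_derive_cts (dsub 0).
    by rewrite subr0; exact: is_derive_cts dKt.
  by move/cvg_at_right_filter; rewrite subr0.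
have Ft : F s @[s --> t^'-] --> 0 * h t.
  apply: cvgM; last by apply: cvg_at_left_filter; exact: is_derive_cts (dh t t0).
  apply/cvg_at_leftP => u [ut utt]; apply: ((cvg_at_rightP _ _ _).1 K0 (fun n => t - u n)).
  split => [n|]; first by rewrite subr_gt0.
  by rewrite -(subrr t); apply: cvgB => //; exact: cvg_cst.
have := FTC_oo t0 dF cF (intbleB mt iK ik) F0 Ft.
rewrite (@RintegralB _ (measurableTypeR R) R mu)// mul0r sub0r.
by move=> /sub_eqN.
Qed.

Let kernel_meas (K : R -> R) t : (forall s : R, 0 < s -> {for s, continuous K}) ->
  measurable_fun (`]0, t[%classic : set R) (fun s => K (t - s)).
Proof.
move=> cK; apply: open_cont_meas; first exact: interval_open.
move=> s; rewrite /= in_itv/= => /andP[s0 st].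
apply: (@cts_comp R _ K (fun s => t - s)); first by apply: cK; rewrite subr_gt0.
by apply: cts_add; [exact: cts_cst|apply: cts_opp; exact: cts_id].
Qed.

Lemma Psi_cts_t (w s : R) : 0 < s -> {for s, continuous (Psi w)}.
Proof. by move=> s0; exact: is_derive_cts (dPsi_t w s0). Qed.

Lemma heat_cts_t (w s : R) : 0 < s -> {for s, continuous (heat w)}.
Proof. by move=> s0; exact: is_derive_cts (dheat_t w s0). Qed.

Lemma Theta_cts_t (w s : R) : 0 < s -> {for s, continuous (Theta w)}.
Proof. by move=> s0; exact: is_derive_cts (dTheta_t w s0). Qed.

Lemma Theta_bnd x t (s : R) : 0 <= x -> 0 < s <= t ->
  `|Theta x s| <= 2 * t * (Num.sqrt (4 * pi * t))^-1 + x.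
Proof.
move=> x0 /andP[s0 st]; have t0 := lt_le_trans s0 st.
apply: (le_trans (ler_normB _ _)); apply: lerD; last first.
  by rewrite normrM (ger0_norm x0) ler_piMr ?norm_Psi_le1.
rewrite ger0_norm; last by rewrite !mulr_ge0 ?heat_ge0// ltW.
apply: (le_trans (ler_wpM2l _ (heat_le _ _))); first by rewrite mulr_ge0// ltW.
(* In this form the quantity is visibly increasing in [u], so that it may be evaluated at [t]
   instead of [s]. *)
have E (u : R) : 0 < u -> 2 * u * (Num.sqrt (4 * pi * u))^-1 = Num.sqrt (4 * pi * u) / (2 * pi).
  move=> u0; have p0 := pi_gt0 R; have q0 : 0 < 4 * pi * u by rewrite !mulr_gt0.
  have S0 : Num.sqrt (4 * pi * u) != 0 by rewrite gt_eqF// sqrtr_gt0.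
  have P2 : 2 * pi != 0 :> R by rewrite gt_eqF// mulr_gt0.
  apply: (mulIf S0); rewrite divfK// mulrAC -expr2 sqr_sqrtr ?(ltW q0)//.
  have -> : 4 * pi * u = 2 * u * (2 * pi) by ring.
  by rewrite mulfK.
rewrite !E// ler_wpM2r ?invr_ge0 ?mulr_ge0 ?pi_ge0// ler_sqrt; last first.
  by rewrite !mulr_ge0 ?pi_ge0// ltW.
by rewrite ler_wpM2l// mulr_ge0 ?pi_ge0.
Qed.

Lemma intble_Psi_duhamel h w t : intble `]0, t[ h ->
  intble `]0, t[ (fun s => Psi w (t - s) * h s).
Proof.
move=> hi; apply: (@intble_bndM _ _ _ _ 1) => //.
  by apply: kernel_meas; exact: Psi_cts_t.
by move=> s _; exact: norm_Psi_le1.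
Qed.

Lemma intble_Theta_duhamel h x t : 0 <= x -> intble `]0, t[ h ->
  intble `]0, t[ (fun s => Theta x (t - s) * h s).
Proof.
move=> x0 hi; apply: (@intble_bndM _ _ _ _ (2 * t * (Num.sqrt (4 * pi * t))^-1 + x)) => //.
  by apply: kernel_meas; exact: Theta_cts_t.
move=> s; rewrite /= in_itv/= => /andP[s0 st]; apply: Theta_bnd => //.
by rewrite subr_gt0 st gerBl ltW.
Qed.

Lemma intble_heat_duhamel h x t : 0 < x -> intble `]0, t[ h ->
  intble `]0, t[ (fun s => heat x (t - s) * h s).
Proof.
move=> x0 hi; apply: (@intble_bndM _ _ _ _ (Num.sqrt pi * x)^-1) => //.
  by apply: kernel_meas; exact: heat_cts_t.
by move=> s _; rewrite ger0_norm ?heat_ge0 ?heat_le_inv.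
Qed.

Lemma Psi_duhamel_derive h x t : 0 < x -> intble `]0, t[ h ->
  is_derive x 1 (fun x => \int[mu]_(s in `]0, t[) (Psi (- x) (t - s) * h s))
    (- \int[mu]_(s in `]0, t[) (heat x (t - s) * h s)).
Proof.
move=> x0 hi; have mt : measurable (`]0, t[%classic : set R) by [].
have -> : - (\int[mu]_(s in `]0, t[) (heat x (t - s) * h s)) =
    \int[mu]_(s in `]0, t[) (- 1 * (heat x (t - s) * h s)).
  by rewrite (@RintegralZl _ (measurableTypeR R) R mu)// ?mulN1r//; exact: intble_heat_duhamel.
(* Within [x / 2] of [x] one has [z > x / 2], where [heat z] is bounded uniformly in time, even near
   [s = t]. *)
apply: (@is_derive_under_integral _ _ (fun x s => Psi (- x) (t - s) * h s) (fun x s => - 1 * (heat x (t - s) * h s))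
   (fun s => (Num.sqrt pi * (x / 2))^-1 * `|h s|) x (x / 2)) => //.
- by rewrite divr_gt0.
- by move=> z _; exact: intble_Psi_duhamel.
- move=> z s _; rewrite /= in_itv/= => /andP[s0 st].
  have ts : 0 < t - s by rewrite subr_gt0.
  refine (is_derive_eq (isd_mul (@isd_comp R (Psi ^~ (t - s)) (fun z => - z) z _ _ (dPsi_w _ ts)
    (isd_opp (isd_id z))) (isd_cst (h s) z)) _).
  have -> : heat (- z) (t - s) = heat z (t - s) by rewrite /heat sqrrN.
  by ring.
- by apply: intbleZl => //; exact: intble_norm.
- move=> z s; rewrite ltr_norml => /andP[zx _] _.
  have z2 : x / 2 < z by lra.
  have z0 : 0 < z by apply: lt_trans z2; rewrite divr_gt0.
  rewrite mulN1r normrN normrM ler_wpM2r// ger0_norm ?heat_ge0//.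
  apply: (le_trans (heat_le_inv _ z0)); rewrite lef_pV2 ?posrE ?mulr_gt0 ?sqrtr_gt0 ?pi_gt0 ?divr_gt0//.
  by rewrite ler_wpM2l ?sqrtr_ge0// ltW.
Qed.

Lemma Theta_duhamel_derive h x t : 0 < x -> intble `]0, t[ h ->
  is_derive x 1 (fun x => \int[mu]_(s in `]0, t[) (Theta x (t - s) * h s))
    (- \int[mu]_(s in `]0, t[) (Psi (- x) (t - s) * h s)).
Proof.
move=> x0 hi; have mt : measurable (`]0, t[%classic : set R) by [].
have -> : - (\int[mu]_(s in `]0, t[) (Psi (- x) (t - s) * h s)) =
    \int[mu]_(s in `]0, t[) (- 1 * (Psi (- x) (t - s) * h s)).
  by rewrite (@RintegralZl _ (measurableTypeR R) R mu)// ?mulN1r//; exact: intble_Psi_duhamel.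
apply: (@is_derive_under_integral _ _ (fun x s => Theta x (t - s) * h s) (fun x s => - 1 * (Psi (- x) (t - s) * h s))
   (fun s => `|h s|) x x mt x0).
- move=> z; rewrite ltr_norml => /andP[zx _]; apply: intble_Theta_duhamel => //.
  by lra.
- move=> z s _; rewrite /= in_itv/= => /andP[s0 st].
  have ts : 0 < t - s by rewrite subr_gt0.
  refine (is_derive_eq (isd_mul (dTheta_x z ts) (isd_cst (h s) z)) _).
  by ring.
- exact: intble_norm.
- by move=> z s _ _; rewrite mulN1r normrN normrM ler_piMl ?norm_Psi_le1.
Qed.

End Potentials.

(** * Dirichlet and Neumann forms, and the passage from one to the other *)

Section Forms.
Context {R : realType}.
Notation mu := (@lebesgue_measure R).
Notation pos := (`]0, +oo[%classic : set R).

(* [f k] is the [k]-th derivative of a smooth function on the open half-line, with limit [a k] at [0]. *)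
Record smooth_jet (f : nat -> R -> R) (a : nat -> R) : Prop := SmoothJet {
  jet_derive : forall k (y : R), 0 < y -> is_derive y 1 (f k) (f k.+1 y);
  jet_zero : forall k, f k y @[y --> (0:R)^'+] --> a k;
  jet_intble : forall k (t : R), intble `]0, t[ (f k) }.

Record schwartz_jet (f : nat -> R -> R) (a : nat -> R) : Prop := SchwartzJet {
  sjet_smooth :> smooth_jet f a;
  sjet_intble : forall k, intble pos (f k);
  sjet_infty : forall k, f k y @[y --> +oo] --> (0 : R) }.

Definition Dform (c : R) (f h : R -> R) (x t : R) : R :=
  c + (\int[mu]_(y in pos) (Psi (x - y) t * f y) - \int[mu]_(y in pos) (Psi (- x - y) t * f y))
  + 2 * \int[mu]_(s in `]0, t[) (Psi (- x) (t - s) * h s).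

(** The bracket is a Duhamel integral of [heat] already integrated by parts: [d] stands for the
    initial value of the time datum and [h] for its derivative. Keeping [d] apart lets it be
    compared with the space trace. *)
Definition Nform (c : R) (f : R -> R) (d : R) (h : R -> R) (x t : R) : R :=
  c + (\int[mu]_(y in pos) (Psi (x - y) t * f y) + \int[mu]_(y in pos) (Psi (- x - y) t * f y))
  - 2 * (d * Theta x t + \int[mu]_(s in `]0, t[) (Theta x (t - s) * h s)).

Variables (f h : nat -> R -> R) (a b : nat -> R).
Hypotheses (fS : schwartz_jet f a) (hS : smooth_jet h b).

Let jet_cts (g : nat -> R -> R) c k (y : R) : smooth_jet g c -> 0 < y -> {for y, continuous (g k)}.
Proof. by move=> gS y0; exact: is_derive_cts (jet_derive gS k y0). Qed.

Lemma heat_jet_ibp k (x t : R) : 0 < t -> \int[mu]_(y in pos) (heat (x - y) t * f k y) =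
  Psi x t * a k + \int[mu]_(y in pos) (Psi (x - y) t * f k.+1 y).
Proof.
move=> t0; apply: heat_ibp => //.
- by move=> y y0; exact: jet_derive fS k y y0.
- by move=> y y0; exact: jet_cts fS y0.
- exact: sjet_intble fS k.
- exact: sjet_intble fS k.+1.
- exact: jet_zero fS k.
- exact: sjet_infty fS k.
Qed.

Let t_cvg : (fun s : R => s) @ (0:R)^'+ --> (0:R).
Proof. exact: cvg_at_right_filter cvg_id. Qed.

Let pos_near : \forall s \near (0:R)^'+, (0 : R) <= s.
Proof. by near=> s; apply: ltW. Unshelve. all: by end_near. Qed.

Let Theta0 (x : R) : 0 < x -> Theta x s @[s --> (0:R)^'+] --> (0 : R).
Proof.
move=> x0; have E : Theta x 0 = 0.
  by rewrite /Theta mulr0 mul0r /Psi ltxx oppr_gt0 ltNge (ltW x0) mulr0 subr0.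
rewrite -[X in _ --> X]E.
apply: (@Theta_cvg R R (0:R)^'+ _ (fun=> x) (fun s => s) x 0 (cvg_cst x) t_cvg pos_near) => //.
  by apply: nearW => ?; exact: ltW.
exact: ltW.
Qed.

Let Psi0 (x : R) : 0 < x -> Psi (- x) s @[s --> (0:R)^'+] --> (0 : R).
Proof.
move=> x0; have E : Psi (- x) 0 = 0 by rewrite /Psi ltxx oppr_gt0 ltNge (ltW x0).
rewrite -[X in _ --> X]E.
apply: (@Psi_cvg R R (0:R)^'+ _ (fun=> - x) (fun s => s) (- x) 0 (cvg_cst (- x)) t_cvg pos_near).
by right; split => //; rewrite oppr_eq0 gt_eqF.
Qed.

Lemma Theta_jet_ibp l (x t : R) : 0 < x -> 0 < t ->
  \int[mu]_(s in `]0, t[) (heat x (t - s) * h l s) =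
  Theta x t * b l + \int[mu]_(s in `]0, t[) (Theta x (t - s) * h l.+1 s).
Proof.
move=> x0 t0; apply: (@duhamel_ibp _ (heat x) (Theta x) (h l) (h l.+1) t (b l)
  ((Num.sqrt pi * x)^-1 + (2 * t * (Num.sqrt (4 * pi * t))^-1 + x))) => //.
- by move=> s; exact: dTheta_t.
- by move=> s; exact: heat_cts_t.
- exact: Theta0.
- move=> s /andP[s0 st].
  have B : `|Theta x s| <= 2 * t * (Num.sqrt (4 * pi * t))^-1 + x.
    by apply: Theta_bnd; rewrite ?s0 ltW.
  split; last by rewrite (le_trans B)// lerDr invr_ge0 mulr_ge0 ?sqrtr_ge0// ltW.
  rewrite ger0_norm ?heat_ge0// (le_trans (heat_le_inv _ x0))// lerDl.
  exact: le_trans (normr_ge0 _) B.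
- by move=> s s0; exact: jet_derive hS l s s0.
- by move=> s s0; exact: jet_cts hS s0.
- exact: jet_zero hS l.
- exact: jet_intble hS l t.
- exact: jet_intble hS l.+1 t.
Qed.

Lemma Psi_jet_ibp l (x t : R) : 0 < x -> 0 < t ->
  \int[mu]_(s in `]0, t[) (heat1 (- x) (t - s) * h l s) =
  Psi (- x) t * b l + \int[mu]_(s in `]0, t[) (Psi (- x) (t - s) * h l.+1 s).
Proof.
move=> x0 t0; apply: (@duhamel_ibp _ (heat1 (- x)) (Psi (- x)) (h l) (h l.+1) t (b l)
  (6 / (Num.sqrt pi * x ^+ 2) + 1)) => //.
- by move=> s; exact: dPsi_t.
- move=> s s0; apply: cts_mul; last exact: heat_cts_t.
  apply: cts_opp; apply: cts_mul; first exact: cts_cst.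
  apply: cts_inv; first by rewrite gt_eqF// mulr_gt0.
  by apply: cts_mul; [exact: cts_cst|exact: cts_id].
- exact: Psi0.
- move=> s /andP[s0 st]; split; last first.
    by rewrite (le_trans (norm_Psi_le1 _ _))// lerDr divr_ge0// mulr_ge0 ?sqrtr_ge0 ?sqr_ge0.
  have -> : `|heat1 (- x) s| = `|heat1 x s| by rewrite /heat1 /heat sqrrN !mulNr normrN.
  by rewrite (le_trans (heat1_bnd x0 s0))// lerDl.
- by move=> s s0; exact: jet_derive hS l s s0.
- by move=> s s0; exact: jet_cts hS s0.
- exact: jet_zero hS l.
- exact: jet_intble hS l t.
- exact: jet_intble hS l.+1 t.
Qed.

(** The two space traces enter with the same sign and sum to [a k] by [PsiDN], while the time trace
    [b l] goes into the [Theta] term. *)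
Lemma Dform_derive c k l (x t : R) : 0 < x -> 0 < t ->
  is_derive x 1 (fun x => Dform c (f k) (h l) x t) (Nform (a k) (f k.+1) (b l) (h l.+1) x t).
Proof.
move=> x0 t0; have fi := sjet_intble fS k; have hi := jet_intble hS l t.
refine (is_derive_eq (isd_add (isd_add (isd_cst c x) (isd_add (Psi_conv_derive x t0 fi)
  (isd_opp (Psi_convN_derive x t0 fi)))) (isd_mul (isd_cst 2 x) (Psi_duhamel_derive x0 hi))) _).
rewrite !heat_jet_ibp// Theta_jet_ibp// /Nform.
have := @PsiDN _ x t (or_introl t0); move: (Psi x t) (Psi (- x) t) => p q pq.
have -> : q = 1 - p by rewrite -pq addrC addKr.
by ring.
Qed.

(** The space traces now have opposite signs and leave [a k - 2 * a k * Psi (- x) t]; the derivative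
    of the [Theta] term compensates the second part because its coefficient is [a k]. *)
Lemma Nform_derive c k l (x t : R) : 0 < x -> 0 < t ->
  is_derive x 1 (fun x => Nform c (f k) (a k) (h l) x t) (Dform (a k) (f k.+1) (h l) x t).
Proof.
move=> x0 t0; have fi := sjet_intble fS k; have hi := jet_intble hS l t.
refine (is_derive_eq (isd_add (isd_add (isd_cst c x) (isd_add (Psi_conv_derive x t0 fi)
  (Psi_convN_derive x t0 fi))) (isd_opp (isd_mul (isd_cst 2 x) (isd_add
  (isd_mul (isd_cst (a k) x) (dTheta_x x t0)) (Theta_duhamel_derive x0 hi))))) _).
rewrite !heat_jet_ibp// /Dform.
have := @PsiDN _ x t (or_introl t0); move: (Psi x t) (Psi (- x) t) => p q pq.
have -> : q = 1 - p by rewrite -pq addrC addKr.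
by ring.
Qed.

(** The cancellation at order zero: integrating the dipole in time produces the trace [b 0], which
    has to match [a 0]. *)
Lemma Dform_heat (x t : R) : 0 < x -> 0 < t -> a 0%N = b 0%N ->
  \int[mu]_(y in pos) (heat (x - y) t * f 0%N y) - \int[mu]_(y in pos) (heat (- x - y) t * f 0%N y)
  + 2 * \int[mu]_(s in `]0, t[) (heat1 (- x) (t - s) * h 0%N s) =
  Dform (a 0%N) (f 1%N) (h 1%N) x t.
Proof.
move=> x0 t0 ab; rewrite !heat_jet_ibp// Psi_jet_ibp// /Dform -ab.
have := @PsiDN _ x t (or_introl t0); move: (Psi x t) (Psi (- x) t) => p q pq.
have -> : q = 1 - p by rewrite -pq addrC addKr.
by ring.
Qed.

(** Two space derivatives correspond to one time derivative. At odd orders the time datum has been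
    integrated by parts once more, whence its larger index. *)
Definition dform k (x t : R) : R :=
  if odd k then Nform (a k) (f k.+1) (b k./2.+1) (h k./2.+2) x t
  else Dform (a k) (f k.+1) (h k./2.+1) x t.

Lemma dform_derive k (x t : R) : 0 < x -> 0 < t -> (odd k -> a k.+1 = b k./2.+1) ->
  is_derive x 1 (fun x => dform k x t) (dform k.+1 x t).
Proof.
move=> x0 t0 ab; rewrite /dform /=; case: (boolP (odd k)) => ok /=.
  by rewrite uphalf_half ok add1n -(ab ok); exact: Nform_derive.
by rewrite uphalf_half (negbTE ok) add0n; exact: Dform_derive.
Qed.

End Forms.

(** * Limits at the boundary of the quadrant *)

Section Boundary.
Context {R : realType}.
Notation mu := (@lebesgue_measure R).
Notation pos := (`]0, +oo[%classic : set R).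
Variable p0 : R * R.
Hypotheses (p01 : 0 <= p0.1) (p02 : 0 <= p0.2).
Let A := @closed_quadrant0 R.
Notation W := (within A (nbhs p0)).

Let W2 : \forall p \near W, 0 <= p.2.
Proof. by apply: (filterS _ (withinT A _)) => p []. Qed.

Let W1 : \forall p \near W, 0 <= p.1.
Proof. by apply: (filterS _ (withinT A _)) => p []. Qed.

Let cvg1 : p.1 @[p --> W] --> p0.1.
Proof. by apply: cvg_within_filter; exact: cvg_fst. Qed.

Let cvg2 : p.2 @[p --> W] --> p0.2.
Proof. by apply: cvg_within_filter; exact: cvg_snd. Qed.

Let nearP (P : R * R -> Prop) : (forall p, P p) -> \forall p \near p0, P p.
Proof.
move=> H; have F := nbhs_filter p0.
exact: (@filterS _ _ F setT P (fun p _ => H p) (@filterT _ _ F)).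
Qed.

Lemma Psi_conv_cvg (e : R) (f : R -> R) : intble pos f ->
  (\int[mu]_(y in pos) (Psi (e * p.1 - y) p.2 * f y)) @[p --> W] -->
  \int[mu]_(y in pos) (Psi (e * p0.1 - y) p0.2 * f y).
Proof.
move=> fi; have mpos : measurable pos by [].
have mk (p : R * R) : measurable_fun pos (fun y => Psi (e * p.1 - y) p.2 * f y).
  apply: meas_mul; last exact: intble_meas.
  by apply: measurable_funTS; exact: measurable_Psi.
have H1 : \forall p \near p0, A p -> measurable_fun pos (fun y => Psi (e * p.1 - y) p.2 * f y).
  by apply: nearP => p _.
have H2 : \forall p \near p0, A p -> forall y, pos y -> `|Psi (e * p.1 - y) p.2 * f y| <= `|f y|.
  by apply: nearP => p _ y _; rewrite normrM ler_piMl ?norm_Psi_le1.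
have H3 : {ae mu, forall y, pos y -> Psi (e * p.1 - y) p.2 * f y @[p --> W] --> Psi (e * p0.1 - y) p0.2 * f y}.
  (* The arguments of [Psi] can tend to its singular point only for this value of [y], a null
     set. *)
  exists [set e * p0.1]; split; [by []|exact: lebesgue_measure_set1|].
  move=> y /= nH; apply: contrapT => ye; apply: nH => _.
  apply: cvgM; last exact: cvg_cst.
  have we : e * p.1 - y @[p --> W] --> e * p0.1 - y.
    by apply: cvgB; [apply: cvgMr; exact: cvg1|exact: cvg_cst].
  have H := @Psi_cvg R _ W _ (fun p => e * p.1 - y) (fun p => p.2) (e * p0.1 - y) p0.2 we cvg2 W2.
  apply: H.
  move: p02; rewrite le_eqVlt => /predU1P[<-|]; last by left.
  by right; split => //; rewrite subr_eq0; apply/eqP => E; apply: ye; rewrite E.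
exact: (dominated_cvg_within mpos (intble_norm mpos fi) (mk p0) H1 H2 H3).
Qed.

(** The interval of integration moves with [p]. An indicator replaces it by the fixed interval []0,
    p0.2 + 1[], at the price of a possible jump at the single value [s = p0.2]. *)
Lemma duhamel_cvg (k : R -> R -> R) (C : R) (h : R -> R) :
  (forall s, 0 < s < p0.2 -> k p.1 (p.2 - s) @[p --> W] --> k p0.1 (p0.2 - s)) ->
  (\forall p \near p0, A p -> forall s, 0 < s <= p.2 -> `|k p.1 s| <= C) ->
  (forall x s : R, 0 < s -> {for s, continuous (k x)}) ->
  (forall t : R, intble `]0, t[ h) ->
  (\int[mu]_(s in `]0, p.2[) (k p.1 (p.2 - s) * h s)) @[p --> W] -->
  \int[mu]_(s in `]0, p0.2[) (k p0.1 (p0.2 - s) * h s).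
Proof.
move=> kcvg kC kcts hi.
pose T := p0.2 + 1; pose D : set R := `]0, T[%classic.
pose f (p : R * R) (s : R) : R := \1_(`]0, p.2[%classic : set R) s * (k p.1 (p.2 - s) * h s).
have mD : measurable D by exact: measurable_itv.
have fE (p : R * R) : p.2 <= T ->
    \int[mu]_(s in `]0, p.2[) (k p.1 (p.2 - s) * h s) = \int[mu]_(s in D) f p s.
  move=> pT; rewrite Rint_indicM [RHS]Rint_indicM; apply: eq_Rintegral => s _.
  rewrite /f !indicE; case: (boolP (s \in `]0, p.2[%classic)); last by rewrite !mul0r mulr0.
  move=> sp; have -> : s \in D; last by rewrite !mul1r.
  move: sp; rewrite !inE /D /= !in_itv/= => /andP[-> sp].
  exact: lt_le_trans sp pT.
have mf (p : R * R) : measurable_fun D (f p).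
  have mE : measurable (`]0, p.2[%classic : set R) by exact: measurable_itv.
  have mk : measurable_fun (`]0, p.2[%classic : set R) (fun s => k p.1 (p.2 - s) * h s).
    apply: meas_mul; last exact: intble_meas.
    apply: open_cont_meas; first exact: interval_open.
    move=> s; rewrite /= in_itv/= => /andP[s0 st].
    apply: (@cts_comp R _ (k p.1) (fun s => p.2 - s)); first by apply: kcts; rewrite subr_gt0.
    by apply: cts_add; [exact: cts_cst|apply: cts_opp; exact: cts_id].
  apply: measurable_funTS; have -> : f p = (fun s => k p.1 (p.2 - s) * h s) \_ `]0, p.2[%classic.
    by apply/funext => s; rewrite /f /patch indicE; case: ifPn; rewrite ?mul1r ?mul0r.
  by apply/(measurable_restrictT _ mE).
have nT : \forall p \near p0, p.2 < T.
  have : p.2 @[p --> p0] --> p0.2 by exact: cvg_snd.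
  by move/cvgr_lt; apply; rewrite ltrDl.
have W_T : \forall p \near W, p.2 < T by apply: filterS nT => p pT _.
rewrite fE; last by rewrite lerDl.
have : \int[mu]_(s in D) f p s @[p --> W] --> \int[mu]_(s in D) f p0 s.
  have H1 : \forall p \near p0, A p -> measurable_fun D (f p) by apply: nearP => p _.
  have H2 : \forall p \near p0, A p -> forall s, D s -> `|f p s| <= `|C| * `|h s|.
    apply: filterS kC => p kC Ap s _; rewrite /f indicE.
    have [|_] := boolP (s \in _); last by rewrite mul0r normr0 mulr_ge0.
    rewrite inE /= in_itv/= mul1r normrM => /andP[s0 sp].
    by rewrite ler_wpM2r// (le_trans _ (ler_norm C))// kC// subr_gt0 sp gerBl ltW.
  have H3 : {ae mu, forall s, D s -> f p s @[p --> W] --> f p0 s}.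
    exists [set p0.2]; split; [by []|exact: lebesgue_measure_set1|].
    move=> s /= nH; apply: contrapT => sp; apply: nH; rewrite /D /= in_itv/= => /andP[s0 _].
    case: (ltgtP s p0.2) sp => // sp _.
      have E (p : R * R) : s < p.2 -> f p s = k p.1 (p.2 - s) * h s.
        by move=> sp'; rewrite /f indicE mem_set ?mul1r//= in_itv/= s0.
      rewrite E//; have : k p.1 (p.2 - s) * h s @[p --> W] --> k p0.1 (p0.2 - s) * h s.
        by apply: cvgM; [apply: kcvg; rewrite s0|exact: cvg_cst].
      apply: cvg_trans; apply: near_eq_cvg.
      by apply: filterS (cvgr_gt _ cvg2 _ sp) => p /E ->.
    have E (p : R * R) : p.2 < s -> f p s = 0.
      by move=> sp'; rewrite /f indicE memNset ?mul0r//= in_itv/= s0 ltNge (ltW sp').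
    rewrite E//; apply: cvg_near_cst.
    by apply: filterS (cvgr_lt _ cvg2 _ sp) => p /E ->.
  exact: (dominated_cvg_within mD (intbleZl `|C| mD (intble_norm mD (hi T))) (mf p0) H1 H2 H3).
apply: cvg_trans; apply: near_eq_cvg.
by apply: filterS W_T => p pT; rewrite fE// ltW.
Qed.

Let sub_pos s : s < p0.2 -> \forall p \near W, 0 <= p.2 - s.
Proof. by move=> sp; apply: filterS (cvgr_gt _ cvg2 _ sp) => p ps; rewrite subr_ge0 ltW. Qed.

Let cvg_sub s : p.2 - s @[p --> W] --> p0.2 - s.
Proof. by apply: cvgB => //; exact: cvg_cst. Qed.

Lemma Psi_duhamel_cvg (h : R -> R) : (forall t : R, intble `]0, t[ h) ->
  (\int[mu]_(s in `]0, p.2[) (Psi (- p.1) (p.2 - s) * h s)) @[p --> W] -->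
  \int[mu]_(s in `]0, p0.2[) (Psi (- p0.1) (p0.2 - s) * h s).
Proof.
move=> hi; apply: (@duhamel_cvg (fun x => Psi (- x)) 1) => //.
- move=> s /andP[s0 sp].
  have H := @Psi_cvg R _ W _ (fun p => - p.1) (fun p => p.2 - s) (- p0.1) (p0.2 - s) (cvgN cvg1) (@cvg_sub s) (sub_pos sp).
  by apply: H; left; rewrite subr_gt0.
- by apply: nearP => p _ s _; exact: norm_Psi_le1.
- by move=> x s; exact: Psi_cts_t.
Qed.

Lemma Theta_duhamel_cvg (h : R -> R) : (forall t : R, intble `]0, t[ h) ->
  (\int[mu]_(s in `]0, p.2[) (Theta p.1 (p.2 - s) * h s)) @[p --> W] -->
  \int[mu]_(s in `]0, p0.2[) (Theta p0.1 (p0.2 - s) * h s).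
Proof.
move=> hi; pose T := p0.2 + 1.
apply: (@duhamel_cvg Theta (2 * T * (Num.sqrt (4 * pi * T))^-1 + (p0.1 + 1))) => //.
- move=> s /andP[s0 sp].
  have H := @Theta_cvg R _ W _ (fun p => p.1) (fun p => p.2 - s) p0.1 (p0.2 - s) cvg1 (@cvg_sub s) (sub_pos sp) W1 p01.
  by apply: H; rewrite subr_ge0 ltW.
- have n2 : \forall p \near p0, p.2 < T.
    have : p.2 @[p --> p0] --> p0.2 by exact: cvg_snd.
    by move/cvgr_lt; apply; rewrite ltrDl.
  have n1 : \forall p \near p0, p.1 < p0.1 + 1.
    have : p.1 @[p --> p0] --> p0.1 by exact: cvg_fst.
    by move/cvgr_lt; apply; rewrite ltrDl.
  apply: filterS2 n1 n2 => p p1 p2 [x0 _ _] s /andP[s0 sp].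
  apply: (le_trans (@Theta_bnd R p.1 T s x0 _)); last by rewrite lerD2l ltW.
  by rewrite s0 (le_trans sp)// ltW.
- by move=> x s; exact: Theta_cts_t.
Qed.

Section Jets.
Variables (f h : nat -> R -> R) (a b : nat -> R).
Hypotheses (fS : schwartz_jet f a) (hS : smooth_jet h b).

(** The base point may be any point of the closed quadrant, the origin included, so this yields both
    the continuity of the extension and the limit at the corner. *)
Lemma dform_cvg k : dform f h a b k p.1 p.2 @[p --> W] --> dform f h a b k p0.1 p0.2.
Proof.
have Pc e := @Psi_conv_cvg e (f k.+1) (sjet_intble fS k.+1).
have P1 : (\int[mu]_(y in pos) (Psi (p.1 - y) p.2 * f k.+1 y)) @[p --> W] -->
    \int[mu]_(y in pos) (Psi (p0.1 - y) p0.2 * f k.+1 y).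
  by have := Pc 1; under eq_fun do under eq_Rintegral do rewrite mul1r; rewrite mul1r.
have P2 : (\int[mu]_(y in pos) (Psi (- p.1 - y) p.2 * f k.+1 y)) @[p --> W] -->
    \int[mu]_(y in pos) (Psi (- p0.1 - y) p0.2 * f k.+1 y).
  by have := Pc (-1); under eq_fun do under eq_Rintegral do rewrite mulN1r; rewrite mulN1r.
rewrite /dform /Nform /Dform; case: ifPn => _.
  apply: cvgB; last apply: cvgMr; apply: cvgD.
  - exact: cvg_cst.
  - exact: cvgD.
  - apply: cvgMr.
    exact: (@Theta_cvg R _ W _ (fun p => p.1) (fun p => p.2) _ _ cvg1 cvg2 W2 W1 p01 p02).
  - by apply: Theta_duhamel_cvg; exact: jet_intble hS _.
apply: cvgD; first apply: cvgD; first exact: cvg_cst.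
  exact: cvgB.
by apply: cvgMr; apply: Psi_duhamel_cvg; exact: jet_intble hS _.
Qed.

End Jets.

End Boundary.

(** At time zero [Psi] is the indicator of positive arguments and the arguments here are [- y < 0];
    the Duhamel integrals run over an empty interval, and [Theta] is zero. *)
Lemma dform00 {R : realType} (f h : nat -> R -> R) (a b : nat -> R) k :
  dform f h a b k 0 0 = a k.
Proof.
have Z (F : R -> R) : \int[@lebesgue_measure R]_(s in `]0, 0[) F s = 0.
  rewrite Rint_indicM Rint_eq0// => s; rewrite indicE memNset ?mul0r//= in_itv/=.
  by case: ltgtP.
have P (F : R -> R) : \int[@lebesgue_measure R]_(y in `]0, +oo[) (Psi (0 - y) 0 * F y) = 0.
  rewrite Rint_indicM Rint_eq0// => y; rewrite indicE; have [|_] := boolP (y \in _); last by rewrite mul0r.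
  rewrite inE /= in_itv/= andbT => y0.
  by rewrite /Psi ltxx sub0r oppr_gt0 ltNge (ltW y0) mul0r mulr0.
rewrite /dform /Nform /Dform oppr0 !P !Z /Theta /heat !(mulr0, mul0r, addr0, subr0).
by case: ifP.
Qed.

(** * Reduction of the contour integrals to heat potentials *)

Section ComplexIntegral.
Context {R : realType}.
Notation mu := (@lebesgue_measure R).
Notation TR := (measurableTypeR R).
Notation C := R[i].
Notation Re := complex.Re.
Notation Im := complex.Im.
Notation pos := (`]0, +oo[%classic : set R).
Implicit Types (z w : C) (D : set R).

Lemma complex_eq z w : Re z = Re w -> Im z = Im w -> z = w.
Proof. by case: z w => [a b] [c d] /= -> ->. Qed.
Lemma complex_ReM z w : Re (z * w) = Re z * Re w - Im z * Im w. Proof. by case: z; case: w. Qed.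
Lemma complex_ImM z w : Im (z * w) = Re z * Im w + Im z * Re w. Proof. by case: z; case: w. Qed.
Lemma complex_ReD z w : Re (z + w) = Re z + Re w. Proof. by case: z; case: w. Qed.
Lemma complex_ImD z w : Im (z + w) = Im z + Im w. Proof. by case: z; case: w. Qed.
Lemma complex_ReN z : Re (- z) = - Re z. Proof. by case: z. Qed.
Lemma complex_ImN z : Im (- z) = - Im z. Proof. by case: z. Qed.
Lemma complex_ReC (x : R) : Re x%:C = x. Proof. by []. Qed.
Lemma complex_ImC (x : R) : Im x%:C = 0. Proof. by []. Qed.
Lemma Re_i : Re ('i%C : C) = 0. Proof. by []. Qed.
Lemma Im_i : Im ('i%C : C) = 1. Proof. by []. Qed.
Lemma Re_iM z : Re ('i%C * z) = - Im z.
Proof. by case: z => a b /=; rewrite mul0r mul1r sub0r. Qed.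
Lemma Im_iM z : Im ('i%C * z) = Re z.
Proof. by case: z => a b /=; rewrite mul0r mul1r add0r. Qed.
Lemma Re_Complex (a b : R) : Re (a +i* b) = a. Proof. by []. Qed.
Lemma Im_Complex (a b : R) : Im (a +i* b) = b. Proof. by []. Qed.
Lemma Re_cexp z : Re (cexp z) = expR (Re z) * cos (Im z).
Proof. by rewrite /cexp complex_ReM complex_ReC complex_ImC /= mul0r subr0. Qed.
Lemma Im_cexp z : Im (cexp z) = expR (Re z) * sin (Im z).
Proof. by rewrite /cexp complex_ImM complex_ReC complex_ImC /= mul0r addr0. Qed.

(** Together with [complex_eq] these rules reduce an identity in [R[i]] to two real ones within
    reach of [ring] or [field]. *)
Definition cE := (expr2, mulNr, Re_cexp, Im_cexp, Re_iM, Im_iM, complex_ReM, complex_ImM, complex_ReD, complex_ImD, complex_ReN, complex_ImN, complex_ReC, complex_ImC, Re_i, Im_i, Re_Complex, Im_Complex).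

Lemma cexpD z w : cexp (z + w) = cexp z * cexp w.
Proof.
apply: complex_eq; rewrite !cE expRD ?cosD ?sinD; ring.
Qed.

Let trig_le (a b p q : R) : `|p| <= 1 -> `|q| <= 1 -> `|p * a - q * b| <= `|a| + `|b|.
Proof.
by move=> p1 q1; rewrite (le_trans (ler_normB _ _))// lerD// normrM ler_piMl.
Qed.

Lemma norm_Re_cexpM z w : `|Re (cexp z * w)| <= expR (Re z) * (`|Re w| + `|Im w|).
Proof.
rewrite complex_ReM Re_cexp Im_cexp -!mulrA -mulrBr normrM (ger0_norm (expR_ge0 _)) ler_wpM2l ?expR_ge0//.
by rewrite trig_le ?norm_cos_le1 ?norm_sin_le1.
Qed.

Lemma norm_Im_cexpM z w : `|Im (cexp z * w)| <= expR (Re z) * (`|Re w| + `|Im w|).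
Proof.
rewrite complex_ImM Re_cexp Im_cexp -!mulrA -mulrDr normrM (ger0_norm (expR_ge0 _)) ler_wpM2l ?expR_ge0//.
rewrite [leRHS]addrC (le_trans (ler_normD _ _))// lerD// normrM.
  by rewrite ler_piMl ?norm_cos_le1.
by rewrite ler_piMl ?norm_sin_le1.
Qed.

Lemma norm_Re_cexp z : Re z <= 0 -> `|Re (cexp z)| <= 1.
Proof.
move=> z0; have e1 : expR (Re z) <= 1 by rewrite -[leRHS]expR0 ler_expR.
by rewrite Re_cexp normrM (ger0_norm (expR_ge0 _)) (le_trans _ e1)// ler_piMr ?norm_cos_le1 ?expR_ge0.
Qed.

Lemma norm_Im_cexp z : Re z <= 0 -> `|Im (cexp z)| <= 1.
Proof.
move=> z0; have e1 : expR (Re z) <= 1 by rewrite -[leRHS]expR0 ler_expR.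
by rewrite Im_cexp normrM (ger0_norm (expR_ge0 _)) (le_trans _ e1)// ler_piMr ?norm_sin_le1 ?expR_ge0.
Qed.

Definition cint D (f : R -> C) := intble D (fun x => Re (f x)) /\ intble D (fun x => Im (f x)).

Lemma cint_ext D (f g : R -> C) : (forall x, D x -> f x = g x) -> cintegral D f = cintegral D g.
Proof.
move=> fg; apply: complex_eq; apply: eq_Rintegral => x; rewrite inE => Dx; by rewrite fg.
Qed.

Lemma cintegralB D (f g : R -> C) : measurable D -> cint D f -> cint D g ->
  cintegral D f - cintegral D g = cintegral D (fun x => f x - g x).
Proof.
move=> mD [f1 f2] [g1 g2]; apply: complex_eq; rewrite !cE /=.
  rewrite -(@RintegralB _ TR R mu)//; by apply: eq_Rintegral => x _; rewrite !cE.
rewrite -(@RintegralB _ TR R mu)//; by apply: eq_Rintegral => x _; rewrite !cE.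
Qed.

Lemma cintegral_realM D (f : R -> C) (k : R -> R) :
  cintegral D (fun x => f x * (k x)%:C) =
  (\int[mu]_(x in D) (k x * Re (f x))) +i* (\int[mu]_(x in D) (k x * Im (f x))).
Proof.
by apply: complex_eq; apply: eq_Rintegral => x _; rewrite !cE; ring.
Qed.

(** [E] carries the decay along the contour, [e] is the bounded exponential of the transform.
    Splitting kernel and datum into real and imaginary parts gives four real instances of Fubini. *)
Lemma cfubini (D1 D2 : set R) (E : R -> C) (e : R -> R -> C) (f : R -> C) (a : R -> R) :
  measurable D1 -> measurable D2 ->
  measurable_fun (setT : set TR) (fun r => Re (E r)) -> measurable_fun (setT : set TR) (fun r => Im (E r)) ->
  measurable_fun (setT : set (TR * TR)) (fun p => Re (e p.1 p.2)) ->
  measurable_fun (setT : set (TR * TR)) (fun p => Im (e p.1 p.2)) ->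
  intble D1 a -> cint D2 f ->
  (forall r, D1 r -> `|Re (E r)| <= a r /\ `|Im (E r)| <= a r) ->
  (forall r y, D1 r -> D2 y -> `|Re (e r y)| <= 1 /\ `|Im (e r y)| <= 1) ->
  cint D2 (fun y => f y * cintegral D1 (fun r => E r * e r y)) /\
  cintegral D1 (fun r => E r * cintegral D2 (fun y => f y * e r y)) =
  cintegral D2 (fun y => f y * cintegral D1 (fun r => E r * e r y)).
Proof.
move=> m1 m2 mE1 mE2 me1 me2 ai [f1i f2i] Ea e1.
pose A1 (p : TR * TR) : R := Re (E p.1 * e p.1 p.2).
pose A2 (p : TR * TR) : R := Im (E p.1 * e p.1 p.2).
have mE1' : measurable_fun (setT : set (TR * TR)) (fun p => Re (E p.1)).
  by apply: (measurableT_comp mE1); exact: measurable_fst.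
have mE2' : measurable_fun (setT : set (TR * TR)) (fun p => Im (E p.1)).
  by apply: (measurableT_comp mE2); exact: measurable_fst.
have mA1 : measurable_fun setT A1.
  rewrite (_ : A1 = (fun p => Re (E p.1) * Re (e p.1 p.2) - Im (E p.1) * Im (e p.1 p.2))).
    by apply: meas_add; [exact: meas_mul|apply: meas_opp; exact: meas_mul].
  by apply/funext => p; rewrite /A1 complex_ReM.
have mA2 : measurable_fun setT A2.
  rewrite (_ : A2 = (fun p => Re (E p.1) * Im (e p.1 p.2) + Im (E p.1) * Re (e p.1 p.2))).
    by apply: meas_add; exact: meas_mul.
  by apply/funext => p; rewrite /A2 complex_ImM.
pose a2 r := 2 * a r.
have a2i : intble D1 a2 by exact: intbleZl.
have b1 r y : D1 r -> D2 y -> `|A1 (r, y)| <= a2 r.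
  move=> r1 y2; have [E1 E2] := Ea r r1; have [e1' e2'] := e1 r y r1 y2.
  rewrite /A1 /a2 /= complex_ReM mulr_natl mulr2n (le_trans (ler_normB _ _))// lerD// normrM.
    by rewrite -[leRHS]mulr1 ler_pM.
  by rewrite -[leRHS]mulr1 ler_pM.
have b2 r y : D1 r -> D2 y -> `|A2 (r, y)| <= a2 r.
  move=> r1 y2; have [E1 E2] := Ea r r1; have [e1' e2'] := e1 r y r1 y2.
  rewrite /A2 /a2 /= complex_ImM mulr_natl mulr2n (le_trans (ler_normD _ _))// lerD// normrM.
    by rewrite -[leRHS]mulr1 ler_pM.
  by rewrite -[leRHS]mulr1 ler_pM.
pose f1 y := Re (f y); pose f2 y := Im (f y).
have [i11 j11 E11] := Rfubini m1 m2 mA1 a2i f1i b1.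
have [i12 j12 E12] := Rfubini m1 m2 mA2 a2i f1i b2.
have [i21 j21 E21] := Rfubini m1 m2 mA1 a2i f2i b1.
have [i22 j22 E22] := Rfubini m1 m2 mA2 a2i f2i b2.
split.
  split.
    have := intbleB m2 j11 j22; apply: intble_eq => // y _; by rewrite /= complex_ReM.
  have := intbleD m2 j12 j21; apply: intble_eq => // y _; by rewrite /= complex_ImM.
have me1r r : measurable_fun (setT : set TR) (fun y => Re (e r y)).
  by have := measurableT_comp me1 (measurable_fun_pair (measurable_cst r) (@measurable_id _ TR setT)).
have me2r r : measurable_fun (setT : set TR) (fun y => Im (e r y)).
  by have := measurableT_comp me2 (measurable_fun_pair (measurable_cst r) (@measurable_id _ TR setT)).
have fe1 r (g : R -> R) : D1 r -> intble D2 g -> intble D2 (fun y => g y * Re (e r y)).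
  move=> r1 gi; have : intble D2 (fun y => Re (e r y) * g y).
    apply: (@intble_bndM _ _ _ _ 1) => //; first exact: measurable_funTS (me1r r).
    by move=> y y2; have [] := e1 r y r1 y2.
  by apply: intble_eq => // y _; rewrite mulrC.
have fe2 r (g : R -> R) : D1 r -> intble D2 g -> intble D2 (fun y => g y * Im (e r y)).
  move=> r1 gi; have : intble D2 (fun y => Im (e r y) * g y).
    apply: (@intble_bndM _ _ _ _ 1) => //; first exact: measurable_funTS (me2r r).
    by move=> y y2; have [] := e1 r y r1 y2.
  by apply: intble_eq => // y _; rewrite mulrC.
have L1 r (g : R -> R) : D1 r -> intble D2 g -> \int[mu]_(y in D2) (g y * A1 (r, y)) =
    Re (E r) * \int[mu]_(y in D2) (g y * Re (e r y)) - Im (E r) * \int[mu]_(y in D2) (g y * Im (e r y)).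
  move=> r1 gi; have h1 := fe1 r g r1 gi; have h2 := fe2 r g r1 gi.
  rewrite -!(@RintegralZl _ TR R mu)// -(@RintegralB _ TR R mu)//; [|exact: intbleZl|exact: intbleZl].
  by apply: eq_Rintegral => y _; rewrite /A1 /= complex_ReM; ring.
have L2 r (g : R -> R) : D1 r -> intble D2 g -> \int[mu]_(y in D2) (g y * A2 (r, y)) =
    Re (E r) * \int[mu]_(y in D2) (g y * Im (e r y)) + Im (E r) * \int[mu]_(y in D2) (g y * Re (e r y)).
  move=> r1 gi; have h1 := fe1 r g r1 gi; have h2 := fe2 r g r1 gi.
  rewrite -!(@RintegralZl _ TR R mu)// -(@RintegralD _ TR R mu)//; [|exact: intbleZl|exact: intbleZl].
  by apply: eq_Rintegral => y _; rewrite /A2 /= complex_ImM; ring.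
have Rc r : D1 r -> Re (cintegral D2 (fun y => f y * e r y)) =
    \int[mu]_(y in D2) (f1 y * Re (e r y)) - \int[mu]_(y in D2) (f2 y * Im (e r y)).
  move=> r1; rewrite -(@RintegralB _ TR R mu)//; [|exact: fe1|exact: fe2].
  by apply: eq_Rintegral => y _; rewrite complex_ReM.
have Ic r : D1 r -> Im (cintegral D2 (fun y => f y * e r y)) =
    \int[mu]_(y in D2) (f1 y * Im (e r y)) + \int[mu]_(y in D2) (f2 y * Re (e r y)).
  move=> r1; rewrite -(@RintegralD _ TR R mu)//; [|exact: fe2|exact: fe1].
  by apply: eq_Rintegral => y _; rewrite complex_ImM.
apply: complex_eq.
- transitivity (\int[mu]_(r in D1) (\int[mu]_(y in D2) (f1 y * A1 (r, y)) - \int[mu]_(y in D2) (f2 y * A2 (r, y)))).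
    apply: eq_Rintegral => r; rewrite inE => r1.
    by rewrite complex_ReM Rc// Ic// L1// L2//; ring.
  rewrite (@RintegralB _ TR R mu)// E11 E22 -(@RintegralB _ TR R mu)//.
  by apply: eq_Rintegral => y _; rewrite complex_ReM.
- transitivity (\int[mu]_(r in D1) (\int[mu]_(y in D2) (f1 y * A2 (r, y)) + \int[mu]_(y in D2) (f2 y * A1 (r, y)))).
    apply: eq_Rintegral => r; rewrite inE => r1.
    by rewrite complex_ImM Rc// Ic// L1// L2//; ring.
  rewrite (@RintegralD _ TR R mu)// E12 E21 -(@RintegralD _ TR R mu)//.
  by apply: eq_Rintegral => y _; rewrite complex_ImM.
Qed.

End ComplexIntegral.

Section CintLinear.
Context {R : realType}.
Notation mu := (@lebesgue_measure R).
Notation C := R[i].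
Implicit Types (D : set R).

Lemma cint_eq D (f g : R -> C) : measurable D -> (forall x, D x -> f x = g x) -> cint D f -> cint D g.
Proof.
by move=> mD fg [f1 f2]; split; [apply: intble_eq f1|apply: intble_eq f2] => // x; rewrite inE => /fg ->.
Qed.

Lemma cintB D (f g : R -> C) : measurable D -> cint D f -> cint D g -> cint D (fun x => f x - g x).
Proof.
move=> mD [f1 f2] [g1 g2]; split.
  by have := intbleB mD f1 g1; apply: intble_eq => // x _; rewrite !cE.
by have := intbleB mD f2 g2; apply: intble_eq => // x _; rewrite !cE.
Qed.

Lemma cintZ D (z : C) (f : R -> C) : measurable D -> cint D f -> cint D (fun x => z * f x).
Proof.
move=> mD [f1 f2]; split.
  have := intbleB mD (intbleZl (complex.Re z) mD f1) (intbleZl (complex.Im z) mD f2).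
  by apply: intble_eq => // x _; rewrite !cE.
have := intbleD mD (intbleZl (complex.Re z) mD f2) (intbleZl (complex.Im z) mD f1).
by apply: intble_eq => // x _; rewrite !cE.
Qed.

Lemma cintegralZ D (z : C) (f : R -> C) : measurable D -> cint D f ->
  z * cintegral D f = cintegral D (fun x => z * f x).
Proof.
move=> mD [f1 f2]; apply: complex_eq; rewrite !cE.
  rewrite -!(@RintegralZl _ (measurableTypeR R) R mu)// -(@RintegralB _ (measurableTypeR R) R mu)//;
    [|exact: intbleZl|exact: intbleZl].
  by apply: eq_Rintegral => x _; rewrite !cE.
rewrite -!(@RintegralZl _ (measurableTypeR R) R mu)// -(@RintegralD _ (measurableTypeR R) R mu)//;
  [|exact: intbleZl|exact: intbleZl].
by apply: eq_Rintegral => x _; rewrite !cE.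
Qed.

End CintLinear.

(** * Kernels produced by the two rays and by the real line *)

Section Rays.
Context {R : realType}.
Notation mu := (@lebesgue_measure R).
Notation TR := (measurableTypeR R).
Notation C := R[i].
Notation Re := complex.Re.
Notation Im := complex.Im.
Notation pos := (`]0, +oo[%classic : set R).

Let mpos : measurable pos. Proof. exact: measurable_itv. Qed.

Definition phase (w : C) (x t r : R) : C :=
  'i%C * (r%:C * w) * x%:C - (r%:C * w) ^+ 2 * t%:C.

Section OneRay.
Variables (c1 c : R).
Hypotheses (c0 : 0 < c) (cc : c1 ^+ 2 = c ^+ 2).
Let w : C := c1 +i* c.

(** On both rays, [c1 = c] and [c1 = - c], the square of [l] is purely imaginary, so all the decay
    comes from [x > 0]. *)
Lemma Re_phase x t r : Re (phase w x t r) = - (c * x * r).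
Proof.
rewrite /phase /w !cE; apply/eqP; rewrite -subr_eq0; apply/eqP.
have e : c1 * c1 = c * c by rewrite -!expr2.
transitivity (- (r ^+ 2 * t * (c1 * c1 - c * c))); first by ring.
by rewrite e subrr mulr0 oppr0.
Qed.

Lemma Im_phase x t r : Im (phase w x t r) = c1 * x * r - 2 * c1 * c * t * r ^+ 2.
Proof. by rewrite /phase /w !cE; ring. Qed.

Let exp_i (z : R) k : 0 < z -> intble pos (fun r => r ^+ k * expR (- (c * z * r))).
Proof. by move=> z0; apply: intble_rpow_exp; rewrite mulr_gt0. Qed.

Let meas_phase (x t : R) (W : R -> C) :
  measurable_fun (setT : set TR) (fun r => Re (W r)) -> measurable_fun (setT : set TR) (fun r => Im (W r)) ->
  measurable_fun (setT : set TR) (fun r => Re (cexp (phase w x t r) * W r)) /\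
  measurable_fun (setT : set TR) (fun r => Im (cexp (phase w x t r) * W r)).
Proof.
move=> mW1 mW2.
have P1 : measurable_fun (setT : set TR) (fun r => Re (cexp (phase w x t r))).
  rewrite (_ : (fun r => _) = (fun r => expR (- (c * x * r)) * cos (c1 * x * r - 2 * c1 * c * t * r ^+ 2))).
    by meas.
  by apply/funext => r; rewrite Re_cexp Re_phase Im_phase.
have P2 : measurable_fun (setT : set TR) (fun r => Im (cexp (phase w x t r))).
  rewrite (_ : (fun r => _) = (fun r => expR (- (c * x * r)) * sin (c1 * x * r - 2 * c1 * c * t * r ^+ 2))).
    by meas.
  by apply/funext => r; rewrite Im_cexp Re_phase Im_phase.
split.
  rewrite (_ : (fun r => _) = (fun r => Re (cexp (phase w x t r)) * Re (W r) - Im (cexp (phase w x t r)) * Im (W r))).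
    by apply: meas_add; [exact: meas_mul|apply: meas_opp; exact: meas_mul].
  by apply/funext => r; exact: complex_ReM.
rewrite (_ : (fun r => _) = (fun r => Re (cexp (phase w x t r)) * Im (W r) + Im (cexp (phase w x t r)) * Re (W r))).
  by apply: meas_add; exact: meas_mul.
by apply/funext => r; exact: complex_ImM.
Qed.

Let phase_bnd (x t r : R) (W : C) : `|Re (cexp (phase w x t r) * W)| <= expR (- (c * x * r)) * (`|Re W| + `|Im W|)
  /\ `|Im (cexp (phase w x t r) * W)| <= expR (- (c * x * r)) * (`|Re W| + `|Im W|).
Proof. by rewrite -(Re_phase x t r); split; [exact: norm_Re_cexpM|exact: norm_Im_cexpM]. Qed.

(** [hat f (- l)] contributes [exp (i l y)], of modulus at most 1 since [Im l > 0]; merged with the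
    phase it shifts [x] to [x + y]. *)
Lemma ray_initial (f : R -> C) (x t : R) : 0 < x -> cint pos f ->
  let k y := cintegral pos (fun r => cexp (phase w (x + y) t r) * w) in
  cint pos (fun y => f y * k y) /\
  cintegral pos (fun r => cexp (phase w x t r) * hat f (- (r%:C * w)) * w) =
  cintegral pos (fun y => f y * k y).
Proof.
move=> x0 fi k.
pose E (r : R) : C := cexp (phase w x t r) * w.
pose e (r y : R) : C := cexp (- 'i%C * - (r%:C * w) * y%:C).
have Ee r y : E r * e r y = cexp (phase w (x + y) t r) * w.
  rewrite /E /e mulrAC -cexpD; congr (cexp _ * _).
  by apply: complex_eq; rewrite /phase /w !cE; ring.
have [mE1 mE2] := @meas_phase x t (fun=> w) (measurable_cst _) (measurable_cst _).
have Re_e r y : Re (- 'i%C * - (r%:C * w) * y%:C) = - (c * r * y) by rewrite /w !cE; ring.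
have Im_e r y : Im (- 'i%C * - (r%:C * w) * y%:C) = c1 * r * y by rewrite /w !cE; ring.
have me1 : measurable_fun (setT : set (TR * TR)) (fun p => Re (e p.1 p.2)).
  rewrite (_ : (fun p => _) = (fun p : TR * TR => expR (- (c * p.1 * p.2)) * cos (c1 * p.1 * p.2))).
    by meas.
  by apply/funext => p; rewrite Re_cexp Re_e Im_e.
have me2 : measurable_fun (setT : set (TR * TR)) (fun p => Im (e p.1 p.2)).
  rewrite (_ : (fun p => _) = (fun p : TR * TR => expR (- (c * p.1 * p.2)) * sin (c1 * p.1 * p.2))).
    by meas.
  by apply/funext => p; rewrite Im_cexp Re_e Im_e.
have ai : intble pos (fun r => (`|c1| + `|c|) * (r ^+ 0 * expR (- (c * x * r)))).
  by apply: intbleZl => //; exact: exp_i.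
have [||ki kE] := @cfubini R pos pos E e f _ mpos mpos mE1 mE2 me1 me2 ai fi.
- by move=> r _; rewrite expr0 mul1r mulrC; exact: phase_bnd.
- move=> r y rp yp.
  have r0 : 0 < r by move: rp; rewrite /= in_itv/= andbT.
  have y0 : 0 < y by move: yp; rewrite /= in_itv/= andbT.
  have n0 : Re (- 'i%C * - (r%:C * w) * y%:C) <= 0 by rewrite Re_e oppr_le0 !mulr_ge0// ltW.
  by split; [exact: norm_Re_cexp|exact: norm_Im_cexp].
have kk y : cintegral pos (fun r => E r * e r y) = k y by apply: cint_ext => r _; rewrite Ee.
split.
  by apply: cint_eq ki; [exact: mpos|move=> y _; congr (_ * _); exact: kk].
rewrite (_ : cintegral pos (fun y => f y * k y) = cintegral pos (fun y => f y * cintegral pos (fun r => E r * e r y))).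
  by rewrite -kE; apply: cint_ext => r _; rewrite /E mulrAC; congr (_ * _).
by apply: cint_ext => y _; rewrite kk.
Qed.

(** [exp (l ^ 2 s)] has modulus 1 on the rays, and merged with the phase it turns [t] into
    [t - s]. *)
Lemma ray_boundary (g : R -> C) (x t : R) : 0 < x -> cint (`]0, t[%classic : set R) g ->
  let k s := cintegral pos (fun r => cexp (phase w x (t - s) r) * (r%:C * w * w)) in
  cint (`]0, t[%classic : set R) (fun s => g s * k s) /\
  cintegral pos (fun r => cexp (phase w x t r) * (r%:C * w) * tilde g (r%:C * w) t * w) =
  cintegral (`]0, t[%classic : set R) (fun s => g s * k s).
Proof.
move=> x0 gi k.
pose E (r : R) : C := cexp (phase w x t r) * (r%:C * w * w).
pose e (r s : R) : C := cexp ((r%:C * w) ^+ 2 * s%:C).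
have mt : measurable (`]0, t[%classic : set R) by exact: measurable_itv.
have Ee r s : E r * e r s = cexp (phase w x (t - s) r) * (r%:C * w * w).
  rewrite /E /e mulrAC -cexpD; congr (cexp _ * _).
  by apply: complex_eq; rewrite /phase /w !cE; ring.
have mW1 : measurable_fun (setT : set TR) (fun r : R => Re (r%:C * w * w)).
  rewrite (_ : (fun r => _) = (fun r : R => r * (c1 * c1 - c * c))); first by meas.
  by apply/funext => r; rewrite /w !cE; ring.
have mW2 : measurable_fun (setT : set TR) (fun r : R => Im (r%:C * w * w)).
  rewrite (_ : (fun r => _) = (fun r : R => r * (2 * c1 * c))); first by meas.
  by apply/funext => r; rewrite /w !cE; ring.
have [mE1 mE2] := @meas_phase x t (fun r => r%:C * w * w) mW1 mW2.
have Re_e r s : Re ((r%:C * w) ^+ 2 * s%:C) = 0.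
  rewrite /w !cE; transitivity (r * r * s * (c1 ^+ 2 - c ^+ 2)); first by ring.
  by rewrite cc subrr mulr0.
have Im_e r s : Im ((r%:C * w) ^+ 2 * s%:C) = 2 * c1 * c * r ^+ 2 * s by rewrite /w !cE; ring.
have me1 : measurable_fun (setT : set (TR * TR)) (fun p => Re (e p.1 p.2)).
  rewrite (_ : (fun p => _) = (fun p : TR * TR => expR 0 * cos (2 * c1 * c * p.1 ^+ 2 * p.2))).
    by meas.
  by apply/funext => p; rewrite Re_cexp Re_e Im_e.
have me2 : measurable_fun (setT : set (TR * TR)) (fun p => Im (e p.1 p.2)).
  rewrite (_ : (fun p => _) = (fun p : TR * TR => expR 0 * sin (2 * c1 * c * p.1 ^+ 2 * p.2))).
    by meas.
  by apply/funext => p; rewrite Im_cexp Re_e Im_e.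
have ReWW (r : R) : Re (r%:C * w * w) = r * Re (w * w).
  by rewrite -mulrA complex_ReM complex_ReC complex_ImC mul0r subr0.
have ImWW (r : R) : Im (r%:C * w * w) = r * Im (w * w).
  by rewrite -mulrA complex_ImM complex_ReC complex_ImC mul0r addr0.
pose M := `|Re (w * w)| + `|Im (w * w)|.
have ai : intble pos (fun r => M * (r ^+ 1 * expR (- (c * x * r)))).
  by apply: intbleZl => //; exact: exp_i.
have [||ki kE] := @cfubini R pos `]0, t[%classic E e g _ mpos mt mE1 mE2 me1 me2 ai gi.
- move=> r rp; have r0 : 0 < r by move: rp; rewrite /= in_itv/= andbT.
  have -> : M * (r ^+ 1 * expR (- (c * x * r))) =
     expR (- (c * x * r)) * (`|Re (r%:C * w * w)| + `|Im (r%:C * w * w)|).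
    rewrite ReWW ImWW !normrM (gtr0_norm r0) /M expr1; ring.
  exact: phase_bnd.
- by move=> r s _ _; split; [apply: norm_Re_cexp|apply: norm_Im_cexp]; rewrite Re_e.
have kk s : cintegral pos (fun r => E r * e r s) = k s by apply: cint_ext => r _; rewrite Ee.
split.
  by apply: cint_eq ki; [exact: mt|move=> y _; congr (_ * _); exact: kk].
rewrite (_ : cintegral `]0, t[%classic (fun y => g y * k y) =
   cintegral `]0, t[%classic (fun y => g y * cintegral pos (fun r => E r * e r y))).
  rewrite -kE; apply: cint_ext => r _; rewrite /E.
  have -> : tilde g (r%:C * w) t = cintegral `]0, t[%classic (fun y => g y * e r y).
    by apply: cint_ext => s _; rewrite mulrC.
  by ring.
by apply: cint_ext => y _; rewrite kk.
Qed.

Lemma intble_phase (z t : R) (k : nat) (b : R -> R) (M : R) : 0 < z ->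
  measurable_fun (setT : set TR) b -> (forall r, `|b r| <= M) ->
  intble pos (fun r => r ^+ k * expR (- (c * z * r)) * b r).
Proof.
move=> z0 mb bM; have : intble pos (fun r => b r * (r ^+ k * expR (- (c * z * r)))).
  by apply: (@intble_bndM _ _ _ _ M) => //; [exact: measurable_funTS|exact: exp_i].
by apply: intble_eq => // r _; rewrite mulrC.
Qed.

End OneRay.

Let c : R := cos (pi / 4).

Let sc : sin (pi / 4) = c.
Proof.
rewrite /c; have -> : pi / 4 = pi / 2 - pi / 4 :> R by field.
by rewrite sinB sin_pihalf cos_pihalf mul1r mul0r subr0; congr cos; field.
Qed.

Let c0 : 0 < c.
Proof.
rewrite /c cos_gt0_pihalf//; have := pi_gt0 R => p0.
by rewrite (lt_trans (_ : - (pi / 2) < 0))/= ?oppr_lt0 ?divr_gt0// ltr_pM2l// ltf_pV2 ?posrE// ltr_nat.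
Qed.

Let w1 : C := c +i* c.
Let w2 : C := (- c) +i* c.

Let ray1E : cexp ('i%C * (pi / 4)%:C) = w1.
Proof. by apply: complex_eq; rewrite /w1 !cE oppr0 expR0 mul1r ?sc. Qed.

Let ray2E : cexp ('i%C * (3 * pi / 4)%:C) = w2.
Proof.
have a34 : 3 * pi / 4 = pi - pi / 4 :> R by field.
have co : cos (3 * pi / 4) = - c by rewrite a34 cosB cospi sinpi mul0r addr0 mulN1r.
have si : sin (3 * pi / 4) = c by rewrite a34 sinB sinpi cospi mul0r sub0r mulN1r opprK sc.
by apply: complex_eq; rewrite /w2 !cE oppr0 expR0 mul1r ?co ?si.
Qed.

Let cc2 : (- c) ^+ 2 = c ^+ 2. Proof. by rewrite sqrrN. Qed.

Let RintN (u : R -> R) : intble pos u -> \int[mu]_(r in pos) (- u r) = - \int[mu]_(r in pos) u r.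
Proof.
move=> ui; rewrite -[RHS]mulN1r -(@RintegralZl _ TR R mu)//.
by apply: eq_Rintegral => r _; rewrite mulN1r.
Qed.

Let th (z t r : R) := c * z * r - 2 * c ^+ 2 * t * r ^+ 2.

Let th1E z t r : c * z * r - 2 * c * c * t * r ^+ 2 = th z t r.
Proof. by rewrite /th; ring. Qed.

Let th2E z t r : - c * z * r - 2 * - c * c * t * r ^+ 2 = - th z t r.
Proof. by rewrite /th; ring. Qed.

Let trig_int (z t : R) k : 0 < z ->
  intble pos (fun r => r ^+ k * expR (- (c * z * r)) * cos (th z t r)) /\
  intble pos (fun r => r ^+ k * expR (- (c * z * r)) * sin (th z t r)).
Proof.
move=> z0; split; apply: (@intble_phase c c0 z t k _ 1) => //.
- by rewrite /th; meas.
- by move=> r; exact: norm_cos_le1.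
- by rewrite /th; meas.
- by move=> r; exact: norm_sin_le1.
Qed.

Let complex_subE (y z : C) (a : R) : Re y = a -> Re z = - a -> Im y = Im z -> y - z = (2 * a)%:C.
Proof.
by move=> ya za yz; apply: complex_eq; rewrite !cE ?ya ?za ?yz; ring.
Qed.

Let complex_subiE (y z : C) (a : R) : Im y = a -> Im z = - a -> Re y = Re z ->
  y - z = 'i%C * (2 * a)%:C.
Proof.
by move=> ya za yz; apply: complex_eq; rewrite !cE ?ya ?za ?yz; ring.
Qed.

(** [w2] is minus the conjugate of [w1] and the two exponentials are conjugate, so the second
    integrand is minus the conjugate of the first, and the difference is twice a real part. *)
Lemma gamma_initial_kernel (z t : R) : 0 < z -> 0 < t ->
  cintegral pos (fun r => cexp (phase w1 z t r) * w1) - cintegral pos (fun r => cexp (phase w2 z t r) * w2) =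
  (2 * pi * heat z t)%:C.
Proof.
move=> z0 t0; have [ci si] := trig_int t 0 z0.
pose u r := expR (- (c * z * r)) * (c * cos (th z t r) - c * sin (th z t r)).
have ui : intble pos u.
  have := intbleB mpos (intbleZl c mpos ci) (intbleZl c mpos si).
  by apply: intble_eq => // r _; rewrite /u expr0; ring.
have A1 : Re (cintegral pos (fun r => cexp (phase w1 z t r) * w1)) = pi * heat z t.
  rewrite -(gamma_kernel0 z0 t0 c0); apply: eq_Rintegral => r _.
  by rewrite complex_ReM Re_cexp Im_cexp Re_phase// Im_phase th1E /w1 Re_Complex Im_Complex /th; ring.
have A2 : Re (cintegral pos (fun r => cexp (phase w2 z t r) * w2)) = - (pi * heat z t).
  rewrite -(gamma_kernel0 z0 t0 c0) -RintN//; apply: eq_Rintegral => r _.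
  rewrite complex_ReM Re_cexp Im_cexp Re_phase// Im_phase th2E cosN sinN /w2 Re_Complex Im_Complex.
  by rewrite /u /th; ring.
rewrite -mulrA; apply: (complex_subE A1 A2); apply: eq_Rintegral => r _.
rewrite !(complex_ImM (cexp _)) !Re_cexp !Im_cexp !Re_phase// !Im_phase th1E th2E cosN sinN.
by rewrite /w1 /w2 !Re_Complex !Im_Complex; ring.
Qed.

(** The additional factor [l] changes the sign once more: the two integrands are now conjugate, and
    the difference is [2 i] times an imaginary part. *)
Lemma gamma_boundary_kernel (z t : R) : 0 < z -> 0 < t ->
  cintegral pos (fun r => cexp (phase w1 z t r) * (r%:C * w1 * w1)) -
  cintegral pos (fun r => cexp (phase w2 z t r) * (r%:C * w2 * w2)) =
  'i%C * (2 * - (pi * heat1 z t))%:C.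
Proof.
move=> z0 t0; have [ci si] := trig_int t 1 z0.
pose u r := expR (- (c * z * r)) * (- (2 * c ^+ 2 * r) * cos (th z t r)).
have ui : intble pos u.
  have := intbleZl (- (2 * c ^+ 2)) mpos ci.
  by apply: intble_eq => // r _; rewrite /u expr1; ring.
have A1 : Im (cintegral pos (fun r => cexp (phase w1 z t r) * (r%:C * w1 * w1))) = - (pi * heat1 z t).
  rewrite -(gamma_kernel1 z0 t0 c0) -RintN//; apply: eq_Rintegral => r _.
  rewrite (complex_ImM (cexp _)) Re_cexp Im_cexp Re_phase// Im_phase th1E.
  rewrite !(complex_ReM, complex_ImM) complex_ReC complex_ImC.
  by rewrite /w1 Re_Complex Im_Complex /u /th; ring.
have A2 : Im (cintegral pos (fun r => cexp (phase w2 z t r) * (r%:C * w2 * w2))) = - - (pi * heat1 z t).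
  rewrite opprK -(gamma_kernel1 z0 t0 c0); apply: eq_Rintegral => r _.
  rewrite (complex_ImM (cexp _)) Re_cexp Im_cexp Re_phase// Im_phase th2E cosN sinN.
  rewrite !(complex_ReM, complex_ImM) complex_ReC complex_ImC.
  by rewrite /w2 Re_Complex Im_Complex /th; ring.
apply: (complex_subiE A1 A2); apply: eq_Rintegral => r _.
rewrite !(complex_ReM (cexp _)) !Re_cexp !Im_cexp !Re_phase// !Im_phase th1E th2E cosN sinN.
by rewrite !(complex_ReM, complex_ImM) complex_ReC complex_ImC /w1 /w2 !Re_Complex !Im_Complex; ring.
Qed.

Lemma line_kernel (z t : R) : 0 < t ->
  cintegral setT (fun l : R => cexp ('i%C * l%:C * z%:C - l%:C ^+ 2 * t%:C)) = (2 * pi * heat z t)%:C.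
Proof.
move=> t0.
have P1 (l : R) : Re ('i%C * l%:C * z%:C - l%:C ^+ 2 * t%:C) = - (t * l ^+ 2) by rewrite !cE; ring.
have P2 (l : R) : Im ('i%C * l%:C * z%:C - l%:C ^+ 2 * t%:C) = l * z by rewrite !cE; ring.
apply: complex_eq; rewrite ?complex_ReC ?complex_ImC.
  transitivity (\int[mu]_l (expR (- (t * l ^+ 2)) * cos (l * z + 0))).
    by apply: eq_Rintegral => l _; rewrite Re_cexp P1 P2 addr0.
  by rewrite gauss_fourierT// cos0 mulr1 -mulrA -heat_gaussE// [RHS]mulrC divfK.
(* The sine is the cosine with phase [- pi / 2], and the transform is proportional to the cosine of
   the phase, which is zero. *)
transitivity (\int[mu]_l (expR (- (t * l ^+ 2)) * cos (l * z + - (pi / 2)))).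
  apply: eq_Rintegral => l _.
  by rewrite Im_cexp P1 P2 cosB cos_pihalf sin_pihalf mulr0 add0r mulr1.
by rewrite gauss_fourierT// cosN cos_pihalf mulr0 mul0r.
Qed.

(** Here the transform factor has modulus 1, and the Gaussian in [l] supplies the domination. *)
Lemma line_initial (f : R -> C) (x t : R) : 0 < t -> cint pos f ->
  cintegral setT (fun l : R => cexp ('i%C * l%:C * x%:C - l%:C ^+ 2 * t%:C) * hat f l%:C) =
  cintegral pos (fun y => f y * (2 * pi * heat (x - y) t)%:C).
Proof.
move=> t0 fi.
pose E (l : R) : C := cexp ('i%C * l%:C * x%:C - l%:C ^+ 2 * t%:C).
pose e (l y : R) : C := cexp (- 'i%C * l%:C * y%:C).
have P1 (l : R) : Re ('i%C * l%:C * x%:C - l%:C ^+ 2 * t%:C) = - (t * l ^+ 2) by rewrite !cE; ring.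
have P2 (l : R) : Im ('i%C * l%:C * x%:C - l%:C ^+ 2 * t%:C) = l * x by rewrite !cE; ring.
have Re_e r y : Re (- 'i%C * r%:C * y%:C) = 0 :> R by rewrite !cE; ring.
have Im_e r y : Im (- 'i%C * r%:C * y%:C) = - (r * y) :> R by rewrite !cE; ring.
have mE1 : measurable_fun (setT : set TR) (fun r => Re (E r)).
  rewrite (_ : (fun r => _) = (fun l => expR (- (t * l ^+ 2)) * cos (l * x))); first by meas.
  by apply/funext => l; rewrite Re_cexp P1 P2.
have mE2 : measurable_fun (setT : set TR) (fun r => Im (E r)).
  rewrite (_ : (fun r => _) = (fun l => expR (- (t * l ^+ 2)) * sin (l * x))); first by meas.
  by apply/funext => l; rewrite Im_cexp P1 P2.
have me1 : measurable_fun (setT : set (TR * TR)) (fun p => Re (e p.1 p.2)).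
  rewrite (_ : (fun p => _) = (fun p : TR * TR => expR 0 * cos (- (p.1 * p.2)))); first by meas.
  by apply/funext => p; rewrite Re_cexp Re_e Im_e.
have me2 : measurable_fun (setT : set (TR * TR)) (fun p => Im (e p.1 p.2)).
  rewrite (_ : (fun p => _) = (fun p : TR * TR => expR 0 * sin (- (p.1 * p.2)))); first by meas.
  by apply/funext => p; rewrite Im_cexp Re_e Im_e.
have [||ki kE] := @cfubini R setT pos E e f _ measurableT mpos mE1 mE2 me1 me2 (intble_gauss t0) fi.
- move=> l _; rewrite /E Re_cexp Im_cexp P1 !normrM (ger0_norm (expR_ge0 _)).
  by split; rewrite ler_piMr ?norm_cos_le1 ?norm_sin_le1 ?expR_ge0.
- by move=> r s _ _; split; [apply: norm_Re_cexp|apply: norm_Im_cexp]; rewrite Re_e.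
transitivity (cintegral setT (fun l => E l * cintegral pos (fun y => f y * e l y))); first exact: cint_ext.
rewrite kE; apply: cint_ext => y _; congr (_ * _).
rewrite -[RHS](line_kernel (x - y) t0); apply: cint_ext => l _; rewrite /E /e -cexpD; congr cexp.
by apply: complex_eq; rewrite !cE; ring.
Qed.

(** Each initial kernel carries a factor [2 pi], and [- i / pi] times [2 pi i] is 2. As [heat] is
    even and [heat1] odd in space, the last two terms can be written at [- x]. *)
Lemma usolE (u0 g0 : R -> C) (x t : R) : 0 < x -> 0 < t ->
  cint pos u0 -> cint (`]0, t[%classic : set R) g0 ->
  usol u0 g0 x t =
    cintegral pos (fun y => u0 y * (heat (x - y) t)%:C)
    - cintegral pos (fun y => u0 y * (heat (- x - y) t)%:C)
    + (2 : R)%:C * cintegral (`]0, t[%classic : set R) (fun s => g0 s * (heat1 (- x) (t - s))%:C).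
Proof.
move=> x0 t0 ui gi; have p0 := pi_gt0 R.
have mt : measurable (`]0, t[%classic : set R) by exact: measurable_itv.
have [i1 E1] := @ray_initial c c c0 erefl u0 x t x0 ui.
have [i2 E2] := @ray_initial (- c) c c0 cc2 u0 x t x0 ui.
have [i3 E3] := @ray_boundary c c c0 erefl g0 x t x0 gi.
have [i4 E4] := @ray_boundary (- c) c c0 cc2 g0 x t x0 gi.
have hx y : heat (- x - y) t = heat (x + y) t by rewrite /heat -opprD sqrrN.
have P1 : pi != 0 :> R by rewrite gt_eqF.
have hi e : cint pos (fun y => u0 y * (heat (e - y) t)%:C).
  have [ui1 ui2] := ui; split; [have := intble_heat e t0 ui1|have := intble_heat e t0 ui2];
  by apply: intble_eq => // y _; rewrite !cE; ring.
have T1 : cintegral setT (fun l : R =>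
    cexp ('i%C * l%:C * x%:C - l%:C ^+ 2 * t%:C) * hat u0 l%:C) =
    (2 * pi)%:C * cintegral pos (fun y => u0 y * (heat (x - y) t)%:C).
  rewrite line_initial// cintegralZ//; apply: cint_ext => y _.
  by apply: complex_eq; rewrite !cE; ring.
have T2 : Gamma_integral (fun l => cexp ('i%C * l * x%:C - l ^+ 2 * t%:C) * hat u0 (- l)) =
    (2 * pi)%:C * cintegral pos (fun y => u0 y * (heat (- x - y) t)%:C).
  rewrite /Gamma_integral /ray_integral ray1E ray2E.
  transitivity (cintegral pos (fun y => u0 y * cintegral pos (fun r => cexp (phase w1 (x + y) t r) * w1)) -
    cintegral pos (fun y => u0 y * cintegral pos (fun r => cexp (phase w2 (x + y) t r) * w2))).
    by congr (_ - _); [exact: E1|exact: E2].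
  rewrite (cintegralZ (2 * pi)%:C mpos (hi (- x))) (cintegralB mpos i1 i2).
  apply: cint_ext => y yp; have y0 : 0 < y by move: yp; rewrite /= in_itv/= andbT.
  rewrite -mulrBr (gamma_initial_kernel (addr_gt0 x0 y0) t0) hx.
  by apply: complex_eq; rewrite !cE; ring.
pose G s := g0 s * (heat1 (- x) (t - s))%:C.
have FG s : (`]0, t[%classic : set R) s ->
    g0 s * cintegral pos (fun r => cexp (phase w1 x (t - s) r) * (r%:C * w1 * w1)) -
    g0 s * cintegral pos (fun r => cexp (phase w2 x (t - s) r) * (r%:C * w2 * w2)) =
    'i%C * (2 * pi)%:C * G s.
  rewrite /= in_itv/= => /andP[s0 st].
  rewrite -mulrBr gamma_boundary_kernel ?subr_gt0// /G.
  have -> : heat1 (- x) (t - s) = - heat1 x (t - s) by rewrite /heat1 /heat sqrrN !mulNr.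
  by apply: complex_eq; rewrite !cE; ring.
(* Integrability of [G] is inherited from the two ray integrals, whose difference is [2 pi i] times
   [G]. *)
have Gi : cint (`]0, t[%classic : set R) G.
  have := cintZ (- 'i%C * ((2 * pi)^-1)%:C) mt (cintB mt i3 i4); apply: cint_eq => // s ts.
  transitivity (- 'i%C * ((2 * pi)^-1)%:C * ('i%C * (2 * pi)%:C * G s)).
    by congr (_ * _); exact: FG.
  by move: (G s) (pi : R) P1 => z q q0; apply: complex_eq; rewrite !cE; field.
have T3 : Gamma_integral (fun l => cexp ('i%C * l * x%:C - l ^+ 2 * t%:C) * l * tilde g0 l t) =
    'i%C * (2 * pi)%:C * cintegral (`]0, t[%classic : set R) G.
  rewrite /Gamma_integral /ray_integral ray1E ray2E.
  transitivity (cintegral `]0, t[%classic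
      (fun s => g0 s * cintegral pos (fun r => cexp (phase w1 x (t - s) r) * (r%:C * w1 * w1))) -
    cintegral `]0, t[%classic
      (fun s => g0 s * cintegral pos (fun r => cexp (phase w2 x (t - s) r) * (r%:C * w2 * w2)))).
    by congr (_ - _); [exact: E3|exact: E4].
  by rewrite (cintegralZ ('i%C * (2 * pi)%:C) mt Gi) (cintegralB mt i3 i4); apply: cint_ext => s /FG.
rewrite /usol T1 T2 T3.
move: (cintegral _ _) (cintegral _ _) (cintegral _ _) (pi : R) P1 => I1 I2 I3 q q0.
by apply: complex_eq; rewrite !cE; field.
Qed.

End Rays.

(** * Derivatives of the data *)

Section ComplexLimits.
Context {R : realType}.
Notation Re := complex.Re.
Notation Im := complex.Im.

Lemma normc_ge_Im (z : R[i]) : `|Im z|%:C <= `|z|.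
Proof. by rewrite normc_def lecR -sqrtr_sqr ler_wsqrtr// lerDr sqr_ge0. Qed.

Lemma normc_le_ReIm (z : R[i]) : `|z| <= (`|Re z| + `|Im z|)%:C.
Proof.
rewrite normc_def lecR -(@ler_pXn2r _ 2) ?nnegrE ?sqrtr_ge0 ?addr_ge0//.
rewrite sqr_sqrtr ?addr_ge0 ?sqr_ge0// sqrrD !real_normK ?num_real//.
by rewrite addrAC lerDl mulrn_wge0// mulr_ge0.
Qed.

Lemma normc_le (z : R[i]) (b : R) : `|z| <= b%:C -> `|Re z| <= b /\ `|Im z| <= b.
Proof.
by move=> zb; split; rewrite -lecR; apply: le_trans zb; [exact: normc_ge_Re|exact: normc_ge_Im].
Qed.

Variables (T : Type) (F : set_system T).
Context {FF : Filter F}.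
Variables (f : T -> cplx R) (z : cplx R).

Lemma cvg_complex : Re (f x) @[x --> F] --> Re z -> Im (f x) @[x --> F] --> Im z ->
  f x @[x --> F] --> z.
Proof.
move=> /cvgrPdist_lt f1 /cvgrPdist_lt f2; apply/(@cvgrPdist_lt (cplx R) (cplx R)) => e e0.
(* The radius ranges over [R[i]], whose positive elements are real. *)
have [er eE] : 0 < Re e /\ e = (Re e)%:C.
  by move: (e : R[i]) e0 => [p q]; rewrite ltcE /= => /andP[/eqP -> ->].
have e2 : 0 < Re e / 2 by rewrite divr_gt0.
have := f1 _ e2; have := f2 _ e2; apply: filterS2 => x h2 h1.
rewrite eE; apply: le_lt_trans (normc_le_ReIm (z - f x)) _.
by rewrite ltcR !(complex_ReD, complex_ImD, complex_ReN, complex_ImN) [ltRHS]splitr ltrD.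
Qed.

Hypothesis fz : f x @[x --> F] --> z.

Let cvg_part (e : R) : 0 < e -> \forall x \near F, `|(z : R[i]) - f x| < e%:C.
Proof.
by move=> e0; have /(@cvgrPdist_lt (cplx R) (cplx R)) := fz; apply; rewrite -[0]/(0%:C) ltcR.
Qed.

Lemma cvg_Re : Re (f x) @[x --> F] --> Re z.
Proof.
apply/cvgrPdist_lt => e /cvg_part; apply: filterS => x h.
rewrite -complex_ReN -complex_ReD -ltcR; apply: le_lt_trans h; exact: normc_ge_Re.
Qed.

Lemma cvg_Im : Im (f x) @[x --> F] --> Im z.
Proof.
apply/cvgrPdist_lt => e /cvg_part; apply: filterS => x h.
rewrite -complex_ImN -complex_ImD -ltcR; apply: le_lt_trans h; exact: normc_ge_Im.
Qed.

End ComplexLimits.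

(** * Jets of the data, and the iterated derivatives of the solution *)

Section JetsOfDerivatives.
Context {R : realType}.
Notation mu := (@lebesgue_measure R).
Notation pos := (`]0, +oo[%classic : set R).
Notation Re := complex.Re.
Notation Im := complex.Im.

(** The limit bounds [f] near 0 and compactness bounds it on [[d, t]]. This makes every derivative
    of the data integrable up to 0. *)
Lemma bounded_near0 (f : R -> R) (a t : R) : (forall y, 0 < y -> {for y, continuous f}) ->
  f y @[y --> 0^'+] --> a -> exists M, forall y, 0 < y < t -> `|f y| <= M.
Proof.
move=> cf /cvgrPdist_lt /(_ 1 ltr01); rewrite near_withinE => /nbhs_ballP[d /= d0 fd].
have {}fd y : 0 < y < d -> `|f y| <= `|a| + 1.
  move=> /andP[y0 yd]; have /ltW h : `|a - f y| < 1.
    by apply: fd => //=; rewrite -ball_normE /= sub0r normrN gtr0_norm.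
  by rewrite -[f y](subKr a) (le_trans (ler_normB _ _))// lerD2l.
have [td|dt] := ltP t d.
  by exists (`|a| + 1) => y /andP[y0 yt]; apply: fd; rewrite y0 (lt_trans yt).
have [|c _ cM] := @EVT_max R (fun y => `|f y|) d t dt.
  apply: continuous_in_subspaceT => y; rewrite inE /= in_itv /= => /andP[dy _].
  by apply: cvg_norm; apply: cf; exact: lt_le_trans dy.
exists (`|a| + 1 + `|f c|) => y /andP[y0 yt]; have [yd|dy] := ltP y d.
  by rewrite (le_trans (fd y _)) ?y0// lerDl.
have h : `|f y| <= `|f c| by apply: (cM y); rewrite in_itv/= dy ltW.
by rewrite (le_trans h)// lerDr addr_ge0.
Qed.

Lemma smooth_jet_derive1n (g : R -> R) (a : nat -> R) :
  (forall N x, 0 < x -> derivable (derive1n N g) x 1) ->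
  (forall N, derive1n N g y @[y --> 0^'+] --> a N) ->
  smooth_jet (fun N => derive1n N g) a.
Proof.
move=> dg ga.
have ig N (y : R) : 0 < y -> is_derive y 1 (derive1n N g) (derive1n N.+1 g y).
  by move=> y0; rewrite derive1nS derive1E; apply: DeriveDef; [exact: dg|].
have cg N (y : R) : 0 < y -> {for y, continuous (derive1n N g)} by move=> y0; exact: is_derive_cts (ig N y y0).
split => // N t; have [M gM] := bounded_near0 t (cg N) (ga N).
apply: intble_oo_bnd gM; apply: open_cont_meas; first exact: interval_open.
by move=> y; rewrite /= in_itv/= => /andP[y0 _]; exact: cg.
Qed.

(** The weight [1 + y ^ 2] yields integrability on the half-line and decay at infinity together. *)
Lemma schwartz_jet_decay (f : nat -> R -> R) (a : nat -> R) : smooth_jet f a ->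
  (forall N, exists B, forall y, 0 < y -> `|f N y| * (1 + y ^+ 2) <= B) ->
  schwartz_jet f a.
Proof.
move=> fS fB; have cf N y : 0 < y -> {for y, continuous (f N)}.
  by move=> y0; exact: is_derive_cts (jet_derive fS N y0).
split=> // N; have [B NB] := fB N.
  apply: (@intble_le _ _ _ (fun r => B * (oneDsqr r)^-1)) => //.
  - apply: open_cont_meas; first exact: interval_open.
    by move=> y; rewrite /= in_itv/= andbT; exact: cf.
  - move=> y; rewrite /= in_itv/= andbT => y0.
    by rewrite ler_pdivlMr ?(lt_le_trans _ (oneDsqr_ge1 _))//; exact: NB.
  - by apply: intbleZl => //; exact: intble_oneDsqrV.
apply: (@cvg_pinfty_bnd _ _ B) => l l1; have l0 : 0 < l by exact: lt_le_trans l1.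
rewrite ler_pdivlMr// (le_trans _ (NB l l0))// ler_wpM2l//.
by rewrite -[leLHS]add0r lerD// ler_eXnr.
Qed.

Variable u : R -> R[i].

Lemma smooth_jet_ReIm : smooth_half u ->
  smooth_jet (fun N => derive1n N (fun y => Re (u y))) (fun N => Re (hderive N u 0)) /\
  smooth_jet (fun N => derive1n N (fun y => Im (u y))) (fun N => Im (hderive N u 0)).
Proof.
move=> uS.
have ul N : ((cderive1n N u y : cplx R) @[y --> (0 : R)^'+]) --> hderive N u 0.
  (* At 0 [hderive] is the right limit by definition, and [smooth_half] provides its existence. *)
  by have [_] := uS N; rewrite /hderive ltxx.
split; apply: smooth_jet_derive1n.
- by move=> N x x0; have [/(_ x x0)[]] := uS N.
- by move=> N; exact: cvg_Re (ul N).
- by move=> N x x0; have [/(_ x x0)[]] := uS N.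
- by move=> N; exact: cvg_Im (ul N).
Qed.

Lemma schwartz_jet_ReIm : schwartz_half u ->
  schwartz_jet (fun N => derive1n N (fun y => Re (u y))) (fun N => Re (hderive N u 0)) /\
  schwartz_jet (fun N => derive1n N (fun y => Im (u y))) (fun N => Im (hderive N u 0)).
Proof.
move=> [/smooth_jet_ReIm[u1 u2] uB].
have B N : exists B, forall y, 0 < y -> `|derive1n N (fun y => Re (u y)) y| * (1 + y ^+ 2) <= B
    /\ `|derive1n N (fun y => Im (u y)) y| * (1 + y ^+ 2) <= B.
  have [B0 h0] := uB 0%N N; have [B2 h2] := uB 2%N N; exists (B0 + B2) => y y0.
  have [p0 q0] := normc_le (h0 y (ltW y0)); have [p2 q2] := normc_le (h2 y (ltW y0)).
  move: p0 q0 p2 q2; rewrite /hderive y0 expr0 mul1r expr2 !(complex_ReM, complex_ImM).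
  rewrite !(complex_ReC, complex_ImC) !mul0r !mulr0 !subr0 !addr0 !mul0r !subr0 ?addr0 !normrM (gtr0_norm y0) => p0 q0 p2 q2.
  by rewrite !mulrDr !mulr1 expr2 ![_ * (y * y)]mulrC !lerD.
split; apply: schwartz_jet_decay => // N; have [B' NB] := B N; exists B' => y y0.
  by have [] := NB y y0.
by have [] := NB y y0.
Qed.

(** Equality with [dform] holds on the open half-line, hence near each of its points, and therefore
    passes to derivatives by induction on the order. *)
Lemma dform_derive1n (f h : nat -> R -> R) (a b : nat -> R) (U : R -> R) (t : R) (m : nat) :
  schwartz_jet f a -> smooth_jet h b -> 0 < t ->
  (forall x : R, 0 < x -> U x = dform f h a b 0 x t) ->
  (forall j, (j < m)%N -> odd j -> a j.+1 = b j./2.+1) ->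
  forall j, (j <= m)%N -> forall x : R, 0 < x -> derive1n j U x = dform f h a b j x t /\
    ((j < m)%N -> derivable (derive1n j U) x 1).
Proof.
move=> fS hS t0 U0 ab.
have step j : (j < m)%N -> (forall x : R, 0 < x -> derive1n j U x = dform f h a b j x t) ->
    forall x : R, 0 < x -> is_derive x 1 (derive1n j U) (dform f h a b j.+1 x t).
  move=> jm Uj x x0; apply: near_eq_is_derive (dform_derive fS hS x0 t0 (ab j jm)).
  by near=> y; rewrite Uj//; near: y; exact: lt_nbhsr.
have E j : (j <= m)%N -> forall x : R, 0 < x -> derive1n j U x = dform f h a b j x t.
  elim: j => [|j IH] jm x x0; first exact: U0.
  rewrite derive1nS derive1E; apply: derive_val.
  by apply: step => //; apply: IH; exact: ltnW.
move=> j jm x x0; split; first exact: E.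
by move=> jm'; apply: ex_derive; apply: step => //; exact: E.
Unshelve. all: by end_near. Qed.

End JetsOfDerivatives.

Theorem theorem8p1 (R : realType) (n : nat) (u0 g0 : R -> R[i]%C)
    (hu0 : schwartz_half u0) (hg0 : smooth_half g0)
    (hcompat : forall l : nat, (l <= n)%N ->
       hderive (2 * l) u0 0 = hderive l g0 0) :
  forall k : nat, (k <= 2 * n + 1)%N ->
    exists v : R * R -> cplx R,
      dxn_extension k (usol u0 g0) v /\
      v p @[p --> within (@closed_quadrant0 R) (nbhs (0, 0))] -->
        hderive k u0 0.
Proof.
move=> k kn.
have [f1 f2] := schwartz_jet_ReIm hu0; have [h1 h2] := smooth_jet_ReIm hg0.
have cu : cint `]0, +oo[%classic u0 by split; [exact: sjet_intble f1 0%N|exact: sjet_intble f2 0%N].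
have cg t : cint `]0, t[%classic g0 by split; [exact: jet_intble h1 0%N t|exact: jet_intble h2 0%N t].
(* An odd [j] below [2 n + 1] is at most [2 n - 1], so the index [j./2.+1] does not exceed [n] and
   the condition is available. *)
have co j : (j < 2 * n + 1)%N -> odd j -> hderive j.+1 u0 0 = hderive j./2.+1 g0 0.
  move=> jn oj; have e : j.+1 = (2 * j./2.+1)%N by rewrite -[in LHS](odd_double_half j) oj add1n mul2n doubleS.
  rewrite e hcompat//; move: jn (odd_double_half j); rewrite oj; lia.
pose F1 := dform (fun N => derive1n N (fun y => complex.Re (u0 y))) (fun N => derive1n N (fun y => complex.Re (g0 y)))
  (fun N => complex.Re (hderive N u0 0)) (fun N => complex.Re (hderive N g0 0)).
pose F2 := dform (fun N => derive1n N (fun y => complex.Im (u0 y))) (fun N => derive1n N (fun y => complex.Im (g0 y)))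
  (fun N => complex.Im (hderive N u0 0)) (fun N => complex.Im (hderive N g0 0)).
have c00 : hderive 0 u0 0 = hderive 0 g0 0 by rewrite -[0%N in LHS]/(2 * 0)%N hcompat.
(* The kernels are real, so they act on the real and imaginary parts of the data separately. *)
have Z1 t x : 0 < t -> 0 < x -> complex.Re (usol u0 g0 x t) = F1 0%N x t.
  move=> t0 x0; rewrite usolE// !cintegral_realM /F1 /dform /=.
  rewrite -(Dform_heat f1 h1 x0 t0) ?c00//.
  by rewrite mul0r subr0.
have Z2 t x : 0 < t -> 0 < x -> complex.Im (usol u0 g0 x t) = F2 0%N x t.
  move=> t0 x0; rewrite usolE// !cintegral_realM /F2 /dform /=.
  rewrite -(Dform_heat f2 h2 x0 t0) ?c00//.
  by rewrite mul0r addr0.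
have D1 t (t0 : 0 < t) := @dform_derive1n R _ _ _ _ (fun x => complex.Re (usol u0 g0 x t)) t (2 * n + 1) f1 h1 t0
  (fun x x0 => Z1 t x t0 x0) (fun j jn oj => congr1 (@complex.Re R) (co j jn oj)).
have D2 t (t0 : 0 < t) := @dform_derive1n R _ _ _ _ (fun x => complex.Im (usol u0 g0 x t)) t (2 * n + 1) f2 h2 t0
  (fun x x0 => Z2 t x t0 x0) (fun j jn oj => congr1 (@complex.Im R) (co j jn oj)).
have F1c p0 := fun p1 p2 => @dform_cvg R p0 p1 p2 _ _ _ _ f1 h1 k.
have F2c p0 := fun p1 p2 => @dform_cvg R p0 p1 p2 _ _ _ _ f2 h2 k.
(* The closed formula is continuous up to the boundary of the quadrant, and so is itself the
   extension. *)
exists (fun p => F1 k p.1 p.2 +i* F2 k p.1 p.2); split; first split.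
- move=> p [p1 p2] j jk; have jm := leq_trans jk kn; split.
    by have [_] := D1 _ p2 j (ltnW jm) _ p1; apply.
  by have [_] := D2 _ p2 j (ltnW jm) _ p1; apply.
- move=> p [p1 p2]; rewrite /dxn /cderive1n.
  by have [-> _] := D1 _ p2 k kn _ p1; have [-> _] := D2 _ p2 k kn _ p1.
- apply/subspace_continuousP => p [p1 p2 _]; apply: cvg_complex; [exact: F1c|exact: F2c].
- apply: cvg_complex.
    by have := @F1c (0, 0) (lexx _) (lexx _); rewrite /= dform00.
  by have := @F2c (0, 0) (lexx _) (lexx _); rewrite /= dform00.
Qed.
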